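(* Let $f\in\mathcal{S}$ and let $\gamma_3,\gamma_4$ be its logarithmic coefficients. Then $$|\gamma_4|-|\gamma_3|\le \frac{1}{\sqrt{7}}.$$
   Context: Let $\mathbb{D}=\{z\in\mathbb{C}:|z|<1\}$. $\mathcal{S}$ denotes the class of functions $f$ analytic and univalent in $\mathbb{D}$ with the normalization $f(z)=z+a_2z^2+a_3z^3+\cdots$ (i.e. $f(0)=0$, $f'(0)=1$). The logarithmic coefficients $\gamma_n$ of $f\in\mathcal{S}$ are defined by $$\log\frac{f(z)}{z}=2\sum_{n=1}^{\infty}\gamma_n z^n,\qquad z\in\mathbb{D},$$ where the branch of the logarithm is the one equal to $0$ at $z=0$. In particular $\gamma_3=\tfrac12\left(a_4-a_2a_3+\tfrac13a_2^3\right)$ and $\gamma_4=\tfrac12\left(a_5-a_2a_4-\tfrac12a_3^2+a_2^2a_3-\tfrac14a_2^4\right)$. *)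

(* Defs.v *)
From Stdlib Require Import Reals.
From Coquelicot Require Import Coquelicot.
Open Scope R_scope.

Definition unit_disk (z : C) : Prop := Cmod z < 1.

Definition taylor_on_disk (f : C -> C) (a : nat -> C) : Prop :=
  forall z : C, unit_disk z -> @is_pseries C_AbsRing C_NormedModule a z (f z).

Definition univalent_on_disk (f : C -> C) : Prop :=
  forall z w : C, unit_disk z -> unit_disk w -> f z = f w -> z = w.

Definition in_class_S (f : C -> C) (a : nat -> C) : Prop :=
  taylor_on_disk f a /\ univalent_on_disk f /\ a 0%nat = RtoC 0 /\ a 1%nat = RtoC 1.

Definition gamma3 (a : nat -> C) : C :=
  (/ 2) * (a 4%nat - a 2%nat * a 3%nat + (/ 3) * (a 2%nat * a 2%nat * a 2%nat)).

Definition gamma4 (a : nat -> C) : C :=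
  (/ 2) * (a 5%nat - a 2%nat * a 4%nat - (/ 2) * (a 3%nat * a 3%nat)
           + a 2%nat * a 2%nat * a 3%nat
           - (/ 4) * (a 2%nat * a 2%nat * a 2%nat * a 2%nat)).

(* Main.v *)
Require Import Defs.
From Stdlib Require Import Reals.
From Coquelicot Require Import Coquelicot.
From Stdlib Require Import Lra Lia ClassicalEpsilon.
Open Scope R_scope.

(** Write sqrt (v / f v) = 1 - w1 v - w3 v^2 - w5 v^3 - w7 v^4 - ...  Then
    gamma_4 - w1 gamma_3 = w7 + w3^2 / 2 - w1^4 / 12, and Gronwall's area theorem for the odd
    function phi z = sqrt (f (z^2)) gives |w1|^2 + 3 |w3|^2 + 5 |w5|^2 + 7 |w7|^2 <= 1; since
    |w1| <= 1, the bound follows by elementary estimates.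

    The area theorem is obtained from the positivity of logarithmic energy instead of Green's
    formula.  For real weights X of mean zero on the N-th roots of unity, the regularized energy
    of the images phi z is nonnegative; as ln |phi z - phi w| = ln |z - w| + Re L z w, where L is
    a logarithm of the divided difference of phi, letting N tend to infinity and then removing
    the regularization bounds the Fourier coefficients of L (Grunsky's inequalities).  Contour
    integrals are replaced throughout by means over the N-th roots of unity. *)

(** The multiple w1 of gamma_3 is the one that eliminates w5. In what remains, the area inequality
    lets |w7| reach 1 / sqrt 7, and any share of the area given to w1 or w3 lowers the bound for
    |w7| by at least as much as these coefficients can add: this is the origin of the constant. The
    obstacle is the boundary. Means over roots of unity live on the unit circle, where f need not be
    defined. Two dilations remove this: [R0] makes the Taylor series of f summable on the closed
    disk even with cubic weights, and [s] makes the divided difference of phi free of zeros there,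
    since the Hurwitz argument only reaches interior points. Both are undone by homogeneity in
    [pow_limit]. Weights of mean zero annihilate every term that depends on one point only. The
    regularization tau = (1 - rho)^2 / rho is chosen so that on the circle the regularized squared
    distance is |1 - rho z conj w|^2 up to the factor rho, whose logarithm has an explicit Fourier
    series. Testing the frequencies 1, 3, 5, 7 is enough, and the Grunsky form is only needed with z
    in one of its two slots: that row already contains the area inequality. *)

Lemma Cmod_add_le (a b : C) (A B : R) :
  Cmod a <= A -> Cmod b <= B -> Cmod (a + b)%C <= A + B.
Proof. intros; eapply Rle_trans; [apply Cmod_triangle|lra]. Qed.

Lemma Cmod_sub_le (a b : C) (A B : R) :
  Cmod a <= A -> Cmod b <= B -> Cmod (a - b)%C <= A + B.
Proof.
  intros; unfold Cminus; apply Cmod_add_le; [auto|now rewrite Cmod_opp].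
Qed.

Lemma Cmod_mul_le (a b : C) (A B : R) :
  Cmod a <= A -> Cmod b <= B -> Cmod (a * b)%C <= A * B.
Proof.
  intros; rewrite Cmod_mult; apply Rmult_le_compat; auto using Cmod_ge_0.
Qed.

Lemma Cmod_inv_le (a : C) (c : R) : 0 < c -> c <= Cmod a -> Cmod (/ a)%C <= / c.
Proof.
  intros Hc Ha. rewrite Cmod_inv; [apply Rinv_le_contravar; lra|].
  apply Cmod_gt_0; lra.
Qed.

Lemma Cmod_pos_neq (a : C) (c : R) : 0 < c -> c <= Cmod a -> a <> 0%C.
Proof. intros H1 H2; apply Cmod_gt_0; lra. Qed.

Lemma Cmod_sub_sym (a b : C) : Cmod (a - b)%C = Cmod (b - a)%C.
Proof. rewrite <- Cmod_opp; f_equal; ring. Qed.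

Lemma Cmod_sub_ge (a b : C) : Cmod a - Cmod b <= Cmod (a - b)%C.
Proof.
  assert (Cmod a <= Cmod (a - b)%C + Cmod b); [|lra].
  replace a with ((a - b) + b)%C at 1 by ring. apply Cmod_triangle.
Qed.

(** * Uniformly holomorphic families and their algebra *)

Definition annulus (r : R) (z : C) : Prop := r <= Cmod z <= 1.

(* Holomorphy of the family K i, uniform in i, with derivative K1 i: a first order Taylor
   expansion with quadratic remainder.  On a closed disk or annulus this is stable under the
   algebraic operations and replaces the usual notion of analyticity. *)
Definition UH {I : Type} (P : I -> Prop) (r : R) (K K1 : I -> C -> C) : Prop :=
  exists M, 0 <= M /\ forall i z, P i -> annulus r z ->
    Cmod (K i z) <= M /\ Cmod (K1 i z) <= M /\
    forall h, annulus r (z + h)%C ->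
      Cmod (K i (z + h)%C - K i z - h * K1 i z)%C <= M * Cmod h ^ 2.

Section Families.
Context {I : Type} {P : I -> Prop} {r : R}.

Lemma annulus_add0 (z : C) : annulus r z -> annulus r (z + 0)%C.
Proof. now rewrite Cplus_0_r. Qed.

Lemma UH_intro (K K1 : I -> C -> C) (A B D : R) :
  (forall i z, P i -> annulus r z -> Cmod (K i z) <= A) ->
  (forall i z, P i -> annulus r z -> Cmod (K1 i z) <= B) ->
  (forall i z h, P i -> annulus r z -> annulus r (z + h)%C ->
     Cmod (K i (z + h)%C - K i z - h * K1 i z)%C <= D * Cmod h ^ 2) ->
  UH P r K K1.
Proof.
  intros HA HB HD. exists (Rabs A + Rabs B + Rabs D).
  pose proof (Rle_abs A); pose proof (Rle_abs B); pose proof (Rle_abs D).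
  pose proof (Rabs_pos A); pose proof (Rabs_pos B); pose proof (Rabs_pos D).
  split; [lra|]. intros i z Hi Hz; split; [|split].
  - specialize (HA i z Hi Hz); lra.
  - specialize (HB i z Hi Hz); lra.
  - intros h Hh; specialize (HD i z h Hi Hz Hh).
    eapply Rle_trans; [exact HD|apply Rmult_le_compat_r; [apply pow2_ge_0|lra]].
Qed.

Lemma annulus_step (z h : C) : annulus r z -> annulus r (z + h)%C -> Cmod h <= 2.
Proof.
  intros [_ Hz] [_ Hh]. replace h with ((z + h) - z)%C by ring.
  eapply Rle_trans; [apply Cmod_sub_le; eassumption|lra].
Qed.

(** The annulus is not convex, so no integration along segments is available. Instead [Cmod h] is at
    most 2, so that the quadratic remainder is itself at most [2 * M * Cmod h]; with the derivative
    term this gives the factor 3. *)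
Lemma UH_lip (K K1 : I -> C -> C) : UH P r K K1 ->
  exists M, 0 <= M /\ forall i z h, P i -> annulus r z -> annulus r (z + h)%C ->
    Cmod (K i z) <= M /\ Cmod (K1 i z) <= M /\
    Cmod (K i (z + h)%C - K i z)%C <= M * Cmod h /\
    Cmod (K i (z + h)%C - K i z - h * K1 i z)%C <= M * Cmod h ^ 2.
Proof.
  intros (M & HM & HK). exists (3 * M); split; [lra|].
  intros i z h Hi Hz Hh. destruct (HK i z Hi Hz) as (H1 & H2 & H3).
  specialize (H3 h Hh). pose proof (annulus_step z h Hz Hh) as H4.
  pose proof (Cmod_ge_0 h) as H5.
  repeat split; try lra.
  - replace (K i (z + h) - K i z)%C
      with ((K i (z + h) - K i z - h * K1 i z) + h * K1 i z)%C by ring.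
    eapply Rle_trans; [apply Cmod_add_le; [exact H3|]|].
    + apply Cmod_mul_le; [apply Rle_refl|exact H2].
    + simpl; rewrite Rmult_1_r. assert (Cmod h * Cmod h <= 2 * Cmod h) by nra. nra.
  - eapply Rle_trans; [exact H3|]. pose proof (pow2_ge_0 (Cmod h)); nra.
Qed.

Lemma UH_ext (K K1 L L1 : I -> C -> C) :
  (forall i z, P i -> annulus r z -> K i z = L i z) ->
  (forall i z, P i -> annulus r z -> K1 i z = L1 i z) ->
  UH P r K K1 -> UH P r L L1.
Proof.
  intros H H1 (M & HM & HK); exists M; split; auto.
  intros i z Hi Hz. rewrite <- (H i z), <- (H1 i z); auto.
  destruct (HK i z Hi Hz) as (A & B & D); repeat split; auto.
  intros h Hh; rewrite <- H; auto.
Qed.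

Lemma UH_const (c : I -> C) (M : R) :
  (forall i, P i -> Cmod (c i) <= M) -> UH P r (fun i _ => c i) (fun _ _ => 0%C).
Proof.
  intros H; apply (UH_intro _ _ M 0 0); auto.
  - intros; rewrite Cmod_0; lra.
  - intros i z h _ _ _. replace (c i - c i - h * 0)%C with (RtoC 0) by ring.
    rewrite Cmod_0; lra.
Qed.

Lemma UH_id : UH P r (fun _ z => z) (fun _ _ => 1%C).
Proof.
  apply (UH_intro _ _ 1 1 0); auto.
  - intros i z _ [_ H]; exact H.
  - intros; rewrite Cmod_1; lra.
  - intros i z h _ _ _. replace (z + h - z - h * 1)%C with (RtoC 0) by ring.
    rewrite Cmod_0; lra.
Qed.

Lemma UH_plus (K K1 L L1 : I -> C -> C) : UH P r K K1 -> UH P r L L1 ->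
  UH P r (fun i z => K i z + L i z)%C (fun i z => K1 i z + L1 i z)%C.
Proof.
  intros (M & HM & HK) (N & HN & HL); apply (UH_intro _ _ (M + N) (M + N) (M + N)).
  - intros i z Hi Hz; apply Cmod_add_le; [apply HK|apply HL]; auto.
  - intros i z Hi Hz; apply Cmod_add_le; [apply HK|apply HL]; auto.
  - intros i z h Hi Hz Hh.
    replace (K i (z + h) + L i (z + h) - (K i z + L i z) - h * (K1 i z + L1 i z))%C
      with ((K i (z + h) - K i z - h * K1 i z) + (L i (z + h) - L i z - h * L1 i z))%C
      by ring.
    rewrite Rmult_plus_distr_r; apply Cmod_add_le; [apply HK|apply HL]; auto.
Qed.

Lemma UH_mult (K K1 L L1 : I -> C -> C) : UH P r K K1 -> UH P r L L1 ->
  UH P r (fun i z => K i z * L i z)%C (fun i z => K1 i z * L i z + K i z * L1 i z)%C.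
Proof.
  intros HK HL. destruct (UH_lip _ _ HK) as (M & HM & HK').
  destruct (UH_lip _ _ HL) as (N & HN & HL').
  pose proof annulus_add0 as E.
  apply (UH_intro _ _ (M * N) (M * N + M * N) (M * N + M * N + M * N)).
  - intros i z Hi Hz; destruct (HK' i z _ Hi Hz (E z Hz)) as (A & _).
    destruct (HL' i z _ Hi Hz (E z Hz)) as (B & _). now apply Cmod_mul_le.
  - intros i z Hi Hz; destruct (HK' i z _ Hi Hz (E z Hz)) as (A & A1 & _).
    destruct (HL' i z _ Hi Hz (E z Hz)) as (B & B1 & _).
    apply Cmod_add_le; now apply Cmod_mul_le.
  - intros i z h Hi Hz Hh; destruct (HK' i z h Hi Hz Hh) as (A & A1 & A2 & A3).
    destruct (HL' i z h Hi Hz Hh) as (B & B1 & B2 & B3).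
    destruct (HL' i _ _ Hi Hh (E _ Hh)) as (B4 & _).
    replace (K i (z + h) * L i (z + h) - K i z * L i z
             - h * (K1 i z * L i z + K i z * L1 i z))%C
      with ((K i (z + h) - K i z - h * K1 i z) * L i (z + h)
            + h * K1 i z * (L i (z + h) - L i z)
            + K i z * (L i (z + h) - L i z - h * L1 i z))%C by ring.
    eapply Rle_trans; [repeat apply Cmod_add_le|].
    + apply Cmod_mul_le; eassumption.
    + apply Cmod_mul_le; [apply Cmod_mul_le; [apply Rle_refl|eassumption]|eassumption].
    + apply Cmod_mul_le; eassumption.
    + simpl; apply Req_le; ring.
Qed.

Lemma UH_scal (c : C) (K K1 : I -> C -> C) : UH P r K K1 ->
  UH P r (fun i z => c * K i z)%C (fun i z => c * K1 i z)%C.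
Proof.
  intros HK. eapply UH_ext; [| |apply UH_mult; [apply (UH_const (fun _ => c) (Cmod c))|exact HK]].
  - reflexivity.
  - intros; cbv beta; ring.
  - intros; lra.
Qed.

Lemma UH_minus (K K1 L L1 : I -> C -> C) : UH P r K K1 -> UH P r L L1 ->
  UH P r (fun i z => K i z - L i z)%C (fun i z => K1 i z - L1 i z)%C.
Proof.
  intros HK HL; eapply UH_ext;
    [| |apply UH_plus; [exact HK|apply (UH_scal (-1) _ _ HL)]]; intros; cbv beta; ring.
Qed.

Lemma UH_pow (K K1 : I -> C -> C) (n : nat) : UH P r K K1 ->
  exists K2, UH P r (fun i z => K i z ^ n)%C K2.
Proof.
  intros HK; induction n as [|n [K2 IH]].
  - eexists; apply (UH_const (fun _ => 1%C) 1); intros; rewrite Cmod_1; lra.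
  - eexists; eapply UH_mult; [exact HK|exact IH].
Qed.

(** The error of the expansion of 1 / K splits into a product of two first order differences and the
    remainder of K, each over a product of values of K; a lower bound uniform in the family then
    suffices. *)
Lemma UH_inv (K K1 : I -> C -> C) (c : R) : 0 < c ->
  (forall i z, P i -> annulus r z -> c <= Cmod (K i z)) -> UH P r K K1 ->
  UH P r (fun i z => / K i z)%C (fun i z => - (K1 i z / (K i z * K i z)))%C.
Proof.
  intros Hc Hlow HK. destruct (UH_lip _ _ HK) as (M & HM & HK').
  pose proof annulus_add0 as E.
  assert (Hi1 : forall i z, P i -> annulus r z -> Cmod (/ K i z)%C <= / c)
    by (intros; apply Cmod_inv_le; auto).
  assert (Hn : forall i z, P i -> annulus r z -> K i z <> 0%C)
    by (intros; eapply Cmod_pos_neq; eauto).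
  apply (UH_intro _ _ (/ c) (M * (/ c * / c))
           (M * (/ c * / c) + M * M * (/ c * / c * / c))).
  - auto.
  - intros i z Hi Hz; rewrite Cmod_opp.
    destruct (HK' i z _ Hi Hz (E z Hz)) as (_ & A & _).
    replace (K1 i z / (K i z * K i z))%C with (K1 i z * (/ K i z * / K i z))%C
      by (field; auto).
    apply Cmod_mul_le; auto; apply Cmod_mul_le; auto.
  - intros i z h Hi Hz Hh; destruct (HK' i z h Hi Hz Hh) as (A & A1 & A2 & A3).
    replace (/ K i (z + h) - / K i z - h * - (K1 i z / (K i z * K i z)))%C
      with ((h * K1 i z) * (K i (z + h) - K i z) * (/ K i z * / K i z * / K i (z + h))
            - (K i (z + h) - K i z - h * K1 i z) * (/ K i z * / K i (z + h)))%C
      by (field; split; auto).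
    eapply Rle_trans; [apply Cmod_sub_le|].
    + apply Cmod_mul_le; [apply Cmod_mul_le; [apply Cmod_mul_le;
        [apply Rle_refl|eassumption]|eassumption]|].
      apply Cmod_mul_le; [apply Cmod_mul_le|]; auto.
    + apply Cmod_mul_le; [eassumption|apply Cmod_mul_le; auto].
    + simpl; apply Req_le; ring.
Qed.

(** A positive lower bound for the real part keeps s(z) + s(z') away from 0, so that s(z') - s(z) =
    (q(z') - q(z)) / (s(z') + s(z)). Regularity of the root is thus inherited from q, with no
    continuity of [s] assumed. *)
Lemma UH_sqrt (s q q1 : I -> C -> C) (c : R) : 0 < c ->
  (forall i z, P i -> annulus r z -> (s i z * s i z)%C = q i z /\ c <= Re (s i z)) ->
  UH P r q q1 ->
  UH P r s (fun i z => q1 i z * / (2 * s i z))%C.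
Proof.
  intros Hc Hs Hq. destruct (UH_lip _ _ Hq) as (M & HM & Hq').
  pose proof annulus_add0 as E.
  assert (Hlow : forall i z i' z', P i -> annulus r z -> P i' -> annulus r z' ->
            c <= Cmod (s i z + s i' z')%C).
  { intros i z i' z' Hi Hz Hi' Hz'. destruct (Hs i z Hi Hz) as [_ A].
    destruct (Hs i' z' Hi' Hz') as [_ B].
    eapply Rle_trans; [|eapply Rle_trans; [apply Rle_abs|apply re_le_Cmod]].
    simpl in *; unfold Re in *; lra. }
  assert (H2 : forall i z, (2 * s i z)%C = (s i z + s i z)%C) by (intros; ring).
  assert (Hi2 : forall i z, P i -> annulus r z -> Cmod (/ (2 * s i z))%C <= / c)
    by (intros; rewrite H2; apply Cmod_inv_le; auto).
  assert (Hn : forall i z, P i -> annulus r z -> s i z <> 0%C).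
  { intros i z Hi Hz H0. specialize (Hlow i z i z Hi Hz Hi Hz).
    rewrite H0, Cplus_0_r, Cmod_0 in Hlow; lra. }
  assert (Hd : forall i z z', P i -> annulus r z -> annulus r z' ->
            (s i z' - s i z)%C = ((q i z' - q i z) * / (s i z' + s i z))%C).
  { intros i z z' Hi Hz Hz'. rewrite <- (proj1 (Hs i z Hi Hz)), <- (proj1 (Hs i z' Hi Hz')).
    field. eapply Cmod_pos_neq; [exact Hc|]. auto. }
  (* From |s|^2 = |q| <= M follows |s| <= 1 + M, which avoids a real square root. *)
  apply (UH_intro _ _ (1 + M) (M * / c)
           (M * / c + M * (M * / c) * (/ c * / c))).
  - intros i z Hi Hz. destruct (Hq' i z _ Hi Hz (E z Hz)) as (A & _).
    rewrite <- (proj1 (Hs i z Hi Hz)), Cmod_mult in A.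
    pose proof (Cmod_ge_0 (s i z)); nra.
  - intros i z Hi Hz. destruct (Hq' i z _ Hi Hz (E z Hz)) as (_ & A & _).
    apply Cmod_mul_le; auto.
  - intros i z h Hi Hz Hh; destruct (Hq' i z h Hi Hz Hh) as (A & A1 & A2 & A3).
    assert (Hm : Cmod (/ (s i (z + h) + s i z))%C <= / c) by (apply Cmod_inv_le; auto).
    replace (s i (z + h) - s i z - h * (q1 i z * / (2 * s i z)))%C
      with ((q i (z + h) - q i z - h * q1 i z) * / (s i (z + h) + s i z)
            - h * q1 i z * (s i (z + h) - s i z) * (/ (2 * s i z) * / (s i (z + h) + s i z)))%C.
    2:{ rewrite (Hd i z (z + h)%C) at 1 by auto.
        rewrite <- (proj1 (Hs i z Hi Hz)), <- (proj1 (Hs i _ Hi Hh)).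
        field. split; [auto|]. eapply Cmod_pos_neq; [exact Hc|]. auto. }
    assert (Hl : Cmod (s i (z + h) - s i z)%C <= M * Cmod h * / c).
    { rewrite Hd by auto. apply Cmod_mul_le; auto. }
    eapply Rle_trans; [apply Cmod_sub_le|].
    + apply Cmod_mul_le; eassumption.
    + apply Cmod_mul_le; [apply Cmod_mul_le; [apply Cmod_mul_le;
        [apply Rle_refl|eassumption]|eassumption]|].
      apply Cmod_mul_le; [apply (Hi2 i z Hi Hz)|exact Hm].
    + simpl; apply Req_le; ring.
Qed.

Lemma UH_comp (r' : R) (u u1 : I -> C -> C) (L L1 : I -> C -> C) :
  UH P r u u1 -> UH P r' L L1 ->
  (forall i z, P i -> annulus r z -> annulus r' (u i z)) ->
  UH P r (fun i z => L i (u i z)) (fun i z => L1 i (u i z) * u1 i z)%C.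
Proof.
  intros Hu (N & HN & HL) Hm. destruct (UH_lip _ _ Hu) as (M & HM & Hu').
  pose proof annulus_add0 as E.
  apply (UH_intro _ _ N (N * M) (N * (M * M) + N * M)).
  - intros i z Hi Hz; apply HL; auto.
  - intros i z Hi Hz; apply Cmod_mul_le; [apply HL; auto|].
    apply (Hu' i z _ Hi Hz (E z Hz)).
  - intros i z h Hi Hz Hh; destruct (Hu' i z h Hi Hz Hh) as (A & A1 & A2 & A3).
    destruct (HL i (u i z) Hi (Hm i z Hi Hz)) as (B & B1 & B2).
    specialize (B2 (u i (z + h) - u i z)%C).
    replace (u i z + (u i (z + h) - u i z))%C with (u i (z + h)%C) in B2 by ring.
    specialize (B2 (Hm _ _ Hi Hh)).
    replace (L i (u i (z + h)) - L i (u i z) - h * (L1 i (u i z) * u1 i z))%C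
      with ((L i (u i (z + h)) - L i (u i z) - (u i (z + h) - u i z) * L1 i (u i z))
            + L1 i (u i z) * (u i (z + h) - u i z - h * u1 i z))%C by ring.
    eapply Rle_trans; [apply Cmod_add_le|].
    + eapply Rle_trans; [exact B2|]. apply Rmult_le_compat_l; [auto|].
      apply (pow_incr (Cmod (u i (z + h) - u i z)%C) (M * Cmod h) 2).
      split; [apply Cmod_ge_0|exact A2].
    + apply Cmod_mul_le; eassumption.
    + simpl; apply Req_le; ring.
Qed.

Lemma UH_restrict (Q : I -> Prop) (r' : R) (K K1 : I -> C -> C) :
  (forall i, Q i -> P i) -> r <= r' -> UH P r K K1 -> UH Q r' K K1.
Proof.
  intros HQ Hr (M & HM & HK). exists M; split; auto.
  assert (E : forall z, annulus r' z -> annulus r z) by (intros z [A B]; split; lra).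
  intros i z Hi Hz. destruct (HK i z (HQ i Hi) (E z Hz)) as (A & B & D).
  repeat split; auto.
Qed.

End Families.

Lemma UH_reindex {I J : Type} (P : I -> Prop) (Q : J -> Prop) (r : R) (g : J -> I)
  (K K1 : I -> C -> C) : (forall j, Q j -> P (g j)) -> UH P r K K1 ->
  UH Q r (fun j => K (g j)) (fun j => K1 (g j)).
Proof.
  intros Hg (M & HM & HK); exists M; split; [exact HM|]. intros j z Hj Hz; apply HK; auto.
Qed.

(** * Roots of unity and discrete means *)

Definition root (n : nat) : C := (cos (2 * PI / INR (S n)), sin (2 * PI / INR (S n))).

Definition mean (n : nat) (f : C -> R) : R :=
  sum_f_R0 (fun j => f (root n ^ j)%C) n / INR (S n).

Definition cmean (n : nat) (f : C -> C) : C :=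
  (mean n (fun z => Re (f z)), mean n (fun z => Im (f z))).

Lemma root_pow (n j : nat) :
  (root n ^ j)%C = (cos (INR j * (2 * PI / INR (S n))), sin (INR j * (2 * PI / INR (S n)))).
Proof.
  induction j as [|j IH].
  - simpl. rewrite Rmult_0_l, cos_0, sin_0. reflexivity.
  - rewrite Cpow_S, IH, (S_INR j). unfold root. set (t := 2 * PI / INR (S n)).
    replace ((INR j + 1) * t) with (t + INR j * t) by ring.
    rewrite cos_plus, sin_plus. unfold Cmult; simpl. f_equal; ring.
Qed.

Lemma Cmod_cos_sin (t : R) : Cmod (cos t, sin t) = 1.
Proof.
  unfold Cmod; simpl. replace (cos t * (cos t * 1) + sin t * (sin t * 1)) with 1.
  - apply sqrt_1.
  - pose proof (sin2_cos2 t) as H; unfold Rsqr in H; lra.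
Qed.

Lemma Cmod_root (n j : nat) : Cmod (root n ^ j)%C = 1.
Proof. rewrite root_pow; apply Cmod_cos_sin. Qed.

Lemma root_order (n : nat) : (root n ^ S n)%C = 1%C.
Proof.
  rewrite root_pow. replace (INR (S n) * (2 * PI / INR (S n))) with (2 * PI).
  - now rewrite cos_2PI, sin_2PI.
  - field. apply not_0_INR; lia.
Qed.

(** The range of [m] puts the angle strictly between 0 and pi, where the sine is positive. Only
    fixed frequencies occur later, while [n] tends to infinity, so this half range suffices. *)
Lemma root_pow_neq1 (n m : nat) : (0 < m)%nat -> (2 * m <= n)%nat -> (root n ^ m)%C <> 1%C.
Proof.
  intros Hm Hn H. rewrite root_pow in H. apply (f_equal Im) in H.
  change (sin (INR m * (2 * PI / INR (S n))) = 0) in H.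
  assert (0 < sin (INR m * (2 * PI / INR (S n)))); [|lra].
  assert (HN : 0 < INR (S n)) by (apply lt_0_INR; lia).
  pose proof PI_RGT_0. assert (0 < INR m) by (apply lt_0_INR; lia).
  assert (E : INR m * (2 * PI / INR (S n)) = PI * (INR (2 * m) / INR (S n))).
  { rewrite mult_INR; change (INR 2) with 2; field; lra. }
  apply sin_gt_0.
  - rewrite E. apply Rmult_lt_0_compat; auto. apply Rdiv_lt_0_compat; auto.
    apply lt_0_INR; lia.
  - rewrite E. rewrite <- (Rmult_1_r PI) at 2. apply Rmult_lt_compat_l; auto.
    apply (Rmult_lt_reg_r (INR (S n))); auto. unfold Rdiv; rewrite Rmult_assoc, Rinv_l by lra.
    rewrite Rmult_1_l, Rmult_1_r. apply lt_INR; lia.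
Qed.

(** With t = pi / [S n] the chord has length 2 sin t < 2 t, and 8 comes from pi <= 4. *)
Lemma root_near_1 (n : nat) : Cmod (root n - 1)%C <= 8 / INR (S n).
Proof.
  assert (HN : 0 < INR (S n)) by (apply lt_0_INR; lia).
  pose proof PI_RGT_0. pose proof PI_4.
  set (t := PI / INR (S n)).
  assert (Ht : 0 < t) by (apply Rdiv_lt_0_compat; lra).
  assert (Ht1 : t <= PI).
  { unfold t. apply (Rmult_le_reg_r (INR (S n))); auto. unfold Rdiv.
    rewrite Rmult_assoc, Rinv_l by lra. rewrite Rmult_1_r.
    assert (1 <= INR (S n)) by (apply (le_INR 1); lia). nra. }
  assert (E : Cmod (root n - 1)%C = 2 * sin t).
  { unfold root. replace (2 * PI / INR (S n)) with (2 * t) by (unfold t; field; lra).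
    assert (Hs : 0 <= sin t) by (apply sin_ge_0; lra).
    unfold Cmod; simpl. rewrite cos_2a_sin, sin_2a.
    match goal with |- sqrt ?x = _ => replace x with ((2 * sin t) ^ 2) end.
    - rewrite <- Rsqr_pow2, sqrt_Rsqr; lra.
    - pose proof (sin2_cos2 t) as HH; unfold Rsqr in HH.
      replace ((2 * sin t) ^ 2) with (4 * (sin t * sin t) * (sin t * sin t + cos t * cos t))
        by (rewrite HH; ring). ring. }
  rewrite E. assert (sin t < t) by (apply sin_lt_x; auto).
  apply Rle_trans with (2 * t); [lra|]. unfold t, Rdiv.
  assert (0 < / INR (S n)) by (apply Rinv_0_lt_compat; auto). nra.
Qed.

Section Mean.
Variable n : nat.

Lemma INR_S_pos : 0 < INR (S n).
Proof. apply lt_0_INR; lia. Qed.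

Lemma mean_ext (f g : C -> R) : (forall z, Cmod z = 1 -> f z = g z) -> mean n f = mean n g.
Proof.
  intros H; unfold mean; f_equal. apply sum_eq; intros j _. apply H, Cmod_root.
Qed.

Lemma mean_plus (f g : C -> R) : mean n (fun z => f z + g z) = mean n f + mean n g.
Proof. unfold mean; rewrite sum_plus; unfold Rdiv; ring. Qed.

Lemma mean_scal (c : R) (f : C -> R) : mean n (fun z => c * f z) = c * mean n f.
Proof.
  unfold mean. replace (sum_f_R0 (fun j => c * f (root n ^ j)%C) n)
    with (c * sum_f_R0 (fun j => f (root n ^ j)%C) n); [unfold Rdiv; ring|].
  rewrite scal_sum. apply sum_eq; intros; ring.
Qed.

Lemma mean_minus (f g : C -> R) : mean n (fun z => f z - g z) = mean n f - mean n g.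
Proof.
  replace (mean n f - mean n g) with (mean n f + (-1) * mean n g) by ring.
  rewrite <- mean_scal, <- mean_plus. apply mean_ext; intros; ring.
Qed.

Lemma mean_const (c : R) : mean n (fun _ => c) = c.
Proof. unfold mean. rewrite sum_cte. field. pose proof INR_S_pos; lra. Qed.

Lemma mean_le (f g : C -> R) : (forall z, Cmod z = 1 -> f z <= g z) -> mean n f <= mean n g.
Proof.
  intros H; unfold mean, Rdiv. apply Rmult_le_compat_r.
  - left; apply Rinv_0_lt_compat, INR_S_pos.
  - apply sum_Rle; intros j _; apply H, Cmod_root.
Qed.

Lemma mean_le_const (f : C -> R) (B : R) : (forall z, Cmod z = 1 -> f z <= B) -> mean n f <= B.
Proof. intros H; rewrite <- (mean_const B). now apply mean_le. Qed.

Lemma mean_rot (f : C -> R) : mean n (fun z => f (root n * z)%C) = mean n f.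
Proof.
  unfold mean; f_equal.
  change (sum_f_R0 (fun j => f (root n ^ S j)%C) n = sum_f_R0 (fun j => f (root n ^ j)%C) n).
  set (g := fun j => f (root n ^ j)%C).
  change (sum_f_R0 (fun j => g (S j)) n = sum_f_R0 g n).
  assert (E : sum_f_R0 g (S n) = g 0%nat + sum_f_R0 (fun j => g (S j)) n)
    by (rewrite decomp_sum by lia; reflexivity).
  assert (E0 : g (S n) = g 0%nat) by (unfold g; now rewrite root_order).
  rewrite tech5, E0 in E. lra.
Qed.

Lemma mean_sum (f : nat -> C -> R) (N : nat) :
  mean n (fun z => sum_f_R0 (fun k => f k z) N) = sum_f_R0 (fun k => mean n (f k)) N.
Proof.
  induction N as [|N IH]; simpl; [reflexivity|]. now rewrite mean_plus, IH.
Qed.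

Lemma mean_swap (f : C -> C -> R) :
  mean n (fun z => mean n (fun w => f z w)) = mean n (fun w => mean n (fun z => f z w)).
Proof.
  unfold mean at 2. transitivity (sum_f_R0 (fun k => mean n (fun z => f z (root n ^ k)%C)) n
                                  / INR (S n)).
  - rewrite <- mean_sum. unfold Rdiv at 2. rewrite Rmult_comm, <- mean_scal.
    apply mean_ext; intros; unfold Rdiv; ring.
  - reflexivity.
Qed.

Lemma cmean_ext (f g : C -> C) :
  (forall z, Cmod z = 1 -> f z = g z) -> cmean n f = cmean n g.
Proof. intros H; unfold cmean; f_equal; apply mean_ext; intros; now rewrite H. Qed.

Lemma cmean_plus (f g : C -> C) :
  cmean n (fun z => f z + g z)%C = (cmean n f + cmean n g)%C.
Proof. unfold cmean, Cplus; simpl. f_equal; now rewrite <- mean_plus. Qed.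

Lemma cmean_scal (c : C) (f : C -> C) : cmean n (fun z => c * f z)%C = (c * cmean n f)%C.
Proof.
  apply injective_projections.
  - change (mean n (fun z => Re (c * f z)%C)
            = Re c * mean n (fun z => Re (f z)) - Im c * mean n (fun z => Im (f z))).
    rewrite <- !mean_scal, <- mean_minus. apply mean_ext; intros; apply re_mult.
  - change (mean n (fun z => Im (c * f z)%C)
            = Re c * mean n (fun z => Im (f z)) + Im c * mean n (fun z => Re (f z))).
    rewrite <- !mean_scal, <- mean_plus. apply mean_ext; intros; apply im_mult.
Qed.

Lemma cmean_minus (f g : C -> C) :
  cmean n (fun z => f z - g z)%C = (cmean n f - cmean n g)%C.
Proof.
  replace (cmean n f - cmean n g)%C with (cmean n f + (-1) * cmean n g)%C by ring.
  rewrite <- cmean_scal, <- cmean_plus. apply cmean_ext; intros; ring.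
Qed.

Lemma cmean_conj (f : C -> C) : cmean n (fun z => Cconj (f z)) = Cconj (cmean n f).
Proof.
  apply injective_projections; [reflexivity|].
  change (mean n (fun z => - Im (f z)) = - mean n (fun z => Im (f z))).
  replace (- mean n (fun z => Im (f z))) with ((-1) * mean n (fun z => Im (f z))) by ring.
  rewrite <- mean_scal. apply mean_ext; intros; ring.
Qed.

Lemma cmean_const (c : C) : cmean n (fun _ => c) = c.
Proof. unfold cmean. rewrite !mean_const. now destruct c. Qed.

Lemma cmean_rot (f : C -> C) : cmean n (fun z => f (root n * z)%C) = cmean n f.
Proof.
  unfold cmean; f_equal.
  - apply (mean_rot (fun z => Re (f z))).
  - apply (mean_rot (fun z => Im (f z))).
Qed.

Lemma cmean_swap (f : C -> C -> C) :
  cmean n (fun z => cmean n (fun w => f z w)) = cmean n (fun w => cmean n (fun z => f z w)).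
Proof.
  unfold cmean at 1 3; simpl. f_equal.
  - apply (mean_swap (fun z w => Re (f z w))).
  - apply (mean_swap (fun z w => Im (f z w))).
Qed.

Lemma Re_cmean (f : C -> C) : Re (cmean n f) = mean n (fun z => Re (f z)).
Proof. reflexivity. Qed.

(** Multiplying by the conjugate of the mean c turns |c|^2 into the real mean of Re (conj c f);
    estimating real and imaginary parts separately would lose a factor. *)
Lemma cmean_le (f : C -> C) (B : R) :
  (forall z, Cmod z = 1 -> Cmod (f z) <= B) -> Cmod (cmean n f) <= B.
Proof.
  intros H. set (c := cmean n f).
  assert (HB : 0 <= B).
  { specialize (H 1%C Cmod_1). pose proof (Cmod_ge_0 (f 1%C)); lra. }
  destruct (Req_dec (Cmod c) 0) as [H0|H0]; [lra|].
  pose proof (Cmod_ge_0 c). apply (Rmult_le_reg_l (Cmod c)); [lra|].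
  replace (Cmod c * Cmod c) with (Re (Cconj c * c)%C).
  2:{ rewrite Cmult_comm, <- Cmod2_conj. simpl. ring. }
  unfold c at 2. rewrite <- cmean_scal, Re_cmean. apply mean_le_const; intros z Hz.
  eapply Rle_trans; [apply Rle_abs|]. eapply Rle_trans; [apply re_le_Cmod|].
  apply Cmod_mul_le; [rewrite Cmod_conj; apply Rle_refl|auto].
Qed.

(** Rotation by one root multiplies this mean by [root n ^ m], which differs from 1, and also leaves
    it unchanged. *)
Lemma cmean_pow (m : nat) : (0 < m)%nat -> (2 * m <= n)%nat -> cmean n (fun z => z ^ m)%C = 0%C.
Proof.
  intros Hm Hn. pose proof (cmean_rot (fun z => z ^ m)%C) as H.
  rewrite (cmean_ext _ (fun z => root n ^ m * z ^ m)%C) in H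
    by (intros; apply Cpow_mult_l).
  rewrite cmean_scal in H. set (x := cmean n _) in *.
  assert (E : ((root n ^ m - 1) * x)%C = 0%C).
  { replace ((root n ^ m - 1) * x)%C with (root n ^ m * x - x)%C by ring. rewrite H; ring. }
  assert (Hr : (root n ^ m - 1)%C <> 0%C).
  { intros E1. apply (root_pow_neq1 n m Hm Hn).
    replace (root n ^ m)%C with ((root n ^ m - 1) + 1)%C by ring. rewrite E1; ring. }
  replace x with (/ (root n ^ m - 1) * ((root n ^ m - 1) * x))%C by (field; auto).
  rewrite E; ring.
Qed.

Lemma conj_unit (z : C) : Cmod z = 1 -> (Cconj z * z)%C = 1%C.
Proof. intros H. rewrite Cmult_comm, <- Cmod2_conj, H. f_equal; ring. Qed.

Lemma cmean_orth_lt (m k : nat) : (k < m)%nat -> (2 * m <= n)%nat ->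
  cmean n (fun z => Cconj z ^ m * z ^ k)%C = 0%C.
Proof.
  intros Hk Hn. rewrite (cmean_ext _ (fun z => Cconj (z ^ (m - k)))%C).
  - rewrite cmean_conj, cmean_pow by lia. unfold Cconj; simpl; now rewrite Ropp_0.
  - intros z Hz. replace m with ((m - k) + k)%nat at 1 by lia.
    rewrite Cpow_add_r, <- Cmult_assoc, <- Cpow_mult_l, conj_unit, Cpow_1_l, Cpow_conj by auto.
    ring.
Qed.

Lemma cmean_orth_gt (m k : nat) : (m < k)%nat -> (2 * k <= n)%nat ->
  cmean n (fun z => Cconj z ^ m * z ^ k)%C = 0%C.
Proof.
  intros Hk Hn. rewrite (cmean_ext _ (fun z => z ^ (k - m))%C).
  - apply cmean_pow; lia.
  - intros z Hz. replace k with (m + (k - m))%nat at 1 by lia.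
    rewrite Cpow_add_r, Cmult_assoc, <- Cpow_mult_l, conj_unit, Cpow_1_l by auto.
    ring.
Qed.

Lemma cmean_orth_eq (m : nat) : cmean n (fun z => Cconj z ^ m * z ^ m)%C = 1%C.
Proof.
  rewrite (cmean_ext _ (fun _ => 1%C)); [apply cmean_const|].
  intros z Hz. now rewrite <- Cpow_mult_l, conj_unit, Cpow_1_l.
Qed.

End Mean.

(** * Means over concentric circles *)

Lemma annulus_scal (r t : R) (z : C) : 0 <= r -> r <= t <= 1 -> Cmod z = 1 ->
  annulus r (t * z)%C.
Proof.
  intros Hr Ht Hz. unfold annulus. rewrite Cmod_mult, Cmod_R, Hz, Rabs_pos_eq; lra.
Qed.

Section Transport.
Context {I : Type} (P : I -> Prop) (r : R) (K K1 : I -> C -> C) (M : R).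
Hypothesis Hr : 0 < r <= 1.
Hypothesis HM : 0 <= M.
Hypothesis HK : forall i z, P i -> annulus r z ->
    Cmod (K i z) <= M /\ Cmod (K1 i z) <= M /\
    forall h, annulus r (z + h)%C ->
      Cmod (K i (z + h)%C - K i z - h * K1 i z)%C <= M * Cmod h ^ 2.

(* Rotation invariance of the mean kills the zeroth order term. *)
Lemma mean_derivative_small (n : nat) (i : I) (t : R) : P i -> r <= t <= 1 ->
  Cmod (cmean n (fun z => z * K1 i (t * z)))%C <= M * (8 / INR (S n)).
Proof.
  intros Hi Ht. set (d := (root n - 1)%C).
  assert (Hd : Cmod d <= 8 / INR (S n)) by apply root_near_1.
  assert (H8 : 0 <= 8 / INR (S n))
    by (eapply Rle_trans; [apply Cmod_ge_0|exact Hd]).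
  (* The main argument divides by [d]. It vanishes only for order 1, where 8 M exceeds the trivial
     bound; order 2 has root -1 and lies outside the range of [root_pow_neq1]. *)
  destruct (Req_dec (Cmod d) 0) as [H0|H0].
  { assert (Hroot : root n = 1%C).
    { apply Cmod_eq_0 in H0. unfold d in H0.
      replace (root n) with ((root n - 1) + 1)%C by ring. rewrite H0; ring. }
    destruct n as [|n].
    - eapply Rle_trans; [apply (cmean_le _ _ M)|].
      + intros z Hz. rewrite Cmod_mult, Hz, Rmult_1_l. apply HK; auto.
        apply annulus_scal; lra.
      + simpl. nra.
    - destruct n as [|n].
      + exfalso. apply (f_equal Re) in Hroot. unfold root in Hroot; simpl in Hroot.
        replace (2 * PI / (1 + 1)) with PI in Hroot by field. rewrite cos_PI in Hroot; lra.
      + exfalso. apply (root_pow_neq1 (S (S n)) 1); [lia|lia|]. rewrite Cpow_1_r; auto. }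
  assert (Hpos : 0 < Cmod d) by (pose proof (Cmod_ge_0 d); lra).
  set (A := cmean n _).
  assert (E : (t * d * A)%C = (- cmean n (fun z => K i (t * z + t * d * z)
                - K i (t * z) - (t * d * z) * K1 i (t * z)))%C).
  { rewrite !cmean_minus.
    replace (cmean n (fun z => K i (t * z + t * d * z)%C)) with (cmean n (fun z => K i (t * z)%C)).
    - unfold A. rewrite <- cmean_scal.
      rewrite (cmean_ext n (fun z => t * d * (z * K1 i (t * z)))%C
                 (fun z => t * d * z * K1 i (t * z))%C) by (intros; ring). ring.
    - rewrite <- (cmean_rot n (fun z => K i (t * z)%C)). apply cmean_ext; intros z _.
      f_equal. unfold d; ring. }
  assert (B : Cmod (t * d * A)%C <= M * (t * Cmod d) ^ 2).
  { rewrite E, Cmod_opp. apply cmean_le; intros z Hz.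
    destruct (HK i (t * z)%C Hi (annulus_scal r t z ltac:(lra) Ht Hz)) as (_ & _ & H).
    eapply Rle_trans; [apply H|].
    - replace (t * z + t * d * z)%C with (t * (root n * z))%C by (unfold d; ring).
      apply annulus_scal; [lra|lra|]. rewrite Cmod_mult, Hz, <- (Cpow_1_r (root n)), Cmod_root; lra.
    - rewrite !Cmod_mult, Cmod_R, Hz, Rabs_pos_eq by lra. apply Req_le; ring. }
  rewrite !Cmod_mult, Cmod_R, Rabs_pos_eq in B by lra.
  apply (Rmult_le_reg_l (t * Cmod d)); [nra|].
  eapply Rle_trans; [exact B|].
  replace (M * (t * Cmod d) ^ 2) with (M * ((t * Cmod d) * (t * Cmod d))) by ring.
  apply Rle_trans with (M * ((t * Cmod d) * (8 / INR (S n)))); [|apply Req_le; ring].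
  apply Rmult_le_compat_l; auto. apply Rmult_le_compat_l; [nra|].
  apply Rle_trans with (1 * Cmod d); [apply Rmult_le_compat_r|]; lra.
Qed.

(** A radial step of size at most 1 / [S n] costs a quadratic remainder (the 1 in 9) and s times a
    mean that is itself O(1 / [S n]) by [mean_derivative_small] (the 8 in 9). *)
Lemma mean_step (n : nat) (i : I) (t s : R) : P i -> r <= t -> 0 <= s -> t + s <= 1 ->
  s <= / INR (S n) ->
  Cmod (cmean n (fun z => K i ((t + s)%R * z)) - cmean n (fun z => K i (t * z)))%C
    <= 9 * M * / INR (S n) ^ 2.
Proof.
  intros Hi Ht Hs Hts HsN. pose proof (INR_S_pos n) as HN.
  assert (HN' : 0 < / INR (S n)) by (apply Rinv_0_lt_compat; auto).
  replace (cmean n (fun z => K i ((t + s)%R * z)) - cmean n (fun z => K i (t * z)))%C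
    with (cmean n (fun z => K i ((t + s)%R * z) - K i (t * z) - s * z * K1 i (t * z))
          + s * cmean n (fun z => z * K1 i (t * z)))%C.
  2:{ rewrite <- cmean_scal, !cmean_minus.
      rewrite (cmean_ext n (fun z => s * (z * K1 i (t * z)))%C
                 (fun z => s * z * K1 i (t * z))%C) by (intros; ring). ring. }
  eapply Rle_trans; [apply Cmod_add_le|].
  - apply (cmean_le _ _ (M * s ^ 2)). intros z Hz.
    destruct (HK i (t * z)%C Hi (annulus_scal r t z ltac:(lra) ltac:(lra) Hz)) as (_ & _ & H).
    replace ((t + s)%R * z)%C with (t * z + s * z)%C by (rewrite RtoC_plus; ring).
    eapply Rle_trans; [apply H|].
    + replace (t * z + s * z)%C with ((t + s)%R * z)%C by (rewrite RtoC_plus; ring).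
      apply annulus_scal; lra.
    + rewrite Cmod_mult, Cmod_R, Hz, Rabs_pos_eq by lra. apply Req_le; ring.
  - apply Cmod_mul_le; [rewrite Cmod_R, Rabs_pos_eq by lra; apply HsN|].
    apply mean_derivative_small; [auto|lra].
  - assert (s ^ 2 <= (/ INR (S n)) ^ 2) by (apply pow_incr; lra).
    rewrite <- pow_inv. unfold Rdiv. simpl in *. nra.
Qed.

(** A discrete Cauchy theorem: [S n] radial steps lead from radius r to 1, and their errors of
    second order in 1 / [S n] add up to first order. *)
Lemma mean_transport (n : nat) (i : I) : P i ->
  Cmod (cmean n (fun z => K i z) - cmean n (fun z => K i (r * z)))%C <= 9 * M / INR (S n).
Proof.
  intros Hi. pose proof (INR_S_pos n) as HN.
  assert (HN' : 0 < / INR (S n)) by (apply Rinv_0_lt_compat; auto).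
  set (s := (1 - r) * / INR (S n)).
  assert (Hs : 0 <= s <= / INR (S n)) by (unfold s; split; nra).
  assert (H : forall k, (k <= S n)%nat ->
    Cmod (cmean n (fun z => K i ((r + INR k * s)%R * z)) - cmean n (fun z => K i (r * z)))%C
      <= INR k * (9 * M * / INR (S n) ^ 2)).
  { induction k as [|k IH]; intros Hk.
    - simpl INR. replace (r + 0 * s) with r by ring.
      match goal with |- Cmod ?x <= _ => replace x with (RtoC 0) by ring end.
      rewrite Cmod_0; lra.
    - replace (cmean n (fun z => K i ((r + INR (S k) * s)%R * z)) - cmean n (fun z => K i (r * z)))%C
        with ((cmean n (fun z => K i (((r + INR k * s) + s)%R * z))
               - cmean n (fun z => K i ((r + INR k * s)%R * z)))
              + (cmean n (fun z => K i ((r + INR k * s)%R * z)) - cmean n (fun z => K i (r * z))))%C.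
      2:{ rewrite S_INR. replace (r + INR k * s + s) with (r + (INR k + 1) * s) by ring. ring. }
      rewrite (S_INR k). rewrite Rplus_comm, Rmult_plus_distr_r, Rmult_1_l.
      rewrite Rplus_comm. rewrite (Rplus_comm (INR k * _)).
      pose proof (pos_INR k).
      assert (Hb : INR (S k) * s <= 1 - r).
      { unfold s. assert (INR (S k) <= INR (S n)) by (apply le_INR; lia).
        apply Rle_trans with (INR (S n) * ((1 - r) * / INR (S n))).
        - apply Rmult_le_compat_r; [apply Rmult_le_pos; lra|auto].
        - apply Req_le; field; lra. }
      rewrite S_INR in Hb.
      assert (0 <= INR k * s) by (apply Rmult_le_pos; lra).
      apply Cmod_add_le; [apply mean_step; auto; lra|apply IH; lia]. }
  specialize (H (S n) (Nat.le_refl _)).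
  replace (r + INR (S n) * s) with 1 in H by (unfold s; field; lra).
  rewrite (cmean_ext n (fun z => K i z) (fun z => K i (1 * z)%C))
    by (intros; f_equal; ring).
  eapply Rle_trans; [exact H|]. apply Req_le; field; lra.
Qed.
End Transport.

Lemma small_inv_INR (B eps : R) : 0 < eps ->
  exists N, forall n, (N <= n)%nat -> B / INR (S n) <= eps.
Proof.
  intros He. destruct (INR_unbounded (Rabs B / eps)) as [N HN]. exists N; intros n Hn.
  pose proof (INR_S_pos n) as H. apply (Rmult_le_reg_r (INR (S n))); auto.
  unfold Rdiv; rewrite Rmult_assoc, Rinv_l by lra. rewrite Rmult_1_r.
  assert (INR N <= INR (S n)) by (apply le_INR; lia).
  apply Rle_trans with (Rabs B); [apply Rle_abs|].
  apply (Rmult_le_reg_r (/ eps)); [apply Rinv_0_lt_compat; auto|].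
  replace (eps * INR (S n) * / eps) with (INR (S n)) by (field; lra). unfold Rdiv in HN; lra.
Qed.

(** On the circle conj z = 1 / z, so the mean is that of K / z^m. This family is holomorphic away
    from 0 and can be moved to a small radius r, where it is at most B r. It serves as Cauchy's
    coefficient formula, uniformly in the family. *)
Lemma mean_vanish {I : Type} (P : I -> Prop) (K K1 : I -> C -> C) (m : nat) (B : R) :
  UH P 0 K K1 ->
  (forall i z, P i -> annulus 0 z -> Cmod (K i z) <= B * Cmod z ^ S m) ->
  forall eps, 0 < eps -> exists N, forall n, (N <= n)%nat -> forall i, P i ->
    Cmod (cmean n (fun z => Cconj z ^ m * K i z))%C <= eps.
Proof.
  intros HK HB eps He.
  (* Half of [eps] pays for the values at radius [r], the other half for the transport. *)
  set (r := Rmin 1 (eps / 2 / (Rabs B + 1))).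
  pose proof (Rabs_pos B) as HBp.
  assert (Hr : 0 < r <= 1).
  { unfold r; split; [apply Rmin_pos; [lra|apply Rdiv_lt_0_compat; lra]|apply Rmin_l]. }
  assert (HBr : Rabs B * r <= eps / 2).
  { assert (r <= eps / 2 / (Rabs B + 1)) by apply Rmin_r.
    apply Rle_trans with (Rabs B * (eps / 2 / (Rabs B + 1))); [nra|].
    apply (Rmult_le_reg_r (Rabs B + 1)); [lra|].
    replace (Rabs B * (eps / 2 / (Rabs B + 1)) * (Rabs B + 1)) with (Rabs B * (eps / 2))
      by (field; lra). nra. }
  destruct (@UH_pow I P r _ _ m UH_id) as [K2 H2].
  assert (Hlow : forall (i : I) z, P i -> annulus r z -> r ^ m <= Cmod (z ^ m)%C).
  { intros i z _ [H _]. rewrite Cmod_pow. apply pow_incr; lra. }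
  pose proof (UH_inv _ _ (r ^ m) (pow_lt _ _ (proj1 Hr)) Hlow H2) as H3.
  assert (HK' : UH P r K K1)
    by (eapply UH_restrict; [| |exact HK]; [auto|lra]).
  destruct (UH_mult _ _ _ _ H3 HK') as (M & HM & HG).
  destruct (small_inv_INR (9 * M) (eps / 2) ltac:(lra)) as [N HN].
  exists N; intros n Hn i Hi.
  pose proof (mean_transport P r _ _ M Hr HM HG n i Hi) as HT. cbv beta in HT.
  rewrite (cmean_ext n _ (fun z => / z ^ m * K i z)%C).
  2:{ intros z Hz. f_equal.
      assert (Hz0 : z <> 0%C) by (apply Cmod_gt_0; lra).
      rewrite <- Cpow_inv by auto. f_equal.
      replace (Cconj z) with (Cconj z * z * / z)%C by (field; auto).
      rewrite conj_unit by auto. ring. }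
  set (a := cmean n _) in *. set (b := cmean n _) in HT.
  replace a with ((a - b) + b)%C by ring.
  replace eps with (eps / 2 + eps / 2) by field.
  apply Cmod_add_le; [eapply Rle_trans; [exact HT|auto]|].
  eapply Rle_trans; [|exact HBr]. apply cmean_le; intros z Hz.
  assert (Hrz : annulus r (r * z)%C) by (apply annulus_scal; lra).
  assert (Hmod : Cmod (r * z)%C = r) by (rewrite Cmod_mult, Cmod_R, Hz, Rabs_pos_eq; lra).
  assert (Hrm : 0 < r ^ m) by (apply pow_lt; lra).
  rewrite Cmod_mult, Cmod_inv, Cmod_pow, Hmod.
  2:{ apply Cpow_nz, Cmod_gt_0; lra. }
  assert (Hb := HB i (r * z)%C Hi (conj (Cmod_ge_0 _) (proj2 Hrz))). rewrite Hmod in Hb.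
  apply (Rmult_le_reg_l (r ^ m)); auto.
  rewrite <- Rmult_assoc, Rinv_r, Rmult_1_l by lra.
  eapply Rle_trans; [exact Hb|]. simpl. pose proof (Rle_abs B).
  apply Rle_trans with (Rabs B * (r * r ^ m)); [apply Rmult_le_compat_r; [nra|auto]|].
  apply Req_le; ring.
Qed.

(** * Compactness and power series *)

Lemma Cmod_le_Re_Im (z : C) : Cmod z <= Rabs (Re z) + Rabs (Im z).
Proof.
  replace z with (RtoC (Re z) + Ci * RtoC (Im z))%C at 1.
  - eapply Rle_trans; [apply Cmod_triangle|].
    rewrite Cmod_mult, Cmod_Ci, !Cmod_R. lra.
  - destruct z; apply injective_projections; simpl; unfold Re, Im; simpl; ring.
Qed.

Lemma im_le_Cmod (z : C) : Rabs (Im z) <= Cmod z.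
Proof. eapply Rle_trans; [apply Rmax_r|apply Rmax_Cmod]. Qed.

(** Compactness of the square [-1, 1]^2 carries the argument; points outside the annulus receive a
    neighbourhood that misses it. A single number serves as local radius and as the quantity in [T],
    which is why [T] must be monotone in it. *)
Lemma annulus_compact (r : R) (T : C -> R -> Prop) :
  (forall z d d', T z d -> d' <= d -> T z d') ->
  (forall z, annulus r z -> exists d, 0 < d /\
     forall z', annulus r z' -> Cmod (z' - z)%C < d -> T z' d) ->
  exists c, 0 < c /\ forall z, annulus r z -> T z c.
Proof.
  intros Hmono Hloc.
  assert (H : forall p : R * R, exists d : posreal, forall z', annulus r z' ->
            Rabs (Re z' - fst p) < d -> Rabs (Im z' - snd p) < d -> T z' d).
  { intros [x y].
    assert (Hclose : forall z' e, Rabs (Re z' - x) < e / 2 -> Rabs (Im z' - y) < e / 2 ->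
              Cmod (z' - (x, y))%C < e).
    { intros z' e H1 H2. eapply Rle_lt_trans; [apply Cmod_le_Re_Im|]. simpl.
      unfold Re, Im in *; simpl in *. unfold Rminus in *. lra. }
    destruct (classic (annulus r (x, y))) as [Ha|Ha].
    - destruct (Hloc _ Ha) as (d & Hd & HT).
      exists (mkposreal (d / 2) ltac:(lra)); simpl; intros z' Hz' H1 H2.
      apply (Hmono _ d); [|lra]. apply HT; auto.
    - assert (Hf : exists e, 0 < e /\ forall z', Cmod (z' - (x, y))%C < e -> ~ annulus r z').
      { destruct (Rlt_or_le (Cmod (x, y)) r) as [H1|H1].
        - exists (r - Cmod (x, y)); split; [lra|]. intros z' Hz' [H2 _].
          pose proof (Cmod_sub_ge z' (x, y)). lra.
        - destruct (Rlt_or_le 1 (Cmod (x, y))) as [H2|H2]; [|exfalso; apply Ha; split; auto].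
          exists (Cmod (x, y) - 1); split; [lra|]. intros z' Hz' [_ H3].
          pose proof (Cmod_sub_ge (x, y) z'). rewrite Cmod_sub_sym in Hz'. lra. }
      destruct Hf as (e & He & Hf).
      exists (mkposreal (e / 2) ltac:(lra)); simpl; intros z' Hz' H1 H2.
      exfalso; apply (Hf z'); auto. }
  set (delta := fun x y => proj1_sig (constructive_indefinite_description _ (H (x, y)))).
  destruct (compactness_value_2d (-1) 1 (-1) 1 delta) as [d Hd].
  (* [compactness_value_2d] gives its tag only under a double negation, hence the proof by
     contradiction. *)
  exists d; split; [apply cond_pos|]. intros z Hz. apply NNPP; intros HN.
  assert (HR : Rabs (Re z) <= 1) by (eapply Rle_trans; [apply re_le_Cmod|apply Hz]).
  assert (HI : Rabs (Im z) <= 1) by (eapply Rle_trans; [apply im_le_Cmod|apply Hz]).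
  apply Rabs_le_between in HR; apply Rabs_le_between in HI.
  apply (Hd (Re z) (Im z)); [lra|lra|].
  intros (u & v & _ & _ & H1 & H2 & H3). apply HN.
  apply (Hmono _ (delta u v)); auto. unfold delta in *.
  destruct (constructive_indefinite_description _ (H (u, v))) as [e He]; simpl in *.
  apply He; auto.
Qed.

(** Subdividing into [S n] steps leaves a total change of at most B / [S n]; this stands in for the
    mean value theorem when a derivative vanishes. *)
Lemma quadratic_constant (g : R -> C) (B : R) :
  (forall s h, 0 <= s <= 1 -> 0 <= s + h <= 1 -> Cmod (g (s + h)%R - g s)%C <= B * h ^ 2) ->
  g 1 = g 0.
Proof.
  intros H.
  assert (HN : forall n, Cmod (g 1 - g 0)%C <= B / INR (S n)).
  { intros n. pose proof (INR_S_pos n) as Hp.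
    assert (Hi : 0 < / INR (S n)) by (apply Rinv_0_lt_compat; auto).
    assert (H1 : forall k, (k <= S n)%nat ->
      Cmod (g (INR k * / INR (S n))%R - g 0)%C <= INR k * (B * (/ INR (S n)) ^ 2)).
    { induction k as [|k IH]; intros Hk.
      - simpl INR. rewrite !Rmult_0_l. replace (g 0 - g 0)%C with (RtoC 0) by ring.
        rewrite Cmod_0; lra.
      - assert (Hk1 : INR (S k) * / INR (S n) <= 1).
        { apply (Rmult_le_reg_r (INR (S n))); auto. rewrite Rmult_assoc, Rinv_l by lra.
          rewrite Rmult_1_l, Rmult_1_r. apply le_INR; lia. }
        rewrite (S_INR k) in *. pose proof (pos_INR k).
        replace ((INR k + 1) * / INR (S n)) with (INR k * / INR (S n) + / INR (S n)) in * by ring.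
        assert (0 <= INR k * / INR (S n)) by (apply Rmult_le_pos; lra).
        replace (g (INR k * / INR (S n) + / INR (S n))%R - g 0)%C with
          ((g (INR k * / INR (S n))%R - g 0)
           + (g (INR k * / INR (S n) + / INR (S n))%R - g (INR k * / INR (S n))%R))%C by ring.
        rewrite Rmult_plus_distr_r, Rmult_1_l. apply Cmod_add_le; [apply IH; lia|].
        apply H; lra. }
    specialize (H1 (S n) (Nat.le_refl _)). rewrite Rinv_r in H1 by lra.
    eapply Rle_trans; [exact H1|]. apply Req_le; field; lra. }
  assert (Hz : Cmod (g 1 - g 0)%C <= 0).
  { apply Rnot_lt_le; intros Hlt.
    destruct (small_inv_INR B (Cmod (g 1 - g 0)%C / 2)) as [N HN']; [lra|].
    specialize (HN N). specialize (HN' N (Nat.le_refl _)). lra. }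
  assert (H0 : (g 1 - g 0)%C = 0%C)
    by (apply Cmod_eq_0; pose proof (Cmod_ge_0 (g 1 - g 0)%C); lra).
  replace (g 1) with ((g 1 - g 0) + g 0)%C by ring. rewrite H0; ring.
Qed.

(** A total operation built from two real series; it has its intended meaning under a summable
    majorant, which the lemmas about it carry as a hypothesis. *)
Definition csum (u : nat -> C) : C :=
  (Series (fun n => Re (u n)), Series (fun n => Im (u n))).

Lemma dominated_Re (u : nat -> C) (b : nat -> R) : (forall n, Cmod (u n) <= b n) ->
  ex_series b -> ex_series (fun n => Re (u n)).
Proof.
  intros H Hb. apply (ex_series_le (fun n => Re (u n)) b); auto.
  intros n. eapply Rle_trans; [apply re_le_Cmod|apply H].
Qed.

Lemma dominated_Im (u : nat -> C) (b : nat -> R) : (forall n, Cmod (u n) <= b n) ->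
  ex_series b -> ex_series (fun n => Im (u n)).
Proof.
  intros H Hb. apply (ex_series_le (fun n => Im (u n)) b); auto.
  intros n. eapply Rle_trans; [apply im_le_Cmod|apply H].
Qed.

Lemma csum_ext (u v : nat -> C) : (forall n, u n = v n) -> csum u = csum v.
Proof. intros H; unfold csum; f_equal; apply Series_ext; intros n; now rewrite H. Qed.

Lemma csum_plus (u v : nat -> C) (b c : nat -> R) :
  (forall n, Cmod (u n) <= b n) -> (forall n, Cmod (v n) <= c n) ->
  ex_series b -> ex_series c ->
  csum (fun n => u n + v n)%C = (csum u + csum v)%C.
Proof.
  intros Hu Hv Hb Hc; unfold csum, Cplus at 3; simpl. f_equal.
  - rewrite <- Series_plus; [reflexivity|eapply dominated_Re; eauto|eapply dominated_Re; eauto].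
  - rewrite <- Series_plus; [reflexivity|eapply dominated_Im; eauto|eapply dominated_Im; eauto].
Qed.

Lemma csum_scal (c : C) (u : nat -> C) (b : nat -> R) :
  (forall n, Cmod (u n) <= b n) -> ex_series b ->
  csum (fun n => c * u n)%C = (c * csum u)%C.
Proof.
  intros Hu Hb. assert (HR := dominated_Re _ _ Hu Hb). assert (HI := dominated_Im _ _ Hu Hb).
  assert (S : forall (k : R) (v : nat -> R), ex_series v -> ex_series (fun n => k * v n))
    by (intros k v Hv; apply (ex_series_scal_l k v Hv)).
  apply injective_projections.
  - change (Series (fun n => Re (c * u n)%C)
            = Re c * Series (fun n => Re (u n)) - Im c * Series (fun n => Im (u n))).
    rewrite <- !Series_scal_l, <- Series_minus by auto.
    apply Series_ext; intros; apply re_mult.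
  - change (Series (fun n => Im (c * u n)%C)
            = Re c * Series (fun n => Im (u n)) + Im c * Series (fun n => Re (u n))).
    rewrite <- !Series_scal_l, <- Series_plus by auto.
    apply Series_ext; intros; apply im_mult.
Qed.

Lemma csum_minus (u v : nat -> C) (b c : nat -> R) :
  (forall n, Cmod (u n) <= b n) -> (forall n, Cmod (v n) <= c n) ->
  ex_series b -> ex_series c ->
  csum (fun n => u n - v n)%C = (csum u - csum v)%C.
Proof.
  intros Hu Hv Hb Hc. replace (csum u - csum v)%C with (csum u + (-1) * csum v)%C by ring.
  rewrite <- (csum_scal _ _ _ Hv Hc), <- (csum_plus _ (fun n => (-1) * v n)%C b c); auto.
  - apply csum_ext; intros; ring.
  - intros n. rewrite Cmod_mult, Cmod_R, Rabs_left by lra. specialize (Hv n); lra.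
Qed.

(** Same device as in [cmean_le]: multiply by the conjugate of the sum and take real parts. *)
Lemma csum_le (u : nat -> C) (b : nat -> R) :
  (forall n, Cmod (u n) <= b n) -> ex_series b -> Cmod (csum u) <= Series b.
Proof.
  intros Hu Hb. set (c := csum u).
  destruct (Req_dec (Cmod c) 0) as [H0|H0].
  { rewrite H0. replace 0 with (Series (fun _ : nat => 0)).
    - apply Series_le; auto. intros n; split; [lra|].
      eapply Rle_trans; [apply Cmod_ge_0|apply Hu].
    - rewrite <- (Series_ext (fun n => 0 * b n)) by (intros; ring).
      rewrite Series_scal_l; ring. }
  pose proof (Cmod_ge_0 c). apply (Rmult_le_reg_l (Cmod c)); [lra|].
  replace (Cmod c * Cmod c) with (Re (Cconj c * c)%C).
  2:{ rewrite Cmult_comm, <- Cmod2_conj. simpl. ring. }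
  assert (Hd : forall n, Cmod (Cconj c * u n)%C <= Cmod c * b n)
    by (intros n; apply Cmod_mul_le; [rewrite Cmod_conj; lra|auto]).
  assert (Hcb : ex_series (fun n => Cmod c * b n)) by (apply (ex_series_scal_l (Cmod c) b Hb)).
  replace (Re (Cconj c * c)%C) with (Series (fun n => Re (Cconj c * u n)%C))
    by exact (f_equal Re (csum_scal (Cconj c) u b Hu Hb)).
  clearbody c. rewrite <- Series_scal_l.
  eapply Rle_trans; [apply Rle_abs|]. eapply Rle_trans; [apply Series_Rabs|].
  - apply (ex_series_le (fun n => Rabs (Re (Cconj c * u n)%C)) (fun n => Cmod c * b n)); auto.
    intros n. change (Rabs (Rabs (Re (Cconj c * u n)%C)) <= Cmod c * b n).
    rewrite Rabs_Rabsolu.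
    eapply Rle_trans; [apply re_le_Cmod|auto].
  - apply Series_le; auto. intros n; split; [apply Rabs_pos|].
    eapply Rle_trans; [apply re_le_Cmod|auto].
Qed.

Lemma csum_incr_1 (u : nat -> C) (b : nat -> R) :
  (forall n, Cmod (u n) <= b n) -> ex_series b ->
  csum u = (u 0%nat + csum (fun n => u (S n)))%C.
Proof.
  intros Hu Hb. apply injective_projections; simpl.
  - apply Series_incr_1; eapply dominated_Re; eauto.
  - apply Series_incr_1; eapply dominated_Im; eauto.
Qed.

(** A Weierstrass test in which one summable sequence majorizes values, derivatives and remainder
    constants together. *)
Lemma UH_csum {I : Type} (P : I -> Prop) (r : R) (phi phi1 : nat -> I -> C -> C) (c : nat -> R) :
  ex_series c ->
  (forall n i z, P i -> annulus r z -> Cmod (phi n i z) <= c n /\ Cmod (phi1 n i z) <= c n /\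
     forall h, annulus r (z + h)%C ->
       Cmod (phi n i (z + h)%C - phi n i z - h * phi1 n i z)%C <= c n * Cmod h ^ 2) ->
  UH P r (fun i z => csum (fun n => phi n i z)) (fun i z => csum (fun n => phi1 n i z)).
Proof.
  intros Hc H. apply (UH_intro _ _ (Series c) (Series c) (Series c)).
  - intros i z Hi Hz; apply csum_le; auto; intros n; apply H; auto.
  - intros i z Hi Hz; apply csum_le; auto; intros n; apply H; auto.
  - intros i z h Hi Hz Hh.
    assert (B1 : forall n, Cmod (phi n i (z + h)%C) <= c n) by (intros; apply H; auto).
    assert (B2 : forall n, Cmod (phi n i z) <= c n) by (intros; apply H; auto).
    assert (B3 : forall n, Cmod (phi1 n i z) <= c n) by (intros; apply H; auto).
    assert (B4 : forall n, Cmod (h * phi1 n i z)%C <= Cmod h * c n)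
      by (intros; apply Cmod_mul_le; [lra|auto]).
    assert (B5 : forall n, Cmod (phi n i (z + h)%C - phi n i z)%C <= c n + c n)
      by (intros; apply Cmod_sub_le; auto).
    assert (E5 : ex_series (fun n => c n + c n)) by (apply (ex_series_plus c c); auto).
    assert (E4 : ex_series (fun n => Cmod h * c n)) by (apply (ex_series_scal_l (Cmod h) c Hc)).
    rewrite <- (csum_scal h _ _ B3 Hc), <- (csum_minus _ _ _ _ B1 B2 Hc Hc),
      <- (csum_minus _ _ _ _ B5 B4 E5 E4), <- Series_scal_r.
    apply csum_le; [|apply (ex_series_scal_r (Cmod h ^ 2) c Hc)].
    intros n; apply H; auto.
Qed.
(* [dd n z w] is the divided difference of the n-th power, and [dd1] its z-derivative. *)
Fixpoint dd (n : nat) (z w : C) : C :=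
  match n with 0%nat => 0%C | S m => (z ^ m + w * dd m z w)%C end.

Fixpoint dd1 (n : nat) (z w : C) : C :=
  match n with 0%nat => 0%C | S m => (dd m z z + w * dd1 m z w)%C end.

Lemma dd_spec (n : nat) (z w : C) : (z ^ n - w ^ n)%C = ((z - w) * dd n z w)%C.
Proof.
  induction n as [|n IH]; simpl; [ring|].
  replace (z * z ^ n - w * w ^ n)%C with ((z - w) * z ^ n + w * (z ^ n - w ^ n))%C by ring.
  rewrite IH; ring.
Qed.

Lemma Cmod_pow_le1 (z : C) (n : nat) : Cmod z <= 1 -> Cmod (z ^ n)%C <= 1.
Proof.
  intros H. rewrite Cmod_pow, <- (pow1 n). apply pow_incr; split; [apply Cmod_ge_0|auto].
Qed.

Lemma dd_le (n : nat) (z w : C) : Cmod z <= 1 -> Cmod w <= 1 -> Cmod (dd n z w) <= INR n.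
Proof.
  intros Hz Hw; induction n as [|n IH]; [simpl; rewrite Cmod_0; lra|].
  rewrite S_INR, Rplus_comm. simpl dd. apply Cmod_add_le; [now apply Cmod_pow_le1|].
  rewrite <- (Rmult_1_l (INR n)). apply Cmod_mul_le; auto.
Qed.

Lemma pow_second_order (n : nat) (z h : C) : Cmod z <= 1 -> Cmod (z + h)%C <= 1 ->
  Cmod ((z + h) ^ n - z ^ n - h * dd n z z)%C <= INR n ^ 2 * Cmod h ^ 2.
Proof.
  intros Hz Hh; induction n as [|n IH].
  - simpl. replace (1 - 1 - h * 0)%C with (RtoC 0) by ring. rewrite Cmod_0.
    pose proof (pow2_ge_0 (Cmod h)); simpl in *; lra.
  - rewrite S_INR. simpl dd. rewrite !Cpow_S.
    replace ((z + h) * (z + h) ^ n - z * z ^ n - h * (z ^ n + z * dd n z z))%C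
      with (z * ((z + h) ^ n - z ^ n - h * dd n z z) + h * ((z + h) ^ n - z ^ n))%C by ring.
    eapply Rle_trans; [apply Cmod_add_le; [apply Cmod_mul_le; [exact Hz|exact IH]|]|].
    + apply Cmod_mul_le; [apply Rle_refl|].
      rewrite dd_spec. apply Cmod_mul_le; [|apply dd_le; auto].
      replace (z + h - z)%C with h by ring. apply Rle_refl.
    + pose proof (pos_INR n) as Hn. pose proof (pow2_ge_0 (Cmod h)) as Hx.
      replace (Cmod h * (Cmod h * INR n)) with (INR n * Cmod h ^ 2) by ring.
      set (x := Cmod h ^ 2) in *. assert (0 <= INR n * x) by (apply Rmult_le_pos; auto).
      simpl. nra.
Qed.

Lemma dd1_le (n : nat) (z w : C) : Cmod z <= 1 -> Cmod w <= 1 -> Cmod (dd1 n z w) <= INR n ^ 2.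
Proof.
  intros Hz Hw; induction n as [|n IH]; [simpl; rewrite Cmod_0; lra|].
  rewrite S_INR. simpl dd1. eapply Rle_trans; [apply Cmod_add_le|].
  - apply dd_le; auto.
  - apply Cmod_mul_le; eauto.
  - pose proof (pos_INR n); nra.
Qed.

(** The induction step needs n^2 + n^3 <= (n + 1)^3. This cubic growth is the origin of the weight
    [INR n ^ 3] in the summability conditions on power series. *)
Lemma dd_second_order (n : nat) (z w h : C) : Cmod z <= 1 -> Cmod w <= 1 ->
  Cmod (z + h)%C <= 1 ->
  Cmod (dd n (z + h)%C w - dd n z w - h * dd1 n z w)%C <= INR n ^ 3 * Cmod h ^ 2.
Proof.
  intros Hz Hw Hh; induction n as [|n IH].
  - simpl. replace (0 - 0 - h * 0)%C with (RtoC 0) by ring. rewrite Cmod_0.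
    pose proof (pow2_ge_0 (Cmod h)); simpl in *; lra.
  - rewrite S_INR. simpl dd; simpl dd1.
    replace ((z + h) ^ n + w * dd n (z + h) w - (z ^ n + w * dd n z w)
             - h * (dd n z z + w * dd1 n z w))%C
      with (((z + h) ^ n - z ^ n - h * dd n z z)
            + w * (dd n (z + h) w - dd n z w - h * dd1 n z w))%C by ring.
    eapply Rle_trans; [apply Cmod_add_le; [apply pow_second_order; auto|
      apply Cmod_mul_le; [exact Hw|exact IH]]|].
    pose proof (pos_INR n). pose proof (pow2_ge_0 (Cmod h)).
    rewrite Rmult_1_l, <- Rmult_plus_distr_r. apply Rmult_le_compat_r; auto.
    simpl; nra.
Qed.

(** In 1 - p^n = (1 - p)(1 + p + ... + p^(n-1)) each of the n terms is at least p^n. *)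
Lemma INR_pow_le (p : R) (n : nat) : 0 <= p < 1 -> INR n * p ^ n <= / (1 - p).
Proof.
  intros Hp. assert (H : INR n * p ^ n * (1 - p) <= 1 - p ^ n).
  { induction n as [|n IH]; [simpl; lra|].
    rewrite S_INR. simpl pow. assert (0 <= p ^ n) by (apply pow_le; lra).
    assert (p * (INR n * p ^ n * (1 - p)) <= p * (1 - p ^ n)) by (apply Rmult_le_compat_l; lra).
    assert (p ^ n <= 1) by (rewrite <- (pow1 n); apply pow_incr; lra).
    assert (0 <= p * p ^ n <= 1) by (split; [apply Rmult_le_pos|
      rewrite <- (Rmult_1_r 1); apply Rmult_le_compat]; lra).
    assert (0 <= (1 - p) * (1 - p * p ^ n)) by (apply Rmult_le_pos; lra). nra. }
  assert (0 <= p ^ n) by (apply pow_le; lra).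
  apply (Rmult_le_reg_r (1 - p)); [lra|]. rewrite Rinv_l by lra. lra.
Qed.

(** With p the fourth root of q, n^3 q^n = (n p^n)^3 p^n: three factors absorb the powers of n and
    the fourth gives a geometric majorant. *)
Lemma ex_series_cube_geom (q : R) : 0 <= q < 1 -> ex_series (fun n => INR n ^ 3 * q ^ n).
Proof.
  intros Hq. set (p := sqrt (sqrt q)).
  assert (Hp0 : 0 <= p) by apply sqrt_pos.
  assert (Hp4 : p ^ 4 = q).
  { replace (p ^ 4) with ((p * p) * (p * p)) by ring. unfold p.
    rewrite sqrt_sqrt by apply sqrt_pos. apply sqrt_sqrt; lra. }
  assert (Hp1 : p < 1).
  { apply Rnot_le_lt; intros H. assert (1 <= p ^ 4) by (apply pow_R1_Rle; auto). lra. }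
  apply (ex_series_le (fun n => INR n ^ 3 * q ^ n) (fun n => (/ (1 - p)) ^ 3 * p ^ n)).
  - intros n. change (Rabs (INR n ^ 3 * q ^ n) <= (/ (1 - p)) ^ 3 * p ^ n).
    pose proof (pos_INR n). assert (Hpn : 0 <= p ^ n) by (apply pow_le; auto).
    replace (INR n ^ 3 * q ^ n) with ((INR n * p ^ n) ^ 3 * p ^ n).
    2:{ rewrite <- Hp4, <- pow_mult, (Nat.mul_comm 4 n), pow_mult. ring. }
    assert (0 <= INR n * p ^ n) by (apply Rmult_le_pos; auto).
    rewrite Rabs_pos_eq by (apply Rmult_le_pos; [apply pow_le|]; auto).
    apply Rmult_le_compat_r; auto. apply (pow_incr _ _ 3). split; auto.
    apply INR_pow_le; lra.
  - apply (ex_series_scal_l ((/ (1 - p)) ^ 3) (fun n => p ^ n)), ex_series_geom.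
    rewrite Rabs_pos_eq; lra.
Qed.

(** * Functions with a holomorphic divided difference *)

Notation cdisk := (annulus 0).

Lemma cdisk_intro (z : C) : Cmod z <= 1 -> cdisk z.
Proof. split; [apply Cmod_ge_0|auto]. Qed.

Lemma cdisk_0 : cdisk 0%C.
Proof. apply cdisk_intro; rewrite Cmod_0; lra. Qed.

Lemma grid_point (N k : nat) : (k <= S N)%nat -> 0 <= INR k * / INR (S N) <= 1.
Proof.
  intros Hk. pose proof (pos_INR k). pose proof (INR_S_pos N) as HN.
  split; [apply Rmult_le_pos; [lra|left; apply Rinv_0_lt_compat; auto]|].
  apply (Rmult_le_reg_r (INR (S N))); auto. rewrite Rmult_assoc, Rinv_l by lra.
  rewrite Rmult_1_l, Rmult_1_r. apply le_INR; lia.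
Qed.

Lemma UH_bounds {I : Type} (P : I -> Prop) (r : R) (K K1 : I -> C -> C) : UH P r K K1 ->
  exists M, 0 <= M /\ (forall i z, P i -> annulus r z -> Cmod (K i z) <= M) /\
    forall i z z', P i -> annulus r z -> annulus r z' ->
      Cmod (K i z' - K i z)%C <= M * Cmod (z' - z)%C.
Proof.
  intros HK. destruct (UH_lip _ _ HK) as (M & HM & H). exists M; repeat split; auto.
  - intros i z Hi Hz. apply (H i z 0%C); auto. now rewrite Cplus_0_r.
  - intros i z z' Hi Hz Hz'. replace z' with (z + (z' - z))%C at 1 by ring.
    apply H; auto. now replace (z + (z' - z))%C with z' by ring.
Qed.

Lemma lipschitz_lower (r M : R) (f : C -> C) : 0 <= M ->
  (forall z z', annulus r z -> annulus r z' -> Cmod (f z' - f z)%C <= M * Cmod (z' - z)%C) ->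
  (forall z, annulus r z -> f z <> 0%C) ->
  exists c, 0 < c /\ forall z, annulus r z -> c <= Cmod (f z).
Proof.
  intros HM HL Hn. apply (annulus_compact r (fun z c => c <= Cmod (f z))).
  - intros; lra.
  - intros z Hz. assert (Hp : 0 < Cmod (f z)) by (apply Cmod_gt_0; auto).
    (* With (M + 1) d = |f z| / 2, a move by less than d leaves at least 2 (M + 1) d - M d >= d, so
       d serves as radius and as lower bound. *)
    exists (Cmod (f z) / 2 / (M + 1)).
    assert (Hd : 0 < Cmod (f z) / 2 / (M + 1)) by (apply Rdiv_lt_0_compat; lra).
    split; auto. set (d := Cmod (f z) / 2 / (M + 1)) in *.
    assert (E : (M + 1) * d = Cmod (f z) / 2) by (unfold d; field; lra).
    intros z' Hz' Hc. specialize (HL z z' Hz Hz').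
    pose proof (Cmod_sub_ge (f z) (f z')). rewrite Cmod_sub_sym in H.
    assert (M * Cmod (z' - z)%C <= M * d) by (apply Rmult_le_compat_l; lra).
    nra.
Qed.

(* Functions whose divided difference D extends holomorphically across the diagonal, uniformly
   in the second variable; D z z is then the derivative of phi. *)
Definition dclass (phi : C -> C) (D : C -> C -> C) : Prop :=
  (forall z w, cdisk z -> cdisk w -> (phi z - phi w)%C = ((z - w) * D z w)%C) /\
  exists D1, UH cdisk 0 (fun w z => D z w) D1.

(** Off the diagonal both sides are the same difference quotient. The class controls only the first
    variable; symmetry transfers its estimates to the second. *)
Lemma dclass_sym (phi : C -> C) (D : C -> C -> C) (z w : C) :
  dclass phi D -> cdisk z -> cdisk w -> D z w = D w z.
Proof.
  intros [H _] Hz Hw. destruct (classic (z = w)) as [->|Hne]; [reflexivity|].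
  assert (Hzw : (z - w)%C <> 0%C).
  { intros E; apply Hne. replace z with ((z - w) + w)%C by ring. rewrite E; ring. }
  replace (D z w) with (/ (z - w) * ((z - w) * D z w))%C by (field; auto).
  rewrite <- H by auto.
  replace (phi z - phi w)%C with (- (phi w - phi z))%C by ring.
  rewrite H by auto. field; auto.
Qed.

Lemma dclass_UH {I : Type} (P : I -> Prop) (phi : C -> C) (D : C -> C -> C) :
  dclass phi D -> UH P 0 (fun _ z => phi z) (fun _ z => D z z).
Proof.
  intros [H [D1 HD]]. destruct (UH_bounds _ _ _ _ HD) as (M & HM & HB & HL).
  pose proof cdisk_0 as H0.
  apply (UH_intro _ _ (Cmod (phi 0%C) + 1 * M) M M).
  - intros _ z _ Hz. replace (phi z) with (phi 0%C + (phi z - phi 0%C))%C by ring.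
    apply Cmod_add_le; [lra|]. rewrite H by auto. apply Cmod_mul_le; auto.
    replace (z - 0)%C with z by ring. apply Hz.
  - intros _ z _ Hz; apply (HB z z); auto.
  - intros _ z h _ Hz Hh. rewrite H by auto.
    replace ((z + h - z) * D (z + h) z - h * D z z)%C with (h * (D (z + h) z - D z z))%C by ring.
    eapply Rle_trans; [apply Cmod_mul_le; [apply Rle_refl|apply (HL z z (z + h)%C); auto]|].
    replace (z + h - z)%C with h by ring. apply Req_le; ring.
Qed.

Lemma dclass_bounded (phi : C -> C) (D : C -> C -> C) : dclass phi D ->
  exists M, 0 <= M /\ (forall z, cdisk z -> Cmod (phi z) <= M) /\
    forall z z', cdisk z -> cdisk z' -> Cmod (phi z' - phi z)%C <= M * Cmod (z' - z)%C.
Proof.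
  intros H. destruct (UH_bounds _ _ _ _ (dclass_UH (fun _ : unit => True) _ _ H))
    as (M & HM & HB & HL).
  exists M; repeat split; auto; intros; [apply (HB tt)|apply (HL tt)]; auto.
Qed.

Lemma dclass_lower (phi : C -> C) (D : C -> C -> C) : dclass phi D ->
  (forall z, cdisk z -> phi z <> 0%C) ->
  exists c, 0 < c /\ forall z, cdisk z -> c <= Cmod (phi z).
Proof.
  intros H Hn. destruct (dclass_bounded _ _ H) as (M & HM & _ & HL).
  now apply (lipschitz_lower 0 M).
Qed.

Lemma dclass_UH_second (phi : C -> C) (D : C -> C -> C) : dclass phi D ->
  UH cdisk 0 (fun w _ => phi w) (fun _ _ => 0%C).
Proof.
  intros H. destruct (dclass_bounded _ _ H) as (M & _ & HB & _).
  now apply (UH_const phi M).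
Qed.

Lemma dclass_const (c : C) : dclass (fun _ => c) (fun _ _ => 0%C).
Proof.
  split; [intros; ring|]. eexists. apply (UH_const (fun _ => 0%C) 0).
  intros; rewrite Cmod_0; lra.
Qed.

Lemma dclass_id : dclass (fun z => z) (fun _ _ => 1%C).
Proof.
  split; [intros; ring|]. eexists. apply (UH_const (fun _ => 1%C) 1).
  intros; rewrite Cmod_1; lra.
Qed.

Lemma dclass_mult (phi psi : C -> C) (D E : C -> C -> C) : dclass phi D -> dclass psi E ->
  dclass (fun z => phi z * psi z)%C (fun z w => D z w * psi z + phi w * E z w)%C.
Proof.
  intros H1 H2; split.
  - intros z w Hz Hw.
    replace (phi z * psi z - phi w * psi w)%C
      with ((phi z - phi w) * psi z + phi w * (psi z - psi w))%C by ring.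
    rewrite (proj1 H1), (proj1 H2) by auto; ring.
  - pose proof (dclass_UH cdisk _ _ H2) as A. pose proof (dclass_UH_second _ _ H1) as B.
    destruct (proj2 H1) as [D1 HD]. destruct (proj2 H2) as [E1 HE].
    eexists. exact (UH_plus _ _ _ _ (UH_mult _ _ _ _ HD A) (UH_mult _ _ _ _ B HE)).
Qed.

Lemma dclass_inv (phi : C -> C) (D : C -> C -> C) : dclass phi D ->
  (forall z, cdisk z -> phi z <> 0%C) ->
  dclass (fun z => / phi z)%C (fun z w => (-1) * (D z w * (/ phi z * / phi w)))%C.
Proof.
  intros H Hn; destruct (dclass_lower _ _ H Hn) as (c & Hc & Hlow). split.
  - intros z w Hz Hw. replace (/ phi z - / phi w)%C
      with (- ((phi z - phi w) * (/ phi z * / phi w)))%C by (field; auto).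
    rewrite (proj1 H) by auto; ring.
  - destruct (proj2 H) as [D1 HD]. eexists.
    refine (UH_scal (-1) _ _ (UH_mult _ _ _ _ HD (UH_mult _ _ _ _
      (UH_inv _ _ c Hc _ (dclass_UH cdisk _ _ H))
      (UH_inv _ _ c Hc _ (dclass_UH_second _ _ H))))); auto.
Qed.

Lemma dclass_sqrt (s q : C -> C) (D : C -> C -> C) (c : R) : 0 < c ->
  (forall z, cdisk z -> (s z * s z)%C = q z /\ c <= Re (s z)) -> dclass q D ->
  dclass s (fun z w => D z w * / (s z + s w))%C.
Proof.
  intros Hc Hs H.
  assert (Hlow : forall z w, cdisk z -> cdisk w -> c <= Cmod (s z + s w)%C).
  { intros z w Hz Hw. destruct (Hs z Hz) as [_ A]. destruct (Hs w Hw) as [_ B].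
    eapply Rle_trans; [|eapply Rle_trans; [apply Rle_abs|apply re_le_Cmod]].
    unfold Re in *; simpl; lra. }
  assert (Hn : forall z w, cdisk z -> cdisk w -> (s z + s w)%C <> 0%C)
    by (intros; eapply Cmod_pos_neq; eauto).
  assert (A : UH cdisk 0 (fun _ z => s z) (fun _ z => D z z * / (2 * s z))%C).
  { apply (UH_sqrt (fun _ z => s z) (fun _ z => q z) (fun _ z => D z z) c Hc).
    - intros _ z _ Hz; apply Hs; auto.
    - now apply dclass_UH. }
  destruct (UH_bounds _ _ _ _ A) as (M & _ & HM & _).
  assert (H1 : cdisk 1%C) by (apply cdisk_intro; rewrite Cmod_1; lra).
  split.
  - intros z w Hz Hw. specialize (proj1 H z w Hz Hw) as E.
    rewrite <- (proj1 (Hs z Hz)), <- (proj1 (Hs w Hw)) in E.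
    rewrite Cmult_assoc, <- E. field; auto.
  - destruct (proj2 H) as [D1 HD]. eexists.
    refine (UH_mult _ _ _ _ HD (UH_inv _ _ c Hc _ (UH_plus _ _ _ _ A
      (UH_const s M (fun i Hi => HM 1%C i H1 Hi))))).
    intros; auto.
Qed.

Lemma dclass_comp (phi u : C -> C) (D E : C -> C -> C) : dclass phi D -> dclass u E ->
  (forall z, cdisk z -> cdisk (u z)) ->
  dclass (fun z => phi (u z)) (fun z w => D (u z) (u w) * E z w)%C.
Proof.
  intros H Hu Hm; split.
  - intros z w Hz Hw. rewrite (proj1 H), (proj1 Hu) by auto; ring.
  - destruct (proj2 H) as [D1 HD]. destruct (proj2 Hu) as [E1 HE].
    pose proof (UH_reindex cdisk cdisk 0 u _ _ Hm HD) as HD'.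
    eexists. refine (UH_mult _ _ _ _ (UH_comp 0 _ _ _ _ (dclass_UH cdisk _ _ Hu) HD' _) HE).
    intros; auto.
Qed.

Lemma dclass_scal_arg (t : R) : 0 <= t <= 1 -> dclass (fun z => t * z)%C (fun _ _ => RtoC t).
Proof.
  intros Ht; split; [intros; ring|]. eexists. apply (UH_const (fun _ => RtoC t) 1).
  intros; rewrite Cmod_R, Rabs_pos_eq; lra.
Qed.

Lemma cdisk_scal (t : R) (z : C) : 0 <= t <= 1 -> cdisk z -> cdisk (t * z)%C.
Proof.
  intros Ht [_ Hz]; apply cdisk_intro. rewrite Cmod_mult, Cmod_R, Rabs_pos_eq by lra.
  pose proof (Cmod_ge_0 z); nra.
Qed.

Lemma cdisk_mult (z w : C) : cdisk z -> cdisk w -> cdisk (z * w)%C.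
Proof.
  intros [_ Hz] [_ Hw]; apply cdisk_intro. replace 1 with (1 * 1) by ring.
  now apply Cmod_mul_le.
Qed.

Lemma dclass_pseries (b : nat -> C) : ex_series (fun n => INR n ^ 3 * Cmod (b n)) ->
  ex_series (fun n => Cmod (b n)) ->
  dclass (fun z => csum (fun n => b n * z ^ n)%C) (fun z w => csum (fun n => b n * dd n z w)%C).
Proof.
  intros H3 H0.
  assert (Hpow : forall n z, cdisk z -> Cmod (b n * z ^ n)%C <= Cmod (b n)).
  { intros n z Hz. rewrite <- (Rmult_1_r (Cmod (b n))).
    apply Cmod_mul_le; [lra|apply Cmod_pow_le1, Hz]. }
  assert (Hc : forall n k, (1 <= k <= 3)%nat -> INR n ^ k <= INR n ^ 3).
  { intros [|n] k Hk.
    - destruct k; [lia|]. simpl. rewrite !Rmult_0_l; lra.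
    - apply Rle_pow; [apply (le_INR 1); lia|lia]. }
  assert (Hle : forall n k x, (1 <= k <= 3)%nat -> Cmod x <= INR n ^ k ->
             Cmod (b n * x)%C <= INR n ^ 3 * Cmod (b n)).
  { intros n k x Hk Hx. rewrite Rmult_comm. apply Cmod_mul_le; [lra|].
    eapply Rle_trans; [exact Hx|auto]. }
  assert (Hdd : forall n z w, cdisk z -> cdisk w ->
             Cmod (b n * dd n z w)%C <= INR n ^ 3 * Cmod (b n)).
  { intros n z w Hz Hw. apply (Hle n 1%nat); [lia|].
    rewrite pow_1. apply dd_le; [apply Hz|apply Hw]. }
  split.
  - intros z w Hz Hw. rewrite <- (csum_scal _ _ (fun n => INR n ^ 3 * Cmod (b n))) by auto.
    rewrite <- (csum_minus _ _ (fun n => Cmod (b n)) (fun n => Cmod (b n))) by auto.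
    apply csum_ext; intros n.
    replace (b n * z ^ n - b n * w ^ n)%C with (b n * (z ^ n - w ^ n))%C by ring.
    rewrite dd_spec; ring.
  - eexists. apply (UH_csum cdisk 0 (fun n w z => b n * dd n z w)%C
      (fun n w z => b n * dd1 n z w)%C (fun n => INR n ^ 3 * Cmod (b n))); auto.
    intros n w z Hw Hz; split; [auto|split].
    + apply (Hle n 2%nat); [lia|]. apply dd1_le; [apply Hz|apply Hw].
    + intros h Hh.
      replace (b n * dd n (z + h) w - b n * dd n z w - h * (b n * dd1 n z w))%C
        with (b n * (dd n (z + h) w - dd n z w - h * dd1 n z w))%C by ring.
      rewrite Cmod_mult, (Rmult_comm (INR n ^ 3)), Rmult_assoc.
      apply Rmult_le_compat_l; [apply Cmod_ge_0|].
      apply dd_second_order; [apply Hz|apply Hw|apply Hh].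
Qed.

(** The principal branch: the real part is the half-angle formula, and the imaginary part is then
    forced by 2 x y = Im q. *)
Definition psqrt (q : C) : C :=
  let x := sqrt ((Cmod q + Re q) / 2) in (x, Im q / (2 * x)).

(** Closeness to 1 gives Re q >= 1 / 2, hence x^2 >= 1 / 2 and x >= 1 / 2: the division is
    legitimate and the lower bound required by [dclass_sqrt] is available. *)
Lemma psqrt_spec (q : C) : Cmod (q - 1)%C <= 1 / 2 ->
  (psqrt q * psqrt q)%C = q /\ 1 / 2 <= Re (psqrt q).
Proof.
  intros Hq. assert (Ha : 1 / 2 <= Re q).
  { pose proof (re_le_Cmod (q - 1)%C) as H. apply Rabs_le_between in H.
    unfold Re in *; simpl in *. lra. }
  set (m := Cmod q). assert (Hm : Re q <= m)
    by (eapply Rle_trans; [apply Rle_abs|apply re_le_Cmod]).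
  assert (Hm2 : m * m = Re q * Re q + Im q * Im q)
    by (pose proof (Cmod2_alt q) as H; fold m in H; simpl in H; lra).
  unfold psqrt; fold m. set (x := sqrt ((m + Re q) / 2)).
  assert (Hx2 : x * x = (m + Re q) / 2) by (apply sqrt_sqrt; lra).
  assert (Hx0 : 0 <= x) by apply sqrt_pos.
  assert (Hx : 1 / 2 <= x) by nra.
  split; [|exact Hx].
  apply injective_projections; simpl.
  - apply (Rmult_eq_reg_r (x * x)); [|nra].
    replace ((x * x - Im q / (2 * x) * (Im q / (2 * x))) * (x * x))
      with (x * x * (x * x) - Im q * Im q / 4) by (field; lra).
    rewrite Hx2. change (fst q) with (Re q).
    replace (Im q * Im q) with (m * m - Re q * Re q) by lra. field.
  - change (snd q) with (Im q). field; lra.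
Qed.

Lemma psqrt_1 : psqrt 1 = 1%C.
Proof.
  unfold psqrt. rewrite Cmod_1. simpl. replace ((1 + 1) / 2) with 1 by field.
  rewrite sqrt_1. unfold RtoC. f_equal. field.
Qed.

(* The square root is built along the rays t |-> t z: consecutive ratios
   F(t_{k+1} z) / F(t_k z) stay close to 1, where the principal branch applies. *)
Lemma dclass_has_sqrt (F : C -> C) (D : C -> C -> C) : dclass F D -> F 0%C = 1%C ->
  (forall z, cdisk z -> F z <> 0%C) ->
  exists h E, dclass h E /\ h 0%C = 1%C /\ forall z, cdisk z -> (h z * h z)%C = F z.
Proof.
  intros H H0 Hn. destruct (dclass_lower _ _ H Hn) as (c & Hc & Hlow).
  destruct (dclass_bounded _ _ H) as (M & HM & _ & HL).
  (* One step along the ray moves F by at most M / [S N] while |F| >= c, so consecutive ratios lie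
     within 1 / 2 of 1. *)
  destruct (small_inv_INR M (c / 2) ltac:(lra)) as [N HN].
  specialize (HN N (Nat.le_refl _)). pose proof (INR_S_pos N) as HNp.
  assert (Hinv : 0 < / INR (S N)) by (apply Rinv_0_lt_compat; auto).
  pose proof cdisk_0 as Hd0.
  pose proof (grid_point N) as Ht.
  assert (Hk : forall k, (k <= S N)%nat -> exists h E, dclass h E /\ h 0%C = 1%C /\
    forall z, cdisk z -> (h z * h z)%C = F (RtoC (INR k * / INR (S N)) * z)%C).
  { induction k as [|k IH]; intros Hk.
    - exists (fun _ => 1%C), (fun _ _ => 0%C); split; [apply dclass_const|split; auto].
      intros z Hz. simpl INR. rewrite Rmult_0_l, Cmult_0_l, H0. ring.
    - destruct IH as (h & E & Hh & Hh0 & Hsq); [lia|].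
      set (t := INR k * / INR (S N)) in *. set (t' := INR (S k) * / INR (S N)).
      assert (T : 0 <= t <= 1) by (apply Ht; lia).
      assert (T' : 0 <= t' <= 1) by (apply Ht; lia).
      pose proof (dclass_comp _ _ _ _ H (dclass_scal_arg t T) (fun z => cdisk_scal t z T)) as A.
      pose proof (dclass_comp _ _ _ _ H (dclass_scal_arg t' T') (fun z => cdisk_scal t' z T')) as A'.
      assert (Hnt : forall z, cdisk z -> F (t * z)%C <> 0%C)
        by (intros; apply Hn, cdisk_scal; auto).
      pose proof (dclass_mult _ _ _ _ A' (dclass_inv _ _ A Hnt)) as Q.
      set (q := fun z : C => (F (t' * z) * / F (t * z))%C) in Q.
      assert (Hq : forall z, cdisk z ->
                 (psqrt (q z) * psqrt (q z))%C = q z /\ 1 / 2 <= Re (psqrt (q z))).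
      { intros z Hz. apply psqrt_spec. unfold q.
        replace (F (t' * z) * / F (t * z) - 1)%C
          with ((F (t' * z) - F (t * z)) * / F (t * z))%C by (field; auto).
        eapply Rle_trans; [apply (Cmod_mul_le _ _ (M * / INR (S N)) (/ c))|].
        - eapply Rle_trans; [apply HL; apply cdisk_scal; auto|].
          apply Rmult_le_compat_l; auto.
          replace (t' * z - t * z)%C with (RtoC (/ INR (S N)) * z)%C.
          + rewrite Cmod_mult, Cmod_R, Rabs_pos_eq by lra.
            rewrite <- (Rmult_1_r (/ INR (S N))) at 2.
            apply Rmult_le_compat_l; [lra|apply Hz].
          + unfold t', t. rewrite (S_INR k), Rmult_plus_distr_r, Rmult_1_l, RtoC_plus. ring.
        - apply Cmod_inv_le; auto. apply Hlow, cdisk_scal; auto.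
        - apply Rle_trans with (c / 2 * / c).
          + apply Rmult_le_compat_r; [left; apply Rinv_0_lt_compat; auto|exact HN].
          + apply Req_le; field; lra. }
      pose proof (dclass_mult _ _ _ _ Hh
        (dclass_sqrt (fun z => psqrt (q z)) q _ (1 / 2) ltac:(lra) Hq Q)) as HS.
      exists (fun z => h z * psqrt (q z))%C. eexists; split; [exact HS|split].
      + rewrite Hh0. unfold q. rewrite !Cmult_0_r, H0.
        replace (1 * / 1)%C with (RtoC 1) by field. rewrite psqrt_1; ring.
      + intros z Hz.
        replace (h z * psqrt (q z) * (h z * psqrt (q z)))%C
          with ((h z * h z) * (psqrt (q z) * psqrt (q z)))%C by ring.
        rewrite Hsq, (proj1 (Hq z Hz)) by auto. unfold q. field; auto. }
  destruct (Hk (S N) (Nat.le_refl _)) as (h & E & Hh & Hh0 & Hsq).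
  exists h, E; split; [auto|split; auto]. intros z Hz. rewrite Hsq by auto.
  rewrite Rinv_r by lra. f_equal; ring.
Qed.

(** * Hurwitz's theorem for divided differences *)

Section Injective.
Variables (phi : C -> C) (D : C -> C -> C).
Hypothesis Hphi : dclass phi D.
Hypothesis Hinj : forall z w, cdisk z -> cdisk w -> phi z = phi w -> z = w.

(* Hurwitz: if D z0 z0 = 0 then, by the mean value property of 1 / D, every D _ w with w
   near z0 vanishes somewhere near z0, and by injectivity only at w; thus phi would have
   zero derivative near z0. *)
Lemma injective_diagonal (z0 : C) : Cmod z0 < 1 -> D z0 z0 <> 0%C.
Proof.
  intros Hz0 HD0.
  pose proof (Cmod_ge_0 z0) as Hz0'.
  pose proof cdisk_0 as Hd0.
  assert (Hdz : cdisk z0) by (apply cdisk_intro; lra).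
  destruct (proj2 Hphi) as [D1 HD].
  destruct (UH_bounds _ _ _ _ HD) as (M & HM & HB & HL).
  assert (HL2 : forall z w w', cdisk z -> cdisk w -> cdisk w' ->
            Cmod (D z w' - D z w)%C <= M * Cmod (w' - w)%C).
  { intros z w w' Hz Hw Hw'. rewrite (dclass_sym phi D z w'), (dclass_sym phi D z w) by auto.
    apply (HL z w w'); auto. }
  assert (Hoff : forall z w, cdisk z -> cdisk w -> z <> w -> D z w <> 0%C).
  { intros z w Hz Hw Hne HE. apply Hne, Hinj; auto.
    pose proof (proj1 Hphi z w Hz Hw) as E. rewrite HE in E.
    replace (phi z) with ((phi z - phi w) + phi w)%C by ring. rewrite E; ring. }
  set (r := (1 - Cmod z0) / 2). assert (Hr : 0 < r) by (unfold r; lra).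
  assert (Hin : forall u, cdisk u -> cdisk (z0 + r * u)%C).
  { intros u [_ Hu]; apply cdisk_intro.
    eapply Rle_trans; [apply Cmod_add_le; [apply Rle_refl|apply Cmod_mul_le;
      [apply Rle_refl|exact Hu]]|].
    rewrite Cmod_R, Rabs_pos_eq by lra. unfold r; lra. }
  assert (Hu : UH cdisk 0 (fun _ u => z0 + r * u)%C (fun _ u => 0 + (0 * u + r * 1))%C).
  { apply UH_plus; [apply (UH_const (fun _ => z0) (Cmod z0)); intros; lra|].
    apply UH_mult; [apply (UH_const (fun _ => RtoC r) (Cmod r)); intros; lra|apply UH_id]. }
  set (G := fun w u => D (z0 + r * u)%C w).
  assert (HG : UH cdisk 0 G (fun w u => D1 w (z0 + r * u) * (0 + (0 * u + r * 1)))%C)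
    by (apply (UH_comp 0 _ _ _ _ Hu HD); auto).
  destruct (UH_bounds _ _ _ _ HG) as (M1 & HM1 & HB1 & HL1).
  assert (Hcirc : exists m, 0 < m /\ forall u, annulus 1 u -> m <= Cmod (G z0 u)).
  { apply (lipschitz_lower 1 M1); auto.
    - intros u u' [A B] [A' B']; apply HL1; auto; apply cdisk_intro; auto.
    - intros u [A B]. apply Hoff; auto.
      + apply Hin, cdisk_intro; auto.
      + intros E. assert (E1 : (r * u)%C = 0%C)
          by (replace (r * u)%C with ((z0 + r * u) - z0)%C by ring; rewrite E; ring).
        apply (f_equal Cmod) in E1. rewrite Cmod_mult, Cmod_R, Cmod_0, Rabs_pos_eq in E1 by lra.
        nra. }
  destruct Hcirc as (m & Hm & Hcirc).
  (* For w within k of [z0] the kernel changes by at most m / 8: it stays above m / 2 on the circle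
     and is at most m / 8 at the centre. *)
  set (k := Rmin r (m / 8 / (M + 1))).
  assert (Hk : 0 < k) by (apply Rmin_pos; [auto|apply Rdiv_lt_0_compat; lra]).
  assert (Hkr : k <= r) by apply Rmin_l.
  assert (HMk : M * k <= m / 8).
  { apply Rle_trans with (M * (m / 8 / (M + 1))); [apply Rmult_le_compat_l; [auto|apply Rmin_r]|].
    apply (Rmult_le_reg_r (M + 1)); [lra|].
    replace (M * (m / 8 / (M + 1)) * (M + 1)) with (M * (m / 8)) by (field; lra). nra. }
  assert (Hnear : forall w, Cmod (w - z0)%C <= k -> cdisk w).
  { intros w Hw; apply cdisk_intro. replace w with (z0 + (w - z0))%C by ring.
    eapply Rle_trans; [apply Cmod_triangle|]. unfold r in Hkr; lra. }
  assert (Hdiag : forall w, Cmod (w - z0)%C <= k -> D w w = 0%C).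
  { intros w Hw. pose proof (Hnear w Hw) as Hdw.
    assert (Hd : forall z, cdisk z -> Cmod (D z w - D z z0)%C <= m / 8).
    { intros z Hz. eapply Rle_trans; [apply HL2; auto|].
      eapply Rle_trans; [apply Rmult_le_compat_l; [auto|exact Hw]|auto]. }
    (* A zero of [G w] can only sit on the diagonal. Without zeros, 1 / [G w] would be holomorphic
       with modulus at least 8 / m at the centre, while its circle mean is at most 2 / m and tends
       to the central value. *)
    destruct (classic (exists u, cdisk u /\ G w u = 0%C)) as [(u & Hcu & HGu)|Hno].
    - unfold G in HGu. destruct (classic ((z0 + r * u)%C = w)) as [E|E].
      + now rewrite E in HGu.
      + exfalso; revert HGu; apply Hoff; auto.
    - exfalso.
      assert (Hn : forall u, cdisk u -> G w u <> 0%C) by (intros u Hcu E; apply Hno; eauto).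
      destruct (lipschitz_lower 0 M1 (G w) HM1 (fun z z' => HL1 w z z' Hdw) Hn)
        as (c & Hc & Hlow).
      (* The lower bound [c] depends on w, so the family is cut down to this single index before
         inverting. *)
      assert (HGw : UH (eq w) 0 G (fun w u => D1 w (z0 + r * u) * (0 + (0 * u + r * 1)))%C).
      { eapply UH_restrict; [| |exact HG]; [intros i <-; auto|lra]. }
      assert (Hinv := UH_inv _ _ c Hc (fun i z (Hi : w = i) Hz =>
                 eq_ind w (fun i => c <= Cmod (G i z)) (Hlow z Hz) i Hi) HGw).
      assert (HK := UH_minus _ _ _ _ Hinv (UH_const (P := eq w) (r := 0)
                 (fun i => / G i 0%C)%C (/ c) (fun i (Hi : w = i) =>
                 eq_ind w (fun i => Cmod (/ G i 0%C)%C <= / c)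
                   (Cmod_inv_le _ _ Hc (Hlow 0%C Hd0)) i Hi))).
      destruct (UH_bounds _ _ _ _ Hinv) as (M2 & HM2 & _ & HL3).
      destruct (mean_vanish _ _ _ 0 M2 HK) with (eps := / m) as [N HN].
      + intros i u <- Hcu. eapply Rle_trans; [apply (HL3 w 0%C u); auto|].
        simpl. replace (u - 0)%C with u by ring. lra.
      + apply Rinv_0_lt_compat; auto.
      + specialize (HN N (Nat.le_refl _) w eq_refl).
        rewrite (cmean_ext N _ (fun u => / G w u - / G w 0%C)%C) in HN
          by (intros; simpl; ring).
        rewrite cmean_minus, cmean_const in HN.
        assert (HA : Cmod (cmean N (fun u => / G w u)%C) <= / (m / 2)).
        { apply cmean_le. intros u Hcu. apply Cmod_inv_le; [lra|].
          assert (Hu1 : annulus 1 u) by (split; lra).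
          specialize (Hcirc u Hu1). unfold G in Hcirc |- *.
          assert (Hc1 : cdisk (z0 + r * u)%C) by (apply Hin, cdisk_intro; lra).
          specialize (Hd _ Hc1).
          pose proof (Cmod_sub_ge (D (z0 + r * u) z0)%C (D (z0 + r * u) w)%C).
          rewrite Cmod_sub_sym in H. lra. }
        assert (HB0 : Cmod (G w 0%C) <= m / 8).
        { unfold G. replace (z0 + r * 0)%C with z0 by ring. specialize (Hd z0 Hdz).
          rewrite HD0 in Hd. now replace (D z0 w - 0)%C with (D z0 w) in Hd by ring. }
        assert (HB2 : / (m / 8) <= Cmod (/ G w 0%C)%C).
        { rewrite Cmod_inv by (apply Hn; auto). apply Rinv_le_contravar; auto.
          apply Cmod_gt_0, Hn; auto. }
        pose proof (Cmod_sub_ge (/ G w 0%C)%C (cmean N (fun u => / G w u)%C)).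
        rewrite Cmod_sub_sym in H.
        replace (/ (m / 8)) with (8 * / m) in HB2 by (field; lra).
        replace (/ (m / 2)) with (2 * / m) in HA by (field; lra).
        assert (0 < / m) by (apply Rinv_0_lt_compat; auto). lra. }
  (* The derivative D u u of phi vanishes on the segment from [z0] to [z0 + k], so phi takes equal
     values at its two ends, against injectivity. *)
  destruct (dclass_UH (fun _ : unit => True) _ _ Hphi) as (M3 & HM3 & H3).
  set (g := fun s : R => phi (z0 + RtoC (s * k))%C).
  assert (Hseg : forall s, 0 <= s <= 1 -> Cmod (z0 + RtoC (s * k) - z0)%C <= k).
  { intros s Hs. replace (z0 + RtoC (s * k) - z0)%C with (RtoC (s * k)) by ring.
    rewrite Cmod_R, Rabs_pos_eq; nra. }
  assert (Hg : g 1 = g 0).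
  { apply (quadratic_constant g (M3 * k ^ 2)). intros s h Hs Hh. unfold g.
    destruct (H3 tt (z0 + RtoC (s * k))%C I (Hnear _ (Hseg s Hs))) as (_ & _ & H4).
    specialize (H4 (RtoC (h * k))).
    replace (z0 + RtoC (s * k) + RtoC (h * k))%C with (z0 + RtoC ((s + h) * k))%C in H4
      by (rewrite Rmult_plus_distr_r, RtoC_plus; ring).
    specialize (H4 (Hnear _ (Hseg _ Hh))). rewrite (Hdiag _ (Hseg s Hs)) in H4.
    eapply Rle_trans; [|eapply Rle_trans; [exact H4|]].
    - apply Req_le; f_equal; ring.
    - rewrite Cmod_R, pow2_abs. apply Req_le; ring. }
  unfold g in Hg. apply Hinj in Hg; [|apply Hnear, Hseg; lra|apply Hnear, Hseg; lra].
  apply (f_equal (fun z => Re (z - z0)%C)) in Hg. unfold Re in Hg; simpl in Hg. lra.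
Qed.

Lemma injective_nonvanishing (z w : C) : Cmod z < 1 -> Cmod w < 1 -> D z w <> 0%C.
Proof.
  intros Hz Hw HE. destruct (classic (z = w)) as [->|Hne].
  - now apply (injective_diagonal w).
  - apply Hne, Hinj; try (apply cdisk_intro; lra).
    pose proof (proj1 Hphi z w) as E. rewrite HE in E.
    replace (phi z) with ((phi z - phi w) + phi w)%C by ring.
    rewrite E by (apply cdisk_intro; lra). ring.
Qed.
End Injective.

(** Compactness is used twice: in z for fixed w, then in w, where symmetry supplies a Lipschitz
    bound in the second variable. *)
Lemma bidisk_lower (phi : C -> C) (D : C -> C -> C) : dclass phi D ->
  (forall z w, cdisk z -> cdisk w -> D z w <> 0%C) ->
  exists c, 0 < c /\ forall z w, cdisk z -> cdisk w -> c <= Cmod (D z w).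
Proof.
  intros H Hn. destruct (proj2 H) as [D1 HD].
  destruct (UH_bounds _ _ _ _ HD) as (M & HM & _ & HL).
  destruct (annulus_compact 0 (fun w c => forall z, cdisk z -> c <= Cmod (D z w)))
    as (c & Hc & Hlow).
  - intros w d d' H1 H2 z Hz; specialize (H1 z Hz); lra.
  - intros w Hw.
    destruct (lipschitz_lower 0 M (fun z => D z w) HM) as (c & Hc & Hlow); auto.
    exists (c / 2 / (M + 1)).
    assert (Hd : 0 < c / 2 / (M + 1)) by (apply Rdiv_lt_0_compat; lra).
    split; auto. set (d := c / 2 / (M + 1)) in *.
    assert (E : (M + 1) * d = c / 2) by (unfold d; field; lra).
    intros w' Hw' Hd' z Hz. specialize (Hlow z Hz).
    assert (HL' := HL z w w' Hz Hw Hw').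
    rewrite (dclass_sym phi D w' z), (dclass_sym phi D w z) in HL' by auto.
    pose proof (Cmod_sub_ge (D z w) (D z w')). rewrite Cmod_sub_sym in H0.
    assert (M * Cmod (w' - w)%C <= M * d) by (apply Rmult_le_compat_l; lra).
    nra.
  - exists c; split; auto.
Qed.

(** * Logarithms *)

(** Partial sum of the first m terms in Horner form, so that peeling off a term shifts the
    coefficient sequence as [csum_incr_1] does. *)
Fixpoint psum (b : nat -> C) (m : nat) (z : C) : C :=
  match m with 0%nat => 0%C | S k => (b 0%nat + z * psum (fun n => b (S n)) k z)%C end.

Lemma pseries_tail (m : nat) (b : nat -> C) : ex_series (fun n => Cmod (b n)) ->
  exists B, 0 <= B /\ forall z, cdisk z ->
    Cmod (csum (fun n => b n * z ^ n) - psum b m z)%C <= B * Cmod z ^ m.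
Proof.
  assert (Hdom : forall (b : nat -> C) n z, cdisk z -> Cmod (b n * z ^ n)%C <= Cmod (b n)).
  { intros b' n z Hz. rewrite <- (Rmult_1_r (Cmod (b' n))).
    apply Cmod_mul_le; [lra|apply Cmod_pow_le1, Hz]. }
  revert b; induction m as [|m IH]; intros b Hb.
  - exists (Rabs (Series (fun n => Cmod (b n)))); split; [apply Rabs_pos|]. intros z Hz.
    simpl psum. simpl pow. rewrite Rmult_1_r.
    replace (csum (fun n => b n * z ^ n) - 0)%C with (csum (fun n => b n * z ^ n)%C) by ring.
    eapply Rle_trans; [|apply Rle_abs]. apply csum_le; auto.
  - assert (Hb' : ex_series (fun n => Cmod (b (S n))))
      by (apply (ex_series_incr_1 (fun n => Cmod (b n))); auto).
    destruct (IH _ Hb') as (B & HB & H). exists B; split; auto. intros z Hz.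
    rewrite (csum_incr_1 _ (fun n => Cmod (b n))) by auto.
    rewrite (csum_ext (fun n => b (S n) * z ^ S n)%C (fun n => z * (b (S n) * z ^ n))%C)
      by (intros; simpl; ring).
    rewrite (csum_scal z _ (fun n => Cmod (b (S n)))); auto.
    2:{ intros n; apply (Hdom (fun n => b (S n))); auto. }
    simpl psum. simpl Cpow.
    match goal with |- Cmod ?x <= _ =>
      replace x with (z * (csum (fun n => b (S n) * z ^ n)
                           - psum (fun n => b (S n)) m z))%C by ring end.
    replace (B * Cmod z ^ S m) with (Cmod z * (B * Cmod z ^ m)) by (simpl; ring).
    apply Cmod_mul_le; [lra|auto].
Qed.

Section Log.
Variable rho : R.
Hypothesis Hrho : 0 <= rho < 1.

(** Taylor coefficients of -log (1 - rho z), the function called [lam]. The factor rho < 1 keeps the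
    singularity off the closed disk. *)
Definition lcoef (n : nat) : C :=
  match n with 0%nat => 0%C | S m => RtoC (rho ^ S m / INR (S m)) end.

Definition lam (z : C) : C := csum (fun n => lcoef n * z ^ n)%C.

Lemma lcoef_le (n : nat) : Cmod (lcoef n) <= rho ^ n.
Proof.
  destruct n as [|n]; [simpl; rewrite Cmod_0; lra|]. unfold lcoef.
  assert (0 <= rho ^ S n) by (apply pow_le; lra). pose proof (INR_S_pos n).
  assert (1 <= INR (S n)) by (apply (le_INR 1); lia).
  assert (/ INR (S n) <= 1) by (rewrite <- Rinv_1; apply Rinv_le_contravar; lra).
  assert (0 < / INR (S n)) by (apply Rinv_0_lt_compat; auto).
  unfold Rdiv. rewrite Cmod_R, Rabs_pos_eq by (apply Rmult_le_pos; lra).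
  rewrite <- (Rmult_1_r (rho ^ S n)) at 2. apply Rmult_le_compat_l; auto.
Qed.

Lemma ex_series_rho : ex_series (fun n => rho ^ n).
Proof. apply ex_series_geom. rewrite Rabs_pos_eq; lra. Qed.

Lemma ex_lcoef : ex_series (fun n => Cmod (lcoef n)).
Proof.
  apply (ex_series_le (fun n => Cmod (lcoef n)) (fun n => rho ^ n)); [|apply ex_series_rho].
  intros n. change (Rabs (Cmod (lcoef n)) <= rho ^ n).
  rewrite Rabs_pos_eq by apply Cmod_ge_0. apply lcoef_le.
Qed.

Lemma ex_lcoef3 : ex_series (fun n => INR n ^ 3 * Cmod (lcoef n)).
Proof.
  apply (ex_series_le (fun n => INR n ^ 3 * Cmod (lcoef n)) (fun n => INR n ^ 3 * rho ^ n));
    [|apply ex_series_cube_geom; auto].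
  intros n. change (Rabs (INR n ^ 3 * Cmod (lcoef n)) <= INR n ^ 3 * rho ^ n).
  assert (0 <= INR n ^ 3) by (apply pow_le, pos_INR).
  rewrite Rabs_pos_eq by (apply Rmult_le_pos; [auto|apply Cmod_ge_0]).
  apply Rmult_le_compat_l; [auto|apply lcoef_le].
Qed.

Definition lamD (z w : C) : C := csum (fun n => lcoef n * dd n z w)%C.

Lemma lam_dclass : dclass lam lamD.
Proof. apply dclass_pseries; [apply ex_lcoef3|apply ex_lcoef]. Qed.

Lemma dd_diag (n : nat) (z : C) : dd (S n) z z = (INR (S n) * z ^ n)%C.
Proof.
  induction n as [|n IH].
  - simpl. ring.
  - change (dd (S (S n)) z z) with (z ^ S n + z * dd (S n) z z)%C.
    rewrite IH, (S_INR (S n)), RtoC_plus. simpl Cpow. ring.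
Qed.

(** The termwise derivative is rho times a geometric series G, and G = 1 + rho z G. *)
Lemma lam_deriv (z : C) : cdisk z -> (lamD z z * (1 - rho * z))%C = RtoC rho.
Proof.
  intros Hz.
  assert (Hg : forall n, Cmod (rho ^ n * z ^ n)%C <= rho ^ n).
  { intros n. rewrite <- (Rmult_1_r (rho ^ n)). apply Cmod_mul_le.
    - rewrite <- RtoC_pow, Cmod_R, Rabs_pos_eq by (apply pow_le; lra). lra.
    - apply Cmod_pow_le1, Hz. }
  assert (E : lamD z z = (rho * csum (fun n => rho ^ n * z ^ n))%C).
  { unfold lamD.
    assert (B : forall n, Cmod (lcoef n * dd n z z)%C <= INR n ^ 3 * rho ^ n).
    { intros n. rewrite Rmult_comm. apply Cmod_mul_le; [apply lcoef_le|].
      eapply Rle_trans; [apply dd_le; apply Hz|]. destruct n as [|n]; [simpl; lra|].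
      rewrite <- (pow_1 (INR (S n))) at 1. apply Rle_pow; [apply (le_INR 1); lia|lia]. }
    rewrite (csum_incr_1 _ _ B) by (apply ex_series_cube_geom; auto).
    rewrite <- (csum_scal _ _ _ Hg ex_series_rho).
    simpl (lcoef 0). rewrite Cmult_0_l, Cplus_0_l. apply csum_ext; intros n.
    rewrite dd_diag. unfold lcoef. rewrite RtoC_div, !RtoC_pow by (apply not_0_INR; lia).
    rewrite !Cpow_S. field. intros E0. apply RtoC_inj in E0.
    pose proof (INR_S_pos n). lra. }
  rewrite E.
  set (G := csum (fun n => rho ^ n * z ^ n)%C).
  assert (HG : G = (1 + rho * z * G)%C).
  { unfold G at 1. rewrite (csum_incr_1 _ _ Hg ex_series_rho).
    unfold G. rewrite <- (csum_scal _ _ _ Hg ex_series_rho).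
    rewrite (csum_ext _ (fun n => rho * z * (rho ^ n * z ^ n))%C) by (intros; simpl; ring).
    simpl. ring. }
  replace (rho * G * (1 - rho * z))%C with (rho * (G - rho * z * G))%C by ring.
  rewrite HG at 1. ring.
Qed.

Lemma lam_lower (z : C) : cdisk z -> 1 - rho <= Cmod (1 - rho * z)%C.
Proof.
  intros Hz. eapply Rle_trans; [|apply Cmod_sub_ge].
  rewrite Cmod_1, Cmod_mult, Cmod_R, Rabs_pos_eq by lra.
  destruct Hz as [H1 H2]. nra.
Qed.

(** The inequality ln x <= x - 1, applied to b / a and to a / b, encloses ln b - ln a between two
    bounds whose gap is the right side. *)
Lemma ln_second_order (a b : R) : 0 < a -> 0 < b ->
  Rabs (ln b - ln a - (b - a) / a) <= (b - a) ^ 2 / (a * b).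
Proof.
  intros Ha Hb.
  assert (E : forall x y, 0 < x -> 0 < y -> ln y - ln x <= (y - x) / x).
  { intros x y Hx Hy. rewrite <- ln_div by auto.
    assert (0 < y / x) by (apply Rdiv_lt_0_compat; auto).
    pose proof (exp_ineq1_le (ln (y / x))). rewrite exp_ln in H0 by auto.
    replace ((y - x) / x) with (y / x - 1) by (field; lra). lra. }
  pose proof (E a b Ha Hb). pose proof (E b a Hb Ha).
  replace ((b - a) ^ 2 / (a * b)) with ((b - a) / a + (a - b) / b) by (field; lra).
  apply Rabs_le; lra.
Qed.

(* The difference of the two sides has zero derivative along rays. *)
Lemma lam_Re (z : C) : cdisk z -> 2 * Re (lam z) = - ln (Cmod (1 - rho * z)%C ^ 2).
Proof.
  intros Hz.
  destruct (dclass_UH (fun _ : unit => True) _ _ lam_dclass) as (M & HM & HK).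
  set (a := fun t : R => Cmod (1 - rho * (t * z))%C ^ 2).
  assert (Ha : forall t, a t = 1 - 2 * rho * t * Re z + rho ^ 2 * t ^ 2 * Cmod z ^ 2).
  { intros t. unfold a. rewrite !Cmod2_alt. unfold Re, Im; simpl. ring. }
  assert (Hseg : forall t, 0 <= t <= 1 -> cdisk (t * z)%C)
    by (intros; apply cdisk_scal; auto).
  assert (Hlow : forall t, 0 <= t <= 1 -> (1 - rho) ^ 2 <= a t).
  { intros t Ht. apply pow_incr; split; [lra|apply lam_lower; auto]. }
  assert (Hp : 0 < (1 - rho) ^ 2) by (apply pow_lt; lra).
  set (g := fun t : R => RtoC (2 * Re (lam (t * z)) + ln (a t))).
  assert (Hg : g 1 = g 0).
  (* Here 2 M is the remainder of [lam], the next term the second order coefficient of [a] over its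
     minimum (1 - rho)^2, and the last one the logarithm error, with 16 from |a(s + h) - a(s)| <= 4
     |h|. *)
  { apply (quadratic_constant g (2 * M + (/ (1 - rho) ^ 2 + 16 * / (1 - rho) ^ 2 * / (1 - rho) ^ 2))).
    intros s h Hs Hh.
    pose proof (Hlow s Hs) as Ls. pose proof (Hlow _ Hh) as Lh.
    destruct (HK tt (s * z)%C Logic.I (Hseg s Hs)) as (_ & _ & H).
    specialize (H (h * z)%C).
    replace (s * z + h * z)%C with ((s + h)%R * z)%C in H by (rewrite RtoC_plus; ring).
    specialize (H (Hseg _ Hh)).
    pose proof (lam_deriv (s * z)%C (Hseg s Hs)) as Hd.
    pose proof (Cmod_ge_0 z) as Hz0. assert (Hz1 : Cmod z <= 1) by apply Hz.
    set (L1 := lamD (s * z) (s * z)) in *.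
    set (E := (lam ((s + h)%R * z) - lam (s * z) - h * z * L1)%C) in *.
    assert (HE : Rabs (Re E) <= M * h ^ 2).
    { eapply Rle_trans; [apply re_le_Cmod|]. eapply Rle_trans; [exact H|].
      rewrite Cmod_mult, Cmod_R. apply Rmult_le_compat_l; auto.
      rewrite Rpow_mult_distr, pow2_abs. pose proof (pow2_ge_0 h).
      assert (Cmod z ^ 2 <= 1) by (rewrite <- (pow1 2); apply pow_incr; lra). nra. }
    assert (HL : Re (z * L1)%C = - (- 2 * rho * Re z + 2 * rho ^ 2 * s * Cmod z ^ 2) / (2 * a s)).
    { assert (Hne : (1 - rho * (s * z))%C <> 0%C).
      { eapply Cmod_pos_neq; [|apply lam_lower; auto]; lra. }
      assert (E2 : (RtoC (a s) * (z * L1))%C = (rho * (z * Cconj (1 - rho * (s * z))))%C).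
      { unfold a. rewrite Cmod2_conj. rewrite <- Hd at 3. ring. }
      apply (f_equal Re) in E2. rewrite re_scal_l in E2.
      apply (Rmult_eq_reg_l (a s)); [|lra]. rewrite E2.
      replace (a s * (- (-2 * rho * Re z + 2 * rho ^ 2 * s * Cmod z ^ 2) / (2 * a s)))
        with (rho * (Re z - rho * s * Cmod z ^ 2)) by (field; lra).
      rewrite Cmod2_alt. unfold Re, Im; simpl. ring. }
    assert (Hln := ln_second_order (a s) (a (s + h)) ltac:(lra) ltac:(lra)).
    unfold g. rewrite <- RtoC_minus, Cmod_R.
    replace (2 * Re (lam ((s + h)%R * z)%C) + ln (a (s + h)) - (2 * Re (lam (s * z)) + ln (a s)))
      with (2 * Re E + (ln (a (s + h)) - ln (a s) - (a (s + h) - a s) / a s)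
            + h ^ 2 * (rho ^ 2 * Cmod z ^ 2 / a s)).
    2:{ assert (HR : Re E = Re (lam ((s + h)%R * z)%C) - Re (lam (s * z)%C) - h * Re (z * L1)%C).
        { unfold E. rewrite <- Cmult_assoc, <- re_scal_l. unfold Re; simpl. ring. }
        assert (HA : a (s + h) - a s = h * (- 2 * rho * Re z + 2 * rho ^ 2 * s * Cmod z ^ 2)
                     + h ^ 2 * (rho ^ 2 * Cmod z ^ 2)) by (rewrite !Ha; ring).
        rewrite HR, HL, HA. field. lra. }
    assert (Hinv : 0 < / a s <= / (1 - rho) ^ 2)
      by (split; [apply Rinv_0_lt_compat; lra|apply Rinv_le_contravar; lra]).
    assert (Hinv' : 0 < / a (s + h) <= / (1 - rho) ^ 2)
      by (split; [apply Rinv_0_lt_compat; lra|apply Rinv_le_contravar; lra]).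
    pose proof (pow2_ge_0 h) as Hh2.
    assert (T3 : 0 <= rho ^ 2 * Cmod z ^ 2 / a s <= / (1 - rho) ^ 2).
    { assert (0 <= rho ^ 2 * Cmod z ^ 2 <= 1).
      { split; [apply Rmult_le_pos; apply pow2_ge_0|]. rewrite <- Rpow_mult_distr.
        rewrite <- (pow1 2). apply pow_incr; nra. }
      unfold Rdiv. split; [apply Rmult_le_pos; lra|].
      rewrite <- (Rmult_1_l (/ (1 - rho) ^ 2)). apply Rmult_le_compat; lra. }
    assert (T2 : (a (s + h) - a s) ^ 2 / (a s * a (s + h))
                 <= h ^ 2 * (16 * / (1 - rho) ^ 2 * / (1 - rho) ^ 2)).
    { unfold Rdiv. rewrite Rinv_mult.
      replace (h ^ 2 * (16 * / (1 - rho) ^ 2 * / (1 - rho) ^ 2))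
        with ((16 * h ^ 2) * (/ (1 - rho) ^ 2 * / (1 - rho) ^ 2)) by ring.
      apply Rmult_le_compat; [apply pow2_ge_0|apply Rmult_le_pos; lra| |
        apply Rmult_le_compat; lra].
      replace (a (s + h) - a s) with (h * (- 2 * rho * Re z + rho ^ 2 * Cmod z ^ 2 * (2 * s + h)))
        by (rewrite !Ha; ring).
      rewrite Rpow_mult_distr, Rmult_comm. apply Rmult_le_compat_r; auto.
      replace 16 with (4 ^ 2) by ring. rewrite <- (pow2_abs (_ + _)). apply pow_incr.
      split; [apply Rabs_pos|]. pose proof (re_le_Cmod z) as HR.
      assert (0 <= rho ^ 2 * Cmod z ^ 2 <= 1).
      { split; [apply Rmult_le_pos; apply pow2_ge_0|]. rewrite <- Rpow_mult_distr.
        rewrite <- (pow1 2). apply pow_incr; nra. }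
      apply Rabs_le_between in HR. apply Rabs_le. assert (-1 <= rho * Re z <= 1) by nra.
      set (p := rho ^ 2 * Cmod z ^ 2) in *. assert (0 <= p * (2 * s + h) <= 2) by nra. nra. }
    eapply Rle_trans; [apply Rabs_triang|]. rewrite (Rabs_pos_eq (h ^ 2 * _)) by nra.
    eapply Rle_trans; [apply Rplus_le_compat_r, Rabs_triang|].
    rewrite Rabs_mult, (Rabs_pos_eq 2) by lra. nra. }
  apply (f_equal Re) in Hg. unfold g in Hg.
  change (2 * Re (lam (1 * z)%C) + ln (a 1) = 2 * Re (lam (0 * z)%C) + ln (a 0)) in Hg.
  assert (E0 : lam (0 * z)%C = 0%C).
  { unfold lam. rewrite (csum_ext _ (fun n => 0 * lcoef n)%C).
    - rewrite (csum_scal 0 lcoef _ (fun n => Rle_refl _) ex_lcoef). ring.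
    - intros [|n]; simpl; ring. }
  rewrite E0, !Ha in Hg. replace (1 * z)%C with z in Hg by ring.
  replace (1 - 2 * rho * 0 * Re z + rho ^ 2 * 0 ^ 2 * Cmod z ^ 2) with 1 in Hg by ring.
  rewrite ln_1 in Hg. simpl (Re 0) in Hg.
  replace (Cmod (1 - rho * z)%C ^ 2) with (a 1); [rewrite Ha; unfold Re in *; simpl in *; lra|].
  unfold a. do 3 f_equal. ring.
Qed.
End Log.

(** * A holomorphic logarithm of the divided difference *)

Section LogQ.
Variables (phi : C -> C) (D : C -> C -> C) (D1 : C -> C -> C).
Hypothesis Hphi : dclass phi D.
Hypothesis HD : UH cdisk 0 (fun w z => D z w) D1.
Hypothesis Hn : forall z w, cdisk z -> cdisk w -> D z w <> 0%C.

(** The logarithm of the ratio u is -[lam] at parameter 1 / 2 and argument 2 (1 - u), since 1 - (1 /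
    2) 2 (1 - u) = u; |u - 1| <= 1 / 2 puts this argument in the closed disk. Symmetry, real part
    and logarithmic derivative are carried along. *)
Lemma log_step (t t' : R) (L L1 : C -> C -> C) (c : R) :
  0 <= t <= 1 -> 0 <= t' <= 1 -> 0 < c ->
  (forall z w, cdisk z -> cdisk w -> c <= Cmod (D z w)) ->
  (forall z w, cdisk z -> cdisk w ->
     Cmod (D (t' * z) (t' * w) * / D (t * z) (t * w) - 1)%C <= 1 / 2) ->
  UH cdisk 0 (fun w z => L z w) L1 ->
  (forall z w, cdisk z -> cdisk w -> L z w = L w z /\
     2 * Re (L z w) = ln (Cmod (D (t * z) (t * w))%C ^ 2) /\
     (L1 w z * D (t * z) (t * w))%C = (t * D1 (t * w) (t * z))%C) ->
  exists L L1, UH cdisk 0 (fun w z => L z w) L1 /\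
  (forall z w, cdisk z -> cdisk w -> L z w = L w z /\
     2 * Re (L z w) = ln (Cmod (D (t' * z) (t' * w))%C ^ 2) /\
     (L1 w z * D (t' * z) (t' * w))%C = (t' * D1 (t' * w) (t' * z))%C).
Proof.
  intros Ht Ht' Hc Hlow Hq HL Hprop.
  assert (A : forall s : R, 0 <= s <= 1 -> UH cdisk 0 (fun w z => D (s * z) (s * w))%C
               (fun w z => D1 (s * w) (s * z) * s)%C).
  { intros s Hs.
    pose proof (UH_reindex cdisk cdisk 0 (fun w => s * w)%C _ _
                  (fun w => cdisk_scal s w Hs) HD) as B.
    pose proof (UH_comp 0 _ _ _ _ (UH_scal (P := cdisk) (r := 0) (RtoC s) _ _ UH_id) B
                  (fun _ z _ => cdisk_scal s z Hs)) as B'.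
    eapply UH_ext; [| |exact B']; intros; cbv beta; ring. }
  assert (Hcs : forall s z w, 0 <= s <= 1 -> cdisk z -> cdisk w -> D (s * z)%C (s * w)%C <> 0%C)
    by (intros; apply Hn; apply cdisk_scal; auto).
  pose proof (UH_inv _ _ c Hc (fun w z Hw Hz =>
    Hlow _ _ (cdisk_scal t z Ht Hz) (cdisk_scal t w Ht Hw)) (A t Ht)) as Bi.
  pose proof (UH_mult _ _ _ _ (A t' Ht') Bi) as U.
  set (u := fun w z => (D (t' * z) (t' * w) * / D (t * z) (t * w))%C) in U.
  set (u1 := fun w z => (D1 (t' * w) (t' * z) * t' * / D (t * z) (t * w)
    + D (t' * z) (t' * w) *
      - (D1 (t * w) (t * z) * t / (D (t * z) (t * w) * D (t * z) (t * w))))%C).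
  change (UH cdisk 0 u u1) in U.
  assert (Y : UH cdisk 0 (fun w z => 2 * (1 - u w z))%C (fun w z => 2 * (0 - u1 w z))%C).
  { apply UH_scal, UH_minus; [apply (UH_const (fun _ => RtoC 1) 1)|exact U].
    intros; rewrite Cmod_1; lra. }
  assert (Hy : forall w z, cdisk w -> cdisk z -> cdisk (2 * (1 - u w z))%C).
  { intros w z Hw Hz. apply cdisk_intro. rewrite Cmod_mult, Cmod_R, Rabs_pos_eq by lra.
    rewrite Cmod_sub_sym. unfold u. specialize (Hq z w Hz Hw). lra. }
  assert (Hh : 0 <= 1 / 2 < 1) by lra.
  pose proof (UH_comp 0 _ _ _ _ Y (dclass_UH cdisk _ _ (lam_dclass (1 / 2) Hh)) Hy) as G.
  cbv beta in G.
  exists (fun z w => L z w + (-1) * lam (1 / 2) (2 * (1 - u w z)))%C. eexists; split.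
  - exact (UH_plus _ _ _ _ HL (UH_scal (-1) _ _ G)).
  - intros z w Hz Hw. destruct (Hprop z w Hz Hw) as (P1 & P2 & P3).
    assert (S : forall s, 0 <= s <= 1 -> D (s * z)%C (s * w)%C = D (s * w)%C (s * z)%C)
      by (intros s Hs; apply (dclass_sym phi); auto; apply cdisk_scal; auto).
    pose proof (Hcs t z w Ht Hz Hw) as N1. pose proof (Hcs t' z w Ht' Hz Hw) as N2.
    split; [|split].
    + rewrite P1. unfold u. now rewrite (S t Ht), (S t' Ht').
    + pose proof (lam_Re (1 / 2) Hh _ (Hy w z Hw Hz)) as E.
      replace (1 - (1 / 2)%R * (2 * (1 - u w z)))%C with (u w z) in E
        by (rewrite RtoC_div by lra; field).
      replace (Re (L z w + -1 * lam (1 / 2) (2 * (1 - u w z)))%C)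
        with (Re (L z w) - Re (lam (1 / 2) (2 * (1 - u w z)))%C)
        by (unfold Re; simpl; ring).
      rewrite Rmult_minus_distr_l, P2, E. unfold u.
      rewrite Cmod_mult, Cmod_inv, Rpow_mult_distr, pow_inv by auto.
      assert (H1 : 0 < Cmod (D (t * z) (t * w))%C ^ 2) by (apply pow_lt, Cmod_gt_0; auto).
      assert (H2 : 0 < Cmod (D (t' * z) (t' * w))%C ^ 2) by (apply pow_lt, Cmod_gt_0; auto).
      rewrite ln_mult, ln_Rinv by (auto; apply Rinv_0_lt_compat; auto). lra.
    + pose proof (lam_deriv (1 / 2) Hh _ (Hy w z Hw Hz)) as E.
      replace (1 - (1 / 2)%R * (2 * (1 - u w z)))%C with (u w z) in E
        by (rewrite RtoC_div by lra; field).
      set (l1 := lamD (1 / 2) (2 * (1 - u w z)) (2 * (1 - u w z))) in *.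
      assert (Hu : u w z <> 0%C).
      { unfold u. intros E0. apply N2.
        replace (D (t' * z)%C (t' * w)%C) with
          (D (t' * z) (t' * w) * / D (t * z) (t * w) * D (t * z) (t * w))%C by (field; auto).
        rewrite E0; ring. }
      assert (El : l1 = (/ 2 * / u w z)%C).
      { replace l1 with (l1 * u w z * / u w z)%C by (field; auto). rewrite E.
        rewrite RtoC_div by lra. field; auto. }
      assert (EL : L1 w z = (t * D1 (t * w) (t * z) * / D (t * z) (t * w))%C)
        by (rewrite <- P3; field; auto).
      rewrite El, EL. unfold u1, u. field. auto.
Qed.

(** Continuation along (t z, t w) from t = 0 to 1. Both variables move, so a step changes D by at
    most 2 M / [S N] <= c / 2, and the ratios stay within reach of [log_step]. *)
Lemma log_exists : exists L L1, UH cdisk 0 (fun w z => L z w) L1 /\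
  (forall z w, cdisk z -> cdisk w -> L z w = L w z /\
     2 * Re (L z w) = ln (Cmod (D z w) ^ 2) /\
     (L1 w z * D z w)%C = D1 w z).
Proof.
  destruct (bidisk_lower _ _ Hphi Hn) as (c & Hc & Hlow).
  destruct (UH_bounds _ _ _ _ HD) as (M & HM & _ & HL).
  assert (HL2 : forall z w w', cdisk z -> cdisk w -> cdisk w' ->
            Cmod (D z w' - D z w)%C <= M * Cmod (w' - w)%C).
  { intros z w w' Hz Hw Hw'.
    rewrite (dclass_sym phi D z w'), (dclass_sym phi D z w) by auto.
    apply (HL z w w'); auto. }
  destruct (small_inv_INR (2 * M) (c / 2) ltac:(lra)) as [N HN].
  specialize (HN N (Nat.le_refl _)). pose proof (INR_S_pos N) as HNp.
  assert (Hinv : 0 < / INR (S N)) by (apply Rinv_0_lt_compat; auto).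
  pose proof (grid_point N) as Ht.
  assert (Hk : forall k, (k <= S N)%nat -> exists L L1, UH cdisk 0 (fun w z => L z w) L1 /\
    (forall z w, cdisk z -> cdisk w -> L z w = L w z /\
     2 * Re (L z w) = ln (Cmod (D ((INR k * / INR (S N))%R * z) ((INR k * / INR (S N))%R * w))%C ^ 2) /\
     (L1 w z * D ((INR k * / INR (S N))%R * z) ((INR k * / INR (S N))%R * w))%C
       = ((INR k * / INR (S N))%R * D1 ((INR k * / INR (S N))%R * w) ((INR k * / INR (S N))%R * z))%C)).
  { induction k as [|k IH]; intros Hk.
    - simpl INR. rewrite Rmult_0_l.
      (* A real constant with the right real part starts the continuation: its imaginary part is
         free, as only Re L and the derivative of L are prescribed. *)
      exists (fun _ _ => RtoC (ln (Cmod (D 0 0)%C ^ 2) / 2)), (fun _ _ => 0%C).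
      split; [apply (UH_const (fun _ => RtoC (ln (Cmod (D 0 0)%C ^ 2) / 2))
                       (Rabs (ln (Cmod (D 0 0)%C ^ 2) / 2))); intros; rewrite Cmod_R; lra|].
      intros z w Hz Hw. rewrite !Cmult_0_l. split; [auto|split; [|ring]].
      change (2 * (ln (Cmod (D 0 0)%C ^ 2) / 2) = ln (Cmod (D 0 0)%C ^ 2)). field.
    - destruct IH as (L & L1 & H1 & H2); [lia|].
      set (t := INR k * / INR (S N)) in *. set (t' := INR (S k) * / INR (S N)).
      assert (T : 0 <= t <= 1) by (apply Ht; lia).
      assert (T' : 0 <= t' <= 1) by (apply Ht; lia).
      apply (log_step t t' L L1 c T T' Hc Hlow); auto.
      intros z w Hz Hw.
      assert (Hd : forall z, cdisk z -> Cmod (t' * z - t * z)%C <= / INR (S N)).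
      { intros x Hx. replace (t' * x - t * x)%C with (RtoC (/ INR (S N)) * x)%C.
        - rewrite Cmod_mult, Cmod_R, Rabs_pos_eq by lra.
          rewrite <- (Rmult_1_r (/ INR (S N))) at 2. apply Rmult_le_compat_l; [lra|apply Hx].
        - unfold t', t. rewrite (S_INR k), Rmult_plus_distr_r, Rmult_1_l, RtoC_plus. ring. }
      assert (C1 := fun x => cdisk_scal t x T). assert (C2 := fun x => cdisk_scal t' x T').
      replace (D (t' * z) (t' * w) * / D (t * z) (t * w) - 1)%C
        with (((D (t' * z) (t' * w) - D (t * z) (t' * w)) + (D (t * z) (t' * w) - D (t * z) (t * w)))
              * / D (t * z) (t * w))%C.
      2:{ assert (N1 : D (t * z)%C (t * w)%C <> 0%C) by auto. revert N1.
          generalize (D (t * z)%C (t * w)%C), (D (t' * z)%C (t' * w)%C), (D (t * z)%C (t' * w)%C).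
          intros x y v N1. field; auto. }
      eapply Rle_trans; [apply (Cmod_mul_le _ _ (M * / INR (S N) + M * / INR (S N)) (/ c))|].
      + apply Cmod_add_le.
        * eapply Rle_trans; [apply (HL (t' * w)%C (t * z)%C (t' * z)%C); auto|].
          apply Rmult_le_compat_l; auto.
        * eapply Rle_trans; [apply HL2; auto|]. apply Rmult_le_compat_l; auto.
      + apply Cmod_inv_le; auto.
      + apply Rle_trans with (c / 2 * / c).
        * apply Rmult_le_compat_r; [left; apply Rinv_0_lt_compat; auto|].
          unfold Rdiv in HN. lra.
        * apply Req_le; field; lra. }
  destruct (Hk (S N) (Nat.le_refl _)) as (L & L1 & H1 & H2).
  exists L, L1; split; auto. intros z w Hz Hw. specialize (H2 z w Hz Hw).
  rewrite Rinv_r, !Cmult_1_l in H2 by lra. exact H2.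
Qed.
End LogQ.

(** * Logarithmic energy *)

Definition mean2 (n : nat) (f : C -> C -> R) : R := mean n (fun z => mean n (fun w => f z w)).

Section Mean2.
Variable n : nat.

Lemma mean2_ext (f g : C -> C -> R) :
  (forall z w, Cmod z = 1 -> Cmod w = 1 -> f z w = g z w) -> mean2 n f = mean2 n g.
Proof. intros H; apply mean_ext; intros z Hz; apply mean_ext; auto. Qed.

Lemma mean2_plus (f g : C -> C -> R) :
  mean2 n (fun z w => f z w + g z w) = mean2 n f + mean2 n g.
Proof. unfold mean2. rewrite <- mean_plus. apply mean_ext; intros; apply mean_plus. Qed.

Lemma mean2_scal (c : R) (f : C -> C -> R) : mean2 n (fun z w => c * f z w) = c * mean2 n f.
Proof. unfold mean2. rewrite <- mean_scal. apply mean_ext; intros; apply mean_scal. Qed.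

Lemma mean2_minus (f g : C -> C -> R) :
  mean2 n (fun z w => f z w - g z w) = mean2 n f - mean2 n g.
Proof. unfold mean2. rewrite <- mean_minus. apply mean_ext; intros; apply mean_minus. Qed.

Lemma mean2_le (f g : C -> C -> R) :
  (forall z w, Cmod z = 1 -> Cmod w = 1 -> f z w <= g z w) -> mean2 n f <= mean2 n g.
Proof. intros H; apply mean_le; intros z Hz; apply mean_le; auto. Qed.

Lemma mean2_prod (f g : C -> R) : mean2 n (fun z w => f z * g w) = mean n f * mean n g.
Proof.
  unfold mean2. rewrite Rmult_comm, <- mean_scal. apply mean_ext; intros.
  rewrite mean_scal; ring.
Qed.

Lemma mean2_sum (f : nat -> C -> C -> R) (N : nat) :
  mean2 n (fun z w => sum_f_R0 (fun k => f k z w) N) = sum_f_R0 (fun k => mean2 n (f k)) N.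
Proof.
  induction N as [|N IH]; simpl; [reflexivity|]. now rewrite mean2_plus, IH.
Qed.

Lemma mean_lim (f : nat -> C -> R) (g : C -> R) :
  (forall z, Cmod z = 1 -> is_lim_seq (fun m => f m z) (g z)) ->
  is_lim_seq (fun m => mean n (f m)) (mean n g).
Proof.
  intros H. unfold mean, Rdiv.
  apply (is_lim_seq_scal_r _ (/ INR (S n)) (Finite _)).
  assert (Hk : forall k, is_lim_seq (fun m => sum_f_R0 (fun j => f m (root n ^ j)%C) k)
                           (sum_f_R0 (fun j => g (root n ^ j)%C) k)).
  { induction k as [|k IH]; simpl.
    - apply H. rewrite Cmod_1; auto.
    - apply (is_lim_seq_plus' _ _ _ _ IH). apply H.
      apply (Cmod_root n (S k)). }
  apply Hk.
Qed.

Lemma mean2_lim (f : nat -> C -> C -> R) (g : C -> C -> R) :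
  (forall z w, Cmod z = 1 -> Cmod w = 1 -> is_lim_seq (fun m => f m z w) (g z w)) ->
  is_lim_seq (fun m => mean2 n (f m)) (mean2 n g).
Proof. intros H. apply mean_lim; intros z Hz. apply mean_lim; auto. Qed.

(** Schur's product theorem: one factor of the power is expanded and each [psi i] is absorbed into
    the weight, which is why the induction quantifies over [X]. *)
Lemma gram_pow_pos (psi : nat -> C -> R) (N k : nat) (X : C -> R) :
  0 <= mean2 n (fun z w => X z * X w * sum_f_R0 (fun i => psi i z * psi i w) N ^ k).
Proof.
  revert X; induction k as [|k IH]; intros X.
  - rewrite (mean2_ext _ (fun z w => X z * X w)) by (intros; simpl; ring).
    rewrite mean2_prod. apply Rle_0_sqr.
  - rewrite (mean2_ext _ (fun z w => sum_f_R0 (fun i => (X z * psi i z) * (X w * psi i w)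
               * sum_f_R0 (fun i => psi i z * psi i w) N ^ k) N)).
    + rewrite mean2_sum. apply cond_pos_sum. intros i. apply (IH (fun z => X z * psi i z)).
    + intros z w _ _. simpl pow.
      set (q := sum_f_R0 (fun i => psi i z * psi i w) N ^ k).
      transitivity ((X z * X w * q) * sum_f_R0 (fun i => psi i z * psi i w) N); [ring|].
      rewrite scal_sum. apply sum_eq; intros; ring.
Qed.

(* After stereographic projection, the argument of the logarithm is, up to factors depending
   on one point only, 1 - y / (1 + tau) with y a Gram kernel, and -ln (1 - x) has
   nonnegative Taylor coefficients. *)
Lemma log_energy (X : C -> R) (p : C -> C) (tau : R) : 0 < tau -> mean n X = 0 ->
  mean2 n (fun z w => X z * X w *
    ln (Cmod (p z - p w)%C ^ 2 + tau * ((1 + Cmod (p z) ^ 2) * (1 + Cmod (p w) ^ 2)))) <= 0.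
Proof.
  intros Htau HX.
  set (A := fun z => 1 + Cmod (p z) ^ 2).
  assert (HA : forall z, 1 <= A z) by (intros z; unfold A; pose proof (pow2_ge_0 (Cmod (p z))); lra).
  (* The vectors (1, |p|^2, sqrt 2 Re p, sqrt 2 Im p) / (1 + |p|^2) have Gram kernel y = |1 + p conj
     p'|^2 / (A A'), and |p - p'|^2 + |1 + p conj p'|^2 = A A', so 1 - y is the squared chordal
     distance up to a constant factor. *)
  set (psi := fun i z => match i with
      | 0%nat => / A z | 1%nat => Cmod (p z) ^ 2 / A z
      | 2%nat => sqrt 2 * Re (p z) / A z | _ => sqrt 2 * Im (p z) / A z end).
  set (y := fun z w => sum_f_R0 (fun i => psi i z * psi i w) 3).
  assert (Hs2 : sqrt 2 * sqrt 2 = 2) by (apply sqrt_sqrt; lra).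
  assert (Hy : forall z w, A z * A w * y z w =
     1 + Cmod (p z) ^ 2 * Cmod (p w) ^ 2 + 2 * (Re (p z) * Re (p w) + Im (p z) * Im (p w))).
  { intros z w. pose proof (HA z); pose proof (HA w). unfold y, psi; simpl sum_f_R0.
    transitivity (1 + Cmod (p z) ^ 2 * Cmod (p w) ^ 2
      + (sqrt 2 * sqrt 2) * (Re (p z) * Re (p w) + Im (p z) * Im (p w)));
      [field; lra|now rewrite Hs2]. }
  assert (Hd : forall z w, Cmod (p z - p w)%C ^ 2 = A z * A w * (1 - y z w)).
  { intros z w. rewrite Rmult_minus_distr_l, Hy. unfold A. rewrite !Cmod2_alt.
    unfold Re, Im; simpl. ring. }
  assert (Hy01 : forall z w, 0 <= y z w <= 1).
  { intros z w. pose proof (HA z); pose proof (HA w).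
    assert (HAA : 0 < A z * A w) by (apply Rmult_lt_0_compat; lra).
    split; apply (Rmult_le_reg_l (A z * A w)); auto.
    - rewrite Rmult_0_r, Hy, !Cmod2_alt.
      replace (1 + _ + _) with ((1 + Re (p z) * Re (p w) + Im (p z) * Im (p w)) ^ 2
         + (Re (p z) * Im (p w) - Im (p z) * Re (p w)) ^ 2) by ring.
      pose proof (pow2_ge_0 (1 + Re (p z) * Re (p w) + Im (p z) * Im (p w))).
      pose proof (pow2_ge_0 (Re (p z) * Im (p w) - Im (p z) * Re (p w))). lra.
    - pose proof (Hd z w). pose proof (pow2_ge_0 (Cmod (p z - p w)%C)). lra. }
  (* The quotient y / (1 + tau) is rho (rho y): one factor is the parameter of [lam], the other
     keeps its argument in the closed disk. *)
  set (rho := / sqrt (1 + tau)).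
  assert (Hsq : 1 < sqrt (1 + tau)) by (rewrite <- sqrt_1 at 1; apply sqrt_lt_1; lra).
  assert (Hrho : 0 < rho < 1).
  { unfold rho; split; [apply Rinv_0_lt_compat; lra|].
    rewrite <- Rinv_1 at 2. apply Rinv_lt_contravar; rewrite ?Rmult_1_l; lra. }
  assert (Hrho2 : rho * rho = / (1 + tau))
    by (unfold rho; rewrite <- Rinv_mult, sqrt_sqrt; [auto|lra]).
  assert (Hr' : 0 <= rho < 1) by lra.
  assert (Hdisk : forall z w, cdisk (RtoC (rho * y z w))).
  { intros z w. apply cdisk_intro. destruct (Hy01 z w).
    rewrite Cmod_R, Rabs_pos_eq by (apply Rmult_le_pos; lra). nra. }
  assert (Hln : forall z w,
     ln (Cmod (p z - p w)%C ^ 2 + tau * (A z * A w))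
     = ln (A z) + ln (A w) + ln (1 + tau) - Re (lam rho (RtoC (rho * y z w)))).
  { intros z w. pose proof (HA z); pose proof (HA w). destruct (Hy01 z w).
    assert (0 <= rho * y z w) by (apply Rmult_le_pos; lra).
    assert (rho * y z w <= 1) by nra.
    assert (Hone : rho * (rho * y z w) < 1) by nra.
    pose proof (lam_Re rho Hr' _ (Hdisk z w)) as E.
    rewrite <- RtoC_mult, <- RtoC_minus, Cmod_R in E.
    rewrite Rabs_pos_eq in E by lra.
    simpl pow in E. rewrite Rmult_1_r, ln_mult in E by lra.
    replace (Cmod (p z - p w)%C ^ 2 + tau * (A z * A w))
      with (A z * (A w * ((1 + tau) * (1 - rho * (rho * y z w))))).
    - rewrite !ln_mult by (try lra; repeat apply Rmult_lt_0_compat; lra). lra.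
    - rewrite Hd, <- (Rmult_assoc rho), Hrho2. field. lra. }
  (* The one-point terms ln A and the constant ln (1 + tau) each multiply a mean of X, which is 0;
     only the positive definite series survives. *)
  rewrite (mean2_ext _ (fun z w => (X z * ln (A z)) * X w + X z * (X w * (ln (A w) + ln (1 + tau)))
             - X z * X w * Re (lam rho (RtoC (rho * y z w))))).
  2:{ intros z w _ _. fold (A z) (A w). rewrite Hln. ring. }
  rewrite mean2_minus, mean2_plus, (mean2_prod (fun z => X z * ln (A z)) X),
    (mean2_prod X (fun w => X w * (ln (A w) + ln (1 + tau)))), HX.
  enough (0 <= mean2 n (fun z w => X z * X w * Re (lam rho (RtoC (rho * y z w))))) by lra.
  assert (Hlim : is_lim_seq
    (fun m => mean2 n (fun z w => X z * X w *
       sum_f_R0 (fun k => Re (lcoef rho k) * rho ^ k * y z w ^ k) m))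
    (mean2 n (fun z w => X z * X w * Re (lam rho (RtoC (rho * y z w)))))).
  { apply mean2_lim. intros z w _ _.
    apply (is_lim_seq_scal_l _ (X z * X w) (Finite _)).
    assert (Hex : ex_series (fun k => Re (lcoef rho k * RtoC (rho * y z w) ^ k)%C)).
    { apply (dominated_Re _ (fun k => Cmod (lcoef rho k))); [|apply ex_lcoef; auto].
      intros k. rewrite <- (Rmult_1_r (Cmod (lcoef rho k))).
      apply Cmod_mul_le; [lra|apply Cmod_pow_le1, Hdisk]. }
    pose proof (Series_correct _ Hex) as Hs. unfold is_series in Hs.
    eapply is_lim_seq_ext; [|exact Hs]. intros m. rewrite sum_n_Reals.
    apply sum_eq; intros k _.
    rewrite <- RtoC_pow, Rpow_mult_distr, re_scal_r. ring. }
  assert (Hpos : forall m, 0 <= mean2 n (fun z w => X z * X w *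
       sum_f_R0 (fun k => Re (lcoef rho k) * rho ^ k * y z w ^ k) m)).
  { intros m. rewrite (mean2_ext _ (fun z w => sum_f_R0 (fun k =>
      (Re (lcoef rho k) * rho ^ k) * (X z * X w * y z w ^ k)) m)).
    - rewrite mean2_sum. apply cond_pos_sum. intros k. rewrite mean2_scal.
      apply Rmult_le_pos; [apply Rmult_le_pos|apply (gram_pow_pos psi 3 k X)].
      + destruct k as [|k]; [simpl; lra|].
        change (0 <= rho ^ S k / INR (S k)). apply Rle_div_r; [apply INR_S_pos|].
        rewrite Rmult_0_l; apply pow_le; lra.
      + apply pow_le; lra.
    - intros z w _ _. rewrite scal_sum. apply sum_eq; intros; ring. }
  exact (is_lim_seq_le (fun _ => 0) _ (Finite 0) (Finite _) Hpos (is_lim_seq_const 0) Hlim).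
Qed.
End Mean2.

(** * Uniform smallness and odd trigonometric weights *)

Definition small {I : Type} (P : I -> Prop) (u : nat -> I -> C) : Prop :=
  forall eps, 0 < eps -> exists N, forall n, (N <= n)%nat -> forall i, P i -> Cmod (u n i) <= eps.

Section Small.
Context {I : Type} {P : I -> Prop}.

Lemma small_ext (N : nat) (u v : nat -> I -> C) :
  (forall n i, (N <= n)%nat -> P i -> u n i = v n i) -> small P u -> small P v.
Proof.
  intros H Hu eps He. destruct (Hu eps He) as [M HM]. exists (N + M)%nat.
  intros n Hn i Hi. rewrite <- H by (auto; lia). apply HM; auto; lia.
Qed.

Lemma small_plus (u v : nat -> I -> C) :
  small P u -> small P v -> small P (fun n i => u n i + v n i)%C.
Proof.
  intros Hu Hv eps He. destruct (Hu (eps / 2) ltac:(lra)) as [M HM].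
  destruct (Hv (eps / 2) ltac:(lra)) as [N HN]. exists (M + N)%nat. intros n Hn i Hi.
  replace eps with (eps / 2 + eps / 2) by field.
  apply Cmod_add_le; [apply HM|apply HN]; auto; lia.
Qed.

Lemma small_mult (b : nat -> I -> C) (B : R) (u : nat -> I -> C) :
  (forall n i, P i -> Cmod (b n i) <= B) -> small P u -> small P (fun n i => b n i * u n i)%C.
Proof.
  intros HB Hu eps He. assert (Hd : 0 < Rabs B + 1) by (pose proof (Rabs_pos B); lra).
  destruct (Hu (eps / (Rabs B + 1))) as [N HN]; [apply Rdiv_lt_0_compat; auto|].
  exists N; intros n Hn i Hi.
  eapply Rle_trans; [apply (Cmod_mul_le _ _ (Rabs B + 1) (eps / (Rabs B + 1)))|].
  - specialize (HB n i Hi). pose proof (Rle_abs B). lra.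
  - auto.
  - apply Req_le; field; lra.
Qed.

Lemma small_scal (c : C) (u : nat -> I -> C) : small P u -> small P (fun n i => c * u n i)%C.
Proof. apply (small_mult (fun _ _ => c) (Cmod c)); intros; lra. Qed.

End Small.

Notation csmall u := (small (fun _ : unit => True) (fun n _ => u n)).
Notation circle := (fun z : C => Cmod z = 1).

Lemma circle_cdisk (z : C) : Cmod z = 1 -> cdisk z.
Proof. intros H; apply cdisk_intro; lra. Qed.

Lemma small_cmean (b : C -> C) (B : R) (u : nat -> C -> C) :
  (forall w, Cmod w = 1 -> Cmod (b w) <= B) -> small circle u ->
  csmall (fun n => cmean n (fun w => b w * u n w)%C).
Proof.
  intros HB Hu.
  pose proof (small_mult (fun _ w => b w) B u (fun _ w Hw => HB w Hw) Hu) as H.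
  intros eps He. destruct (H eps He) as [N HN]. exists N; intros n Hn _ _.
  apply cmean_le; intros w Hw. now apply HN.
Qed.

(** Test polynomials for an odd function: only these frequencies meet w1, w3, w5, w7. The exponent 1
    is kept explicit so that all four terms have one shape. *)
Definition odd_poly (y1 y3 y5 y7 z : C) : C := (y1 * z ^ 1 + y3 * z ^ 3 + y5 * z ^ 5 + y7 * z ^ 7)%C.

Section Poly.
Variables y1 y3 y5 y7 : C.
Let pc := odd_poly y1 y3 y5 y7.

Lemma odd_poly_bound (z : C) : cdisk z ->
  Cmod (pc z) <= (Cmod y1 + Cmod y3 + Cmod y5 + Cmod y7) * Cmod z.
Proof.
  intros [H0 H1].
  assert (H : forall y k, Cmod (y * z ^ S k)%C <= Cmod y * Cmod z).
  { intros y k. rewrite Cpow_S. apply Cmod_mul_le; [lra|].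
    rewrite <- (Rmult_1_r (Cmod z)). apply Cmod_mul_le; [lra|now apply Cmod_pow_le1]. }
  unfold pc, odd_poly. rewrite !Rmult_plus_distr_r.
  repeat apply Cmod_add_le; apply H.
Qed.

Lemma odd_poly_bound1 (z : C) : Cmod z = 1 -> Cmod (pc z) <= Cmod y1 + Cmod y3 + Cmod y5 + Cmod y7.
Proof. intros Hz. pose proof (odd_poly_bound z (circle_cdisk z Hz)). rewrite Hz in H; lra. Qed.

Lemma odd_poly_UH {I : Type} (P : I -> Prop) : exists K1, UH P 0 (fun _ z => pc z) K1.
Proof.
  assert (H : forall k y, exists K1, UH P 0 (fun (_ : I) z => y * z ^ k)%C K1).
  { intros k y. destruct (@UH_pow I P 0 _ _ k UH_id) as [K1 H]. eexists.
    exact (UH_scal y _ _ H). }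
  destruct (H 1%nat y1) as [A1 H1]. destruct (H 3%nat y3) as [A3 H3].
  destruct (H 5%nat y5) as [A5 H5]. destruct (H 7%nat y7) as [A7 H7].
  eexists. exact (UH_plus _ _ _ _ (UH_plus _ _ _ _ (UH_plus _ _ _ _ H1 H3) H5) H7).
Qed.

Lemma odd_poly_conj (z : C) : Cconj (pc z) = (Cconj y1 * Cconj z ^ 1 + Cconj y3 * Cconj z ^ 3
  + Cconj y5 * Cconj z ^ 5 + Cconj y7 * Cconj z ^ 7)%C.
Proof. unfold pc, odd_poly. now rewrite !Cplus_conj, !Cmult_conj, !Cpow_conj. Qed.

Lemma cmean_odd_poly_conj (n : nat) (K : C -> C) : cmean n (fun z => Cconj (pc z) * K z)%C =
  (Cconj y1 * cmean n (fun z => Cconj z ^ 1 * K z) + Cconj y3 * cmean n (fun z => Cconj z ^ 3 * K z)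
   + Cconj y5 * cmean n (fun z => Cconj z ^ 5 * K z)
   + Cconj y7 * cmean n (fun z => Cconj z ^ 7 * K z))%C.
Proof.
  rewrite <- !cmean_scal, <- !cmean_plus. apply cmean_ext; intros z _. rewrite odd_poly_conj; ring.
Qed.

Lemma cmean_odd_poly (n : nat) (K : C -> C) : cmean n (fun z => pc z * K z)%C =
  (y1 * cmean n (fun z => z ^ 1 * K z) + y3 * cmean n (fun z => z ^ 3 * K z)
   + y5 * cmean n (fun z => z ^ 5 * K z) + y7 * cmean n (fun z => z ^ 7 * K z))%C.
Proof.
  rewrite <- !cmean_scal, <- !cmean_plus. apply cmean_ext; intros z _. unfold pc, odd_poly; ring.
Qed.

(** Positivity of the energy requires real weights; this one is the polynomial plus its
    conjugate. *)
Definition odd_weight (z : C) : R := 2 * Re (odd_poly y1 y3 y5 y7 z).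

Lemma odd_weight_C (z : C) : RtoC (odd_weight z) = (pc z + Cconj (pc z))%C.
Proof.
  unfold odd_weight. fold pc. rewrite RtoC_mult, re_alt. field.
Qed.

Lemma odd_weight_bound (z : C) : Cmod z = 1 ->
  Rabs (odd_weight z) <= 2 * (Cmod y1 + Cmod y3 + Cmod y5 + Cmod y7).
Proof.
  intros Hz. unfold odd_weight. rewrite Rabs_mult, Rabs_pos_eq by lra.
  apply Rmult_le_compat_l; [lra|]. eapply Rle_trans; [apply re_le_Cmod|now apply odd_poly_bound1].
Qed.

Lemma odd_weight_mean (n : nat) : (14 <= n)%nat -> mean n odd_weight = 0.
Proof.
  intros Hn. unfold odd_weight. rewrite mean_scal.
  assert (E : cmean n pc = 0%C).
  { rewrite (cmean_ext _ _ (fun z => pc z * 1)%C) by (intros; ring).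
    rewrite cmean_odd_poly.
    rewrite !(cmean_ext n (fun z => z ^ _ * 1)%C _ (fun z _ => Cmult_1_r _)).
    rewrite !cmean_pow by lia. ring. }
  apply (f_equal Re) in E. change (mean n (fun z => Re (odd_poly y1 y3 y5 y7 z)) = 0) in E.
  rewrite E; ring.
Qed.

(* The holomorphic half of the weight integrates a holomorphic kernel to zero. *)
Lemma holomorphic_half (K K1 : C -> C -> C) : UH cdisk 0 K K1 ->
  small cdisk (fun n w => cmean n (fun z => pc z * K w z)%C).
Proof.
  intros HK. destruct (odd_poly_UH cdisk) as [P1 HP].
  destruct (UH_bounds _ _ _ _ HK) as (M & HM & HB & _).
  pose proof (UH_mult _ _ _ _ HP HK) as H.
  intros eps He.
  destruct (mean_vanish _ _ _ 0 ((Cmod y1 + Cmod y3 + Cmod y5 + Cmod y7) * M) H) with (eps := eps)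
    as [N HN]; auto.
  - intros w z Hw Hz. rewrite pow_1, Rmult_assoc, (Rmult_comm M), <- Rmult_assoc.
    apply Cmod_mul_le; [now apply odd_poly_bound|auto].
  - exists N; intros n Hn w Hw. specialize (HN n Hn w Hw).
    rewrite (cmean_ext n _ (fun z => Cconj z ^ 0 * (pc z * K w z))%C); [exact HN|].
    intros; simpl; ring.
Qed.

Lemma mean2_Re (n : nat) (X : C -> R) (K : C -> C -> C) :
  mean2 n (fun z w => X z * X w * Re (K z w))
  = Re (cmean n (fun w => X w * cmean n (fun z => X z * K z w))%C).
Proof.
  rewrite Re_cmean. unfold mean2. rewrite mean_swap. apply mean_ext; intros w _.
  rewrite re_scal_l, Re_cmean, <- mean_scal. apply mean_ext; intros z _.
  rewrite re_scal_l; ring.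
Qed.

(** The holomorphic half of the inner weight contributes o(1) uniformly in w, and the outer weight
    is bounded. *)
Lemma reduce_half (K K1 : C -> C -> C) : UH cdisk 0 (fun w z => K z w) K1 ->
  csmall (fun n => cmean n (fun w => odd_weight w * cmean n (fun z => odd_weight z * K z w))
    - cmean n (fun w => odd_weight w * cmean n (fun z => Cconj (pc z) * K z w)))%C.
Proof.
  intros HK.
  apply (small_ext 0 (fun n _ => cmean n (fun w => odd_weight w * cmean n (fun z => pc z * K z w)))%C).
  - intros n _ _ _. rewrite <- cmean_minus. apply cmean_ext; intros w _.
    rewrite (cmean_ext n (fun z => odd_weight z * K z w)%C
               (fun z => pc z * K z w + Cconj (pc z) * K z w)%C)
      by (intros; rewrite odd_weight_C; ring).
    rewrite cmean_plus. ring.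
  - apply (small_cmean (fun w => RtoC (odd_weight w)) (2 * (Cmod y1 + Cmod y3 + Cmod y5 + Cmod y7))
             (fun n w => cmean n (fun z => pc z * K z w)%C)).
    + intros w Hw. rewrite Cmod_R. now apply odd_weight_bound.
    + intros eps He. destruct (holomorphic_half _ _ HK eps He) as [N HN].
      exists N; intros n Hn w Hw. apply HN; auto. now apply circle_cdisk.
Qed.
End Poly.

(** The induction peels off constant coefficients, z^j recording how many are gone; orthogonality of
    powers then isolates one coefficient. *)
Lemma cmean_psum (n k : nat) (c : C) (m j : nat) (b : nat -> C) :
  (2 * k <= n)%nat -> (2 * (j + m) <= n)%nat ->
  ((k < j)%nat -> cmean n (fun z => Cconj z ^ k * (z ^ j * psum b m (z * c)))%C = 0%C) /\
  ((j <= k < j + m)%nat ->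
     cmean n (fun z => Cconj z ^ k * (z ^ j * psum b m (z * c)))%C = (b (k - j)%nat * c ^ (k - j))%C).
Proof.
  intros Hk. revert j b; induction m as [|m IH]; intros j b Hn.
  - split; [|lia]. intros _. rewrite (cmean_ext _ _ (fun _ => 0%C)) by (intros; simpl; ring).
    apply cmean_const.
  - destruct (IH (S j) (fun n => b (S n)) ltac:(lia)) as [I1 I2].
    assert (E : cmean n (fun z => Cconj z ^ k * (z ^ j * psum b (S m) (z * c)))%C
      = (b 0%nat * cmean n (fun z => Cconj z ^ k * z ^ j)
         + c * cmean n (fun z => Cconj z ^ k * (z ^ S j * psum (fun n => b (S n)) m (z * c))))%C).
    { rewrite <- !cmean_scal, <- cmean_plus. apply cmean_ext; intros z _. simpl; ring. }
    rewrite E. split; intros H.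
    + rewrite I1 by lia. rewrite cmean_orth_gt by lia. ring.
    + destruct (Nat.eq_dec j k) as [->|Hne].
      * rewrite I1 by lia. rewrite cmean_orth_eq, Nat.sub_diag. simpl; ring.
      * rewrite I2 by lia. rewrite cmean_orth_lt by lia.
        replace (k - j)%nat with (S (k - S j)) by lia. simpl; ring.
Qed.

Lemma UH_psum {I : Type} (P : I -> Prop) (r : R) (K K1 : I -> C -> C) (m : nat) (b : nat -> C) :
  UH P r K K1 -> exists K2, UH P r (fun i z => psum b m (K i z)) K2.
Proof.
  intros HK. revert b; induction m as [|m IH]; intros b.
  - eexists. apply (UH_const (fun _ => 0%C) 0). intros; rewrite Cmod_0; lra.
  - destruct (IH (fun n => b (S n))) as [K2 H2]. eexists.
    refine (UH_plus _ _ _ _ (UH_const (fun _ => b 0%nat) (Cmod (b 0%nat)) _) (UH_mult _ _ _ _ HK H2)).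
    intros; lra.
Qed.

(** * The regularized logarithmic kernel of the circle *)

Section Kernel.
Variable rho : R.
Hypothesis Hrho : 0 < rho < 1.
Let Hr : 0 <= rho < 1. Proof. lra. Qed.

Lemma zwbar_UH : exists K1, UH cdisk 0 (fun w z => z * Cconj w)%C K1.
Proof.
  eexists. refine (UH_mult _ _ _ _ UH_id (UH_const (fun w => Cconj w) 1 _)).
  intros w [_ H]. now rewrite Cmod_conj.
Qed.

Lemma zwbar_cdisk (w z : C) : cdisk w -> cdisk z -> cdisk (z * Cconj w)%C.
Proof.
  intros Hw Hz; apply cdisk_mult; auto. apply cdisk_intro. rewrite Cmod_conj; apply Hw.
Qed.

Lemma lam_UH : exists K1, UH cdisk 0 (fun w z => lam rho (z * Cconj w))%C K1.
Proof.
  destruct zwbar_UH as [U1 HU]. eexists.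
  exact (UH_comp 0 _ _ _ _ HU (dclass_UH cdisk _ _ (lam_dclass rho Hr)) zwbar_cdisk).
Qed.

(** Eight terms of the series cover all frequencies up to 7 and are paired exactly; the tail
    vanishes to order 8 >= k + 1 at 0, so [mean_vanish] disposes of it. *)
Lemma lam_pair (k : nat) : (1 <= k <= 7)%nat ->
  small cdisk (fun n w => cmean n (fun z => Cconj z ^ k * lam rho (z * Cconj w))
    - RtoC (rho ^ k / INR k) * Cconj w ^ k)%C.
Proof.
  intros Hk. destruct (pseries_tail 8 (lcoef rho) (ex_lcoef rho Hr)) as (B & HB & Htail).
  destruct lam_UH as [L1 HL]. destruct zwbar_UH as [U1 HU].
  destruct (UH_psum _ _ _ _ 8 (lcoef rho) HU) as [K2 H2].
  pose proof (UH_minus _ _ _ _ HL H2) as H. cbv beta in H.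
  apply (small_ext 16 (fun n w => cmean n (fun z => Cconj z ^ k *
           (lam rho (z * Cconj w) - psum (lcoef rho) 8 (z * Cconj w))))%C).
  - intros n w Hn Hw. destruct (cmean_psum n k (Cconj w) 8 0 (lcoef rho)) as [_ E]; [lia|lia|].
    specialize (E ltac:(lia)). rewrite Nat.sub_0_r in E.
    rewrite (cmean_ext n _ (fun z => Cconj z ^ k * lam rho (z * Cconj w)
        - Cconj z ^ k * (z ^ 0 * psum (lcoef rho) 8 (z * Cconj w)))%C)
      by (intros; simpl Cpow; ring).
    rewrite cmean_minus, E. destruct k as [|k]; [lia|]. reflexivity.
  - intros eps He. destruct (mean_vanish _ _ _ k B H) with (eps := eps) as [N HN]; auto.
    + intros w z Hw Hz. eapply Rle_trans; [apply Htail, zwbar_cdisk; auto|].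
      apply Rmult_le_compat_l; auto. rewrite Cmod_mult, Cmod_conj.
      destruct Hz as [Z0 Z1]; destruct Hw as [W0 W1].
      apply Rle_trans with (Cmod z ^ 8); [apply pow_incr; nra|].
      replace 8%nat with (S k + (7 - k))%nat by lia. rewrite pow_add.
      rewrite <- (Rmult_1_r (Cmod z ^ S k)) at 2. apply Rmult_le_compat_l; [apply pow_le; auto|].
      rewrite <- (pow1 (7 - k)). apply pow_incr; auto.
    + exists N; auto.
Qed.

(** With x = z conj w the Poisson kernel is 1 + 2 Re (rho x / (1 - rho x)), and the second term is
    the real part of a function of z vanishing at 0. The bound 2 leaves room above the limit 1. *)
Lemma poisson_mean : exists N, forall n, (N <= n)%nat ->
  mean2 n (fun z w => (1 - rho ^ 2) / Cmod (1 - rho * (z * Cconj w))%C ^ 2) <= 2.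
Proof.
  destruct zwbar_UH as [U1 HU].
  assert (Hlow : forall w z, cdisk w -> cdisk z -> 1 - rho <= Cmod (1 - rho * (z * Cconj w))%C)
    by (intros; apply lam_lower; auto; apply zwbar_cdisk; auto).
  assert (Hc : 0 < 1 - rho) by lra.
  assert (V : UH cdisk 0 (fun w z => 1 - rho * (z * Cconj w))%C (fun w z => 0 - rho * U1 w z)%C).
  { apply UH_minus; [apply (UH_const (fun _ => RtoC 1) 1); intros; rewrite Cmod_1; lra|].
    now apply UH_scal. }
  pose proof (UH_inv _ _ _ Hc Hlow V) as Vi.
  pose proof (UH_scal (2 * rho) _ _ (UH_mult _ _ _ _ HU Vi)) as W. cbv beta in W.
  set (K := fun w z => (2 * rho * (z * Cconj w * / (1 - rho * (z * Cconj w))))%C) in W.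
  destruct (mean_vanish _ _ _ 0 (2 * / (1 - rho)) W) with (eps := 1) as [N HN]; [|lra|].
  - intros w z Hw Hz. unfold K. rewrite pow_1, Rmult_assoc, (Rmult_comm (/ _)).
    rewrite <- Cmult_assoc. apply Cmod_mul_le; [rewrite Cmod_R, Rabs_pos_eq; lra|].
    rewrite <- (Rmult_1_l (Cmod z * _)).
    apply Cmod_mul_le; [rewrite Cmod_R, Rabs_pos_eq; lra|].
    apply Cmod_mul_le; [|apply Cmod_inv_le; auto].
    rewrite Cmod_mult, Cmod_conj. destruct Hw as [_ Hw]. pose proof (Cmod_ge_0 z); nra.
  - exists N; intros n Hn.
    rewrite (mean2_ext n _ (fun z w => 1 * 1 + 1 * 1 * Re (K w z))).
    + rewrite mean2_plus, mean2_prod, mean_const.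
      assert (mean2 n (fun z w => 1 * 1 * Re (K w z)) <= 1); [|lra].
      rewrite (mean2_Re n (fun _ => 1) (fun z w => K w z)).
      eapply Rle_trans; [apply Rle_abs|]. eapply Rle_trans; [apply re_le_Cmod|].
      apply cmean_le; intros w Hw. rewrite Cmult_1_l.
      specialize (HN n Hn w (circle_cdisk w Hw)).
      rewrite (cmean_ext n _ (fun z => Cconj z ^ 0 * K w z)%C); [exact HN|].
      intros; simpl; ring.
    + intros z w Hz Hw. unfold K.
      pose proof (Hlow w z (circle_cdisk w Hw) (circle_cdisk z Hz)) as Hl.
      assert (Hx : Cmod (z * Cconj w)%C = 1) by (rewrite Cmod_mult, Cmod_conj, Hz, Hw; ring).
      set (x := (z * Cconj w)%C) in *.
      assert (Hne : (1 - rho * x)%C <> 0%C) by (eapply Cmod_pos_neq; eauto).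
      assert (Hp : 0 < Cmod (1 - rho * x)%C ^ 2) by (apply pow_lt; lra).
      apply (Rmult_eq_reg_l (Cmod (1 - rho * x)%C ^ 2)); [|lra].
      assert (E : (RtoC (Cmod (1 - rho * x)%C ^ 2) * (2 * rho * (x * / (1 - rho * x))))%C
                  = (2 * rho * (x * Cconj (1 - rho * x)))%C).
      { rewrite Cmod2_conj. field. auto. }
      apply (f_equal Re) in E. rewrite re_scal_l in E.
      replace (Cmod (1 - rho * x)%C ^ 2 * ((1 - rho ^ 2) / Cmod (1 - rho * x)%C ^ 2))
        with (1 - rho ^ 2) by (field; lra).
      replace (Cmod (1 - rho * x)%C ^ 2 * (1 * 1 + 1 * 1 * Re (2 * rho * (x * / (1 - rho * x)))%C))
        with (Cmod (1 - rho * x)%C ^ 2 + Re (2 * rho * (x * Cconj (1 - rho * x)))%C)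
        by (rewrite <- E; ring).
      assert (Hx2 : Re x ^ 2 + Im x ^ 2 = 1) by (rewrite <- Cmod2_alt, Hx; ring).
      rewrite Cmod2_alt. destruct x as [a b]. unfold Re, Im in *; simpl in *.
      transitivity (1 - rho * rho * (a * (a * 1) + b * (b * 1))); [rewrite Hx2|]; ring.
Qed.

(** This identity dictates tau = (1 - rho)^2 / rho: the same regularization is used for the energy
    of the images and for that of the circle. *)
Lemma circle_distance (z w : C) : Cmod z = 1 -> Cmod w = 1 ->
  Cmod (1 - rho * (z * Cconj w))%C ^ 2 = rho * (Cmod (z - w)%C ^ 2 + (1 - rho) ^ 2 / rho).
Proof.
  intros Hz Hw.
  assert (E1 : Re z ^ 2 + Im z ^ 2 = 1) by (rewrite <- Cmod2_alt, Hz; ring).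
  assert (E2 : Re w ^ 2 + Im w ^ 2 = 1) by (rewrite <- Cmod2_alt, Hw; ring).
  rewrite !Cmod2_alt. destruct z as [a b], w as [c d]. unfold Re, Im in *; simpl in *.
  transitivity (1 - 2 * rho * (a * c + b * d)
    + rho ^ 2 * ((a * (a * 1) + b * (b * 1)) * (c * (c * 1) + d * (d * 1)))); [ring|].
  transitivity (rho * ((a * (a * 1) + b * (b * 1)) + (c * (c * 1) + d * (d * 1))
    - 2 * (a * c + b * d)) + (1 - rho) ^ 2); [rewrite E1, E2; ring|field; lra].
Qed.

End Kernel.

(** The conjugate half only produces frequencies j + k between 1 and 14, whose means vanish once
    twice the frequency is at most n, hence 28. *)
Lemma odd_weight_coef (y1 y3 y5 y7 : C) (n k : nat) : (28 <= n)%nat -> (1 <= k <= 7)%nat ->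
  cmean n (fun w => odd_weight y1 y3 y5 y7 w * Cconj w ^ k)%C
  = cmean n (fun w => odd_poly y1 y3 y5 y7 w * Cconj w ^ k)%C.
Proof.
  intros Hn Hk.
  assert (Z : forall j, (j <= 7)%nat -> cmean n (fun z => z ^ j * z ^ k)%C = 0%C).
  { intros j Hj. rewrite (cmean_ext n _ (fun z => z ^ (j + k))%C)
      by (intros; now rewrite Cpow_add_r). apply cmean_pow; lia. }
  rewrite (cmean_ext n (fun w => odd_weight y1 y3 y5 y7 w * Cconj w ^ k)%C
    (fun w => odd_poly y1 y3 y5 y7 w * Cconj w ^ k + Cconj (odd_poly y1 y3 y5 y7 w * w ^ k))%C).
  - rewrite cmean_plus, cmean_conj, (cmean_odd_poly y1 y3 y5 y7 n (fun w => w ^ k)%C).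
    rewrite !Z by lia.
    replace (_ + _ + _ + _)%C with (RtoC 0) by ring.
    unfold Cconj at 2; simpl. rewrite Ropp_0. apply Cplus_0_r.
  - intros w _. rewrite odd_weight_C, Cmult_conj, Cpow_conj. ring.
Qed.

(** Energy of the test weight against the circle kernel with parameter t; t = 1 is the limit free of
    regularization. *)
Definition weight (t : R) (y1 y3 y5 y7 : C) : R :=
  t * Cmod y1 ^ 2 + t ^ 3 / 3 * Cmod y3 ^ 2 + t ^ 5 / 5 * Cmod y5 ^ 2 + t ^ 7 / 7 * Cmod y7 ^ 2.

Lemma weight_le (t : R) (y1 y3 y5 y7 : C) : 0 <= t <= 1 ->
  weight t y1 y3 y5 y7 <= weight 1 y1 y3 y5 y7.
Proof.
  intros Ht. unfold weight. rewrite !pow1.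
  assert (H : forall k, t ^ k <= 1) by (intros k; rewrite <- (pow1 k); apply pow_incr; lra).
  pose proof (H 3%nat); pose proof (H 5%nat); pose proof (H 7%nat).
  repeat apply Rplus_le_compat; apply Rmult_le_compat_r; try apply pow2_ge_0; lra.
Qed.

Section Circle.
Variables y1 y3 y5 y7 : C.
Let pc := odd_poly y1 y3 y5 y7.
Let X := odd_weight y1 y3 y5 y7.

Lemma odd_poly_coef (n : nat) : (28 <= n)%nat ->
  cmean n (fun w => pc w * Cconj w ^ 1)%C = y1 /\ cmean n (fun w => pc w * Cconj w ^ 3)%C = y3 /\
  cmean n (fun w => pc w * Cconj w ^ 5)%C = y5 /\ cmean n (fun w => pc w * Cconj w ^ 7)%C = y7.
Proof.
  intros Hn.
  assert (O : forall k j, (k <= 7)%nat -> (j <= 7)%nat ->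
    cmean n (fun w => w ^ j * Cconj w ^ k)%C = if Nat.eqb k j then 1%C else 0%C).
  { intros k j Hk Hj. rewrite (cmean_ext n _ (fun w => Cconj w ^ k * w ^ j)%C) by (intros; ring).
    destruct (Nat.eqb_spec k j) as [->|Hne]; [apply cmean_orth_eq|].
    destruct (Nat.lt_ge_cases k j); [apply cmean_orth_gt|apply cmean_orth_lt]; lia. }
  unfold pc. repeat split;
    match goal with |- cmean n (fun w => _ * Cconj w ^ ?k)%C = _ =>
      rewrite (cmean_odd_poly y1 y3 y5 y7 n (fun w => Cconj w ^ k)%C) end;
    rewrite !O by lia; simpl Nat.eqb; cbv iota; ring.
Qed.

(** The conjugate half of the inner weight reads off the coefficients of [lam], producing [T]; the
    outer weight pairs [T] with the coefficients of the polynomial. *)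
Lemma circle_energy (rho : R) : 0 < rho < 1 ->
  csmall (fun n => cmean n (fun w => X w * cmean n (fun z => X z * lam rho (z * Cconj w)))
                   - RtoC (weight rho y1 y3 y5 y7))%C.
Proof.
  intros Hr. destruct (lam_UH rho Hr) as [L1 HL].
  set (T := fun w => (Cconj y1 * (RtoC (rho ^ 1 / INR 1) * Cconj w ^ 1)
    + Cconj y3 * (RtoC (rho ^ 3 / INR 3) * Cconj w ^ 3)
    + Cconj y5 * (RtoC (rho ^ 5 / INR 5) * Cconj w ^ 5)
    + Cconj y7 * (RtoC (rho ^ 7 / INR 7) * Cconj w ^ 7))%C).
  assert (H1 : small circle (fun n w => cmean n (fun z => Cconj (pc z) * lam rho (z * Cconj w)) - T w)%C).
  { assert (S : forall k, (1 <= k <= 7)%nat -> forall y,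
      small circle (fun n w => y * (cmean n (fun z => Cconj z ^ k * lam rho (z * Cconj w))
                                    - RtoC (rho ^ k / INR k) * Cconj w ^ k))%C).
    { intros k Hk y. apply small_scal. intros eps He.
      destruct (lam_pair rho Hr k Hk eps He) as [N HN]. exists N; intros n Hn w Hw.
      apply HN; auto. now apply circle_cdisk. }
    eapply (small_ext 0); [|exact (small_plus _ _ (small_plus _ _ (small_plus _ _
      (S 1%nat ltac:(lia) (Cconj y1)) (S 3%nat ltac:(lia) (Cconj y3)))
      (S 5%nat ltac:(lia) (Cconj y5))) (S 7%nat ltac:(lia) (Cconj y7)))].
    intros n w _ _. cbv beta. unfold pc. rewrite cmean_odd_poly_conj. unfold T. ring. }
  assert (HX : forall w, Cmod w = 1 -> Cmod (RtoC (X w)) <= 2 * (Cmod y1 + Cmod y3 + Cmod y5 + Cmod y7)).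
  { intros w Hw. rewrite Cmod_R. now apply odd_weight_bound. }
  pose proof (small_cmean (fun w => RtoC (X w)) _ _ HX H1) as H2.
  pose proof (reduce_half y1 y3 y5 y7 (fun z w => lam rho (z * Cconj w))%C _ HL) as H3.
  eapply (small_ext 28); [|exact (small_plus _ _ H3 H2)].
  intros n [] Hn _. cbv beta. fold pc. fold X.
  rewrite (cmean_ext n (fun w => X w * (cmean n (fun z => Cconj (pc z) * lam rho (z * Cconj w)) - T w))%C
    (fun w => X w * cmean n (fun z => Cconj (pc z) * lam rho (z * Cconj w)) - X w * T w)%C)
    by (intros; ring).
  rewrite cmean_minus.
  assert (E : cmean n (fun w => X w * T w)%C = RtoC (weight rho y1 y3 y5 y7)).
  { rewrite (cmean_ext n _ (fun w =>
      Cconj y1 * RtoC (rho ^ 1 / INR 1) * (X w * Cconj w ^ 1)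
      + Cconj y3 * RtoC (rho ^ 3 / INR 3) * (X w * Cconj w ^ 3)
      + Cconj y5 * RtoC (rho ^ 5 / INR 5) * (X w * Cconj w ^ 5)
      + Cconj y7 * RtoC (rho ^ 7 / INR 7) * (X w * Cconj w ^ 7))%C)
      by (intros; unfold T; ring).
    rewrite !cmean_plus, !cmean_scal. unfold X. rewrite !odd_weight_coef by lia.
    destruct (odd_poly_coef n Hn) as (E1 & E3 & E5 & E7). unfold pc in *.
    rewrite E1, E3, E5, E7. unfold weight.
    rewrite !RtoC_plus, !RtoC_mult, !Cmod2_conj.
    replace (rho ^ 1 / INR 1) with rho by (simpl; field).
    replace (INR 3) with 3 by (simpl; ring). replace (INR 5) with 5 by (simpl; ring).
    replace (INR 7) with 7 by (simpl; ring). ring. }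
  rewrite E. ring.
Qed.

End Circle.

(** * Comparison of the image energy with the circle energy *)

Section Area.
Variables (phi : C -> C) (D D1 : C -> C -> C).
Hypothesis Hphi : dclass phi D.
Hypothesis HD : UH cdisk 0 (fun w z => D z w) D1.
Hypothesis Hn : forall z w, cdisk z -> cdisk w -> D z w <> 0%C.

(* The bound on the right is a multiple of the Poisson kernel, whose mean is 1, so the error
   disappears as rho tends to 1. *)
Lemma log_ratio_bound : exists K, 0 <= K /\ forall rho z w, 0 < rho < 1 -> Cmod z = 1 -> Cmod w = 1 ->
  Rabs (ln (Cmod (phi z - phi w)%C ^ 2
            + (1 - rho) ^ 2 / rho * ((1 + Cmod (phi z) ^ 2) * (1 + Cmod (phi w) ^ 2)))
        - ln (Cmod (1 - rho * (z * Cconj w))%C ^ 2) + ln rho - ln (Cmod (D z w) ^ 2))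
    <= K * (1 - rho) * ((1 - rho ^ 2) / Cmod (1 - rho * (z * Cconj w))%C ^ 2).
Proof.
  destruct (bidisk_lower _ _ Hphi Hn) as (c & Hc & Hlow).
  destruct (UH_bounds _ _ _ _ HD) as (M & HM & HB & _).
  destruct (dclass_bounded _ _ Hphi) as (M0 & HM0 & HB0 & _).
  (* With t = d + tau, both d q + tau al and t q are at least m t, because q >= m and al >= 1 >= m;
     they differ by tau (al - q), which [B] controls. *)
  set (m := Rmin (c ^ 2) 1).
  assert (Hm : 0 < m) by (apply Rmin_pos; [apply pow_lt; auto|lra]).
  set (B := (1 + M0 ^ 2) * (1 + M0 ^ 2) + M ^ 2).
  assert (HBp : 0 <= B).
  { unfold B. pose proof (pow2_ge_0 M0). pose proof (pow2_ge_0 M). nra. }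
  exists (B / m). split; [apply Rle_div_r; lra|].
  intros rho z w Hr Hz Hw.
  pose proof (circle_cdisk z Hz) as Dz. pose proof (circle_cdisk w Hw) as Dw.
  set (tau := (1 - rho) ^ 2 / rho).
  assert (Htau : 0 < tau) by (apply Rdiv_lt_0_compat; [apply pow_lt|]; lra).
  set (d := Cmod (z - w)%C ^ 2). assert (Hd : 0 <= d) by apply pow2_ge_0.
  set (q := Cmod (D z w) ^ 2).
  assert (Hq : m <= q).
  { eapply Rle_trans; [apply Rmin_l|]. apply pow_incr; split; [lra|auto]. }
  assert (HqM : q <= M ^ 2) by (apply pow_incr; split; [apply Cmod_ge_0|auto]).
  set (al := (1 + Cmod (phi z) ^ 2) * (1 + Cmod (phi w) ^ 2)).
  assert (Hal : 1 <= al <= (1 + M0 ^ 2) * (1 + M0 ^ 2)).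
  { pose proof (pow2_ge_0 (Cmod (phi z))). pose proof (pow2_ge_0 (Cmod (phi w))).
    assert (Cmod (phi z) ^ 2 <= M0 ^ 2) by (apply pow_incr; split; [apply Cmod_ge_0|auto]).
    assert (Cmod (phi w) ^ 2 <= M0 ^ 2) by (apply pow_incr; split; [apply Cmod_ge_0|auto]).
    unfold al; split; nra. }
  assert (Hm1 : m <= 1) by apply Rmin_r.
  rewrite (proj1 Hphi z w Dz Dw), Cmod_mult, Rpow_mult_distr. fold d q.
  rewrite (circle_distance rho Hr z w Hz Hw). fold tau d.
  set (t := d + tau). assert (Ht : 0 < t) by (unfold t; lra).
  assert (Hs : m * t <= d * q + tau * al) by (unfold t; nra).
  assert (Hmt : 0 < m * t) by (apply Rmult_lt_0_compat; auto).
  rewrite ln_mult by lra.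
  replace (ln (d * q + tau * al) - (ln rho + ln t) + ln rho - ln q)
    with (ln (d * q + tau * al) - ln (t * q)) by (rewrite ln_mult by lra; ring).
  set (s := d * q + tau * al) in *.
  assert (Htq : m * t <= t * q) by nra.
  assert (E : forall x y, m * t <= x -> 0 < y -> Rabs (y - x) <= tau * B ->
            ln y - ln x <= B / m * (tau / t)).
  { intros x y Hx Hy Hxy. assert (Hx0 : 0 < x) by lra.
    rewrite <- ln_div by auto.
    assert (Hp : 0 < y / x) by (apply Rdiv_lt_0_compat; auto).
    pose proof (exp_ineq1_le (ln (y / x))) as He. rewrite exp_ln in He by auto.
    assert (Hle : y - x <= tau * B) by (eapply Rle_trans; [apply Rle_abs|exact Hxy]).
    apply Rle_trans with (y / x - 1); [lra|].
    replace (y / x - 1) with ((y - x) * / x) by (field; lra).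
    replace (B / m * (tau / t)) with (tau * B * / (m * t)) by (field; lra).
    apply Rle_trans with (tau * B * / x).
    - apply Rmult_le_compat_r; [left; apply Rinv_0_lt_compat; auto|auto].
    - apply Rmult_le_compat_l; [apply Rmult_le_pos; lra|apply Rinv_le_contravar; auto]. }
  assert (Hdiff : Rabs (s - t * q) <= tau * B).
  { replace (s - t * q) with (tau * (al - q)) by (unfold s, t; ring).
    rewrite Rabs_mult, Rabs_pos_eq by lra. apply Rmult_le_compat_l; [lra|].
    unfold B. apply Rabs_le; lra. }
  (* Here rho t is |1 - rho z conj w|^2, and (1 - rho)^2 <= (1 - rho)(1 - rho^2) brings out the
     Poisson kernel with a spare factor 1 - rho. *)
  assert (Hfin : B / m * (tau / t) <= B / m * (1 - rho) * ((1 - rho ^ 2) / (rho * t))).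
  { rewrite Rmult_assoc. apply Rmult_le_compat_l; [apply Rle_div_r; lra|].
    replace (tau / t) with ((1 - rho) ^ 2 * / (rho * t)) by (unfold tau; field; lra).
    replace ((1 - rho) * ((1 - rho ^ 2) / (rho * t)))
      with ((1 - rho) * (1 - rho ^ 2) * / (rho * t)) by (field; lra).
    apply Rmult_le_compat_r; [left; apply Rinv_0_lt_compat, Rmult_lt_0_compat; lra|].
    replace ((1 - rho) ^ 2) with ((1 - rho) * (1 - rho)) by ring.
    apply Rmult_le_compat_l; [lra|]. assert (0 <= rho * (1 - rho)) by (apply Rmult_le_pos; lra). lra. }
  eapply Rle_trans; [|exact Hfin].
  apply Rabs_le. split.
  - assert (ln (t * q) - ln s <= B / m * (tau / t)); [|lra].
    apply E; [lra|lra|]. rewrite Rabs_minus_sym; auto.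
  - apply E; [lra|lra|auto].
Qed.

(** Up to the controlled error, ln |D|^2 is the image kernel minus the circle kernel plus ln rho.
    The first has energy at most 0, the second is [circle_energy], the third is killed by mean zero.
    The parameter rho is fixed from eps before n grows. *)
Lemma energy_upper (y1 y3 y5 y7 : C) (eps : R) : 0 < eps -> exists N, forall n, (N <= n)%nat ->
  mean2 n (fun z w => odd_weight y1 y3 y5 y7 z * odd_weight y1 y3 y5 y7 w * ln (Cmod (D z w) ^ 2))
    <= 2 * weight 1 y1 y3 y5 y7 + eps.
Proof.
  intros He. set (X := odd_weight y1 y3 y5 y7).
  destruct log_ratio_bound as (K & HK & Hlr).
  set (b := 2 * (Cmod y1 + Cmod y3 + Cmod y5 + Cmod y7)).
  assert (Hb : forall z, Cmod z = 1 -> Rabs (X z) <= b) by (intros; now apply odd_weight_bound).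
  clearbody b.
  assert (Hb0 : 0 <= b).
  { eapply Rle_trans; [apply Rabs_pos|apply (Hb 1%C Cmod_1)]. }
  assert (Hkb : 0 <= b * b * K) by (repeat apply Rmult_le_pos; auto).
  (* The gap 1 - rho is taken so small that the error is at most eps / 4 times the Poisson mean,
     hence at most eps / 2. *)
  set (dl := Rmin (1 / 2) (eps / 4 / (b * b * K + 1))).
  assert (Hdl : 0 < dl).
  { apply Rmin_pos; [lra|]. apply Rdiv_lt_0_compat; lra. }
  assert (Hdl2 : dl <= 1 / 2) by apply Rmin_l.
  assert (Hdle : b * b * K * dl <= eps / 4).
  { apply Rle_trans with (b * b * K * (eps / 4 / (b * b * K + 1))).
    - apply Rmult_le_compat_l; [auto|apply Rmin_r].
    - apply (Rmult_le_reg_r (b * b * K + 1)); [lra|].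
      replace (b * b * K * (eps / 4 / (b * b * K + 1)) * (b * b * K + 1))
        with (b * b * K * (eps / 4)) by (field; lra). nra. }
  set (rho := 1 - dl). assert (Hr : 0 < rho < 1) by (unfold rho; lra).
  destruct (poisson_mean rho Hr) as [N1 HN1].
  destruct (circle_energy y1 y3 y5 y7 rho Hr (eps / 8) ltac:(lra)) as [N2 HN2].
  exists (N1 + N2 + 14)%nat. intros n Hn'.
  assert (HX0 : mean n X = 0) by (apply odd_weight_mean; lia).
  set (tau := (1 - rho) ^ 2 / rho).
  assert (Htau : 0 < tau) by (apply Rdiv_lt_0_compat; [apply pow_lt|]; lra).
  pose proof (log_energy n X phi tau Htau HX0) as HE.
  set (S := fun z w => ln (Cmod (phi z - phi w)%C ^ 2
     + tau * ((1 + Cmod (phi z) ^ 2) * (1 + Cmod (phi w) ^ 2)))) in *.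
  set (V := fun z w => ln (Cmod (1 - rho * (z * Cconj w))%C ^ 2)).
  set (Q := fun z w => ln (Cmod (D z w) ^ 2)).
  set (Po := fun z w => (1 - rho ^ 2) / Cmod (1 - rho * (z * Cconj w))%C ^ 2).
  assert (HV : mean2 n (fun z w => X z * X w * V z w) >= - 2 * weight 1 y1 y3 y5 y7 - eps / 2).
  { assert (Hr' : 0 <= rho < 1) by lra.
    rewrite (mean2_ext n _ (fun z w => (-2) * (X z * X w * Re (lam rho (z * Cconj w))))).
    - rewrite mean2_scal, mean2_Re.
      specialize (HN2 n ltac:(lia) tt Logic.I).
      set (A := cmean n _) in HN2. fold X in A. fold A.
      pose proof (re_le_Cmod (A - RtoC (weight rho y1 y3 y5 y7))%C) as HRe.
      replace (Re (A - RtoC (weight rho y1 y3 y5 y7))%C) with (Re A - weight rho y1 y3 y5 y7) in HRe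
        by (unfold Re; simpl; ring).
      assert (HRe' : Rabs (Re A - weight rho y1 y3 y5 y7) <= eps / 8) by lra.
      apply Rabs_le_between in HRe'.
      pose proof (weight_le rho y1 y3 y5 y7 ltac:(lra)). lra.
    - intros z w Hz Hw. unfold V.
      pose proof (lam_Re rho Hr' (z * Cconj w)%C
        (zwbar_cdisk w z (circle_cdisk w Hw) (circle_cdisk z Hz))) as E.
      replace (ln (Cmod (1 - rho * (z * Cconj w))%C ^ 2)) with (- (2 * Re (lam rho (z * Cconj w)%C)))
        by lra. ring. }
  assert (HQ : mean2 n (fun z w => X z * X w * Q z w)
     <= mean2 n (fun z w => X z * X w * S z w - X z * X w * V z w + ln rho * (X z * X w)
                            + b * b * K * dl * Po z w)).
  { apply mean2_le. intros z w Hz Hw.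
    pose proof (Hlr rho z w Hr Hz Hw) as H. fold tau (S z w) (V z w) (Q z w) (Po z w) in H.
    replace (1 - rho) with dl in H by (unfold rho; ring).
    set (e := S z w - V z w + ln rho - Q z w) in H.
    replace (X z * X w * Q z w) with
      (X z * X w * S z w - X z * X w * V z w + ln rho * (X z * X w) - X z * X w * e)
      by (unfold e; ring).
    assert (Rabs (X z * X w * e) <= b * b * K * dl * Po z w).
    { rewrite !Rabs_mult.
      replace (b * b * K * dl * Po z w) with (b * b * (K * dl * Po z w)) by ring.
      apply Rmult_le_compat; [apply Rmult_le_pos; apply Rabs_pos|apply Rabs_pos| |exact H].
      apply Rmult_le_compat; try apply Rabs_pos; auto. }
    apply Rabs_le_between in H0. lra. }
  rewrite !mean2_plus, mean2_minus, !mean2_scal, mean2_prod, HX0 in HQ.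
  specialize (HN1 n ltac:(lia)). change (mean2 n Po <= 2) in HN1.
  assert (b * b * K * dl * mean2 n Po <= eps / 4 * 2).
  { assert (0 <= b * b * K * dl) by (apply Rmult_le_pos; lra). 
    destruct (Rle_or_lt 0 (mean2 n Po)).
    - apply Rmult_le_compat; lra.
    - nra. }
  change (mean2 n (fun z w => X z * X w * S z w) <= 0) in HE.
  change (mean2 n (fun z w => X z * X w * Q z w) <= 2 * weight 1 y1 y3 y5 y7 + eps).
  lra.
Qed.
End Area.

(** * The Grunsky form and the area inequality *)

Section Form.
Variables (phi : C -> C) (D D1 : C -> C -> C).
Hypothesis Hphi : dclass phi D.
Hypothesis HD : UH cdisk 0 (fun w z => D z w) D1.
Hypothesis Hn : forall z w, cdisk z -> cdisk w -> D z w <> 0%C.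
Variables (L L1 : C -> C -> C).
Hypothesis HL : UH cdisk 0 (fun w z => L z w) L1.
Hypothesis HLs : forall z w, cdisk z -> cdisk w -> L z w = L w z.
Hypothesis HLe : forall z w, cdisk z -> cdisk w -> 2 * Re (L z w) = ln (Cmod (D z w) ^ 2).

(* The discretized Grunsky form. *)
Definition form (n : nat) (f g : C -> C) : C :=
  cmean n (fun w => Cconj (g w) * cmean n (fun z => Cconj (f z) * L z w))%C.

(** The form is conjugate linear in both arguments, so it is symmetric rather than Hermitian;
    multiplying the argument by i therefore reverses its sign, as the polarization requires. *)
Lemma form_sym (n : nat) (f g : C -> C) : form n f g = form n g f.
Proof.
  unfold form.
  rewrite (cmean_ext n _ (fun w => cmean n (fun z => Cconj (g w) * (Cconj (f z) * L z w)))%C)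
    by (intros; now rewrite cmean_scal).
  rewrite cmean_swap. apply cmean_ext; intros z Hz. rewrite <- cmean_scal.
  apply cmean_ext; intros w Hw. rewrite (HLs z w) by (apply circle_cdisk; auto). ring.
Qed.

Lemma form_plus_l (n : nat) (f f' g : C -> C) :
  form n (fun z => f z + f' z)%C g = (form n f g + form n f' g)%C.
Proof.
  unfold form. rewrite <- cmean_plus. apply cmean_ext; intros w _.
  rewrite <- Cmult_plus_distr_l, <- cmean_plus. f_equal. apply cmean_ext; intros z _.
  rewrite Cplus_conj; ring.
Qed.

Lemma form_scal_l (n : nat) (c : C) (f g : C -> C) :
  form n (fun z => c * f z)%C g = (Cconj c * form n f g)%C.
Proof.
  unfold form. rewrite <- cmean_scal. apply cmean_ext; intros w _.
  transitivity (Cconj (g w) * (Cconj c * cmean n (fun z => Cconj (f z) * L z w)))%C; [|ring].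
  rewrite <- (cmean_scal n (Cconj c)). f_equal. apply cmean_ext; intros z _.
  rewrite Cmult_conj; ring.
Qed.

Lemma form_ext (n : nat) (f f' : C -> C) : (forall z, f z = f' z) -> form n f f = form n f' f'.
Proof.
  intros H. unfold form. apply cmean_ext; intros w _. rewrite H. f_equal.
  apply cmean_ext; intros z _. now rewrite H.
Qed.

Lemma form_polar (n : nat) (c : C) (f g : C -> C) :
  form n (fun z => f z + c * g z)%C (fun z => f z + c * g z)%C
  = (form n f f + 2 * Cconj c * form n f g + Cconj c * Cconj c * form n g g)%C.
Proof.
  rewrite form_plus_l, form_scal_l.
  rewrite (form_sym n f), (form_sym n g), !form_plus_l, !form_scal_l, (form_sym n g f). ring.
Qed.

(** Dropping the holomorphic half of the weight in z, then in w after exchanging the means, turns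
    the energy of ln |D|^2 = 2 Re L into twice the real part of the form. *)
Lemma form_upper (y1 y3 y5 y7 : C) (eps : R) : 0 < eps -> exists N, forall n, (N <= n)%nat ->
  Re (form n (odd_poly y1 y3 y5 y7) (odd_poly y1 y3 y5 y7)) <= weight 1 y1 y3 y5 y7 + eps.
Proof.
  intros He. set (pc := odd_poly y1 y3 y5 y7). set (X := odd_weight y1 y3 y5 y7).
  destruct (energy_upper phi D D1 Hphi HD Hn y1 y3 y5 y7 eps He) as [N1 HN1].
  assert (HS : csmall (fun n => cmean n (fun w => X w * cmean n (fun z => X z * L z w))
                                - form n pc pc)%C).
  { pose proof (reduce_half y1 y3 y5 y7 L L1 HL) as H1. fold pc in H1. fold X in H1.
    assert (H2 : csmall (fun n => cmean n (fun z => Cconj (pc z) * cmean n (fun w => pc w * L w z)))%C).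
    { apply (small_cmean (fun z => Cconj (pc z)) (Cmod y1 + Cmod y3 + Cmod y5 + Cmod y7)
               (fun n z => cmean n (fun w => pc w * L w z)%C)).
      - intros w Hw. rewrite Cmod_conj. now apply odd_poly_bound1.
      - intros e Hee. destruct (holomorphic_half y1 y3 y5 y7 _ _ HL e Hee) as [N HN].
        exists N; intros n Hn' w Hw. apply HN; auto. now apply circle_cdisk. }
    eapply (small_ext 0); [|exact (small_plus _ _ H1 H2)].
    intros n [] _ _. cbv beta.
    replace (cmean n (fun z => Cconj (pc z) * cmean n (fun w => pc w * L w z)))%C
      with (cmean n (fun w => X w * cmean n (fun z => Cconj (pc z) * L z w)) - form n pc pc)%C;
      [ring|].
    unfold form. rewrite <- cmean_minus.
    rewrite (cmean_ext n _ (fun w => cmean n (fun z => pc w * (Cconj (pc z) * L z w)))%C).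
    - rewrite cmean_swap. apply cmean_ext; intros z Hz. rewrite <- cmean_scal.
      apply cmean_ext; intros w Hw. rewrite (HLs z w) by (apply circle_cdisk; auto). ring.
    - intros w Hw. rewrite cmean_scal. unfold X; rewrite odd_weight_C. fold pc. ring. }
  destruct (HS (eps / 2) ltac:(lra)) as [N2 HN2].
  exists (N1 + N2)%nat. intros n Hn'.
  specialize (HN1 n ltac:(lia)). specialize (HN2 n ltac:(lia) tt Logic.I).
  rewrite (mean2_ext n _ (fun z w => 2 * (X z * X w * Re (L z w)))) in HN1.
  2:{ intros z w Hz Hw. rewrite <- HLe by (apply circle_cdisk; auto). unfold X; ring. }
  rewrite mean2_scal, mean2_Re in HN1. cbv beta in HN2.
  set (A := cmean n _) in HN2. fold A in HN1. set (F := form n pc pc) in *.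
  pose proof (re_le_Cmod (A - F)%C) as HR.
  replace (Re (A - F)%C) with (Re A - Re F) in HR by (unfold Re; simpl; ring).
  assert (HR' : Rabs (Re A - Re F) <= eps / 2) by lra.
  apply Rabs_le_between in HR'. lra.
Qed.

(* Polarization: form_upper is applied to z + g and to i (z - g), whose forms have opposite
   diagonal parts. *)
Lemma form_cross (y1 y3 y5 y7 : C) (eps : R) : 0 < eps -> exists N, forall n, (N <= n)%nat ->
  2 * Re (form n (fun z => z) (odd_poly y1 y3 y5 y7)) <= 1 + weight 1 y1 y3 y5 y7 + eps.
Proof.
  intros He.
  destruct (form_upper (1 + y1) y3 y5 y7 eps He) as [N1 HN1].
  destruct (form_upper (Ci * (1 - y1)) (- (Ci * y3)) (- (Ci * y5)) (- (Ci * y7)) eps He) as [N2 HN2].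
  exists (N1 + N2)%nat. intros n Hn'.
  specialize (HN1 n ltac:(lia)). specialize (HN2 n ltac:(lia)).
  set (f := odd_poly y1 y3 y5 y7). set (e := fun z : C => z).
  rewrite (form_ext n _ (fun z => e z + 1 * f z)%C) in HN1
    by (intros; unfold e, f, odd_poly; simpl; ring).
  rewrite (form_ext n _ (fun z => Ci * (e z + (-1) * f z))%C) in HN2
    by (intros; unfold e, f, odd_poly; simpl; ring).
  rewrite form_scal_l, form_sym, form_scal_l, form_polar in HN2. rewrite form_polar in HN1.
  assert (C1 : Cconj 1 = 1%C) by (unfold Cconj; simpl; now rewrite Ropp_0).
  assert (C2 : Cconj (-1) = (-1)%C) by (unfold Cconj; simpl; now rewrite Ropp_0).
  assert (C3 : (Cconj Ci * Cconj Ci)%C = (-1)%C)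
    by (apply injective_projections; simpl; ring).
  rewrite C1 in HN1. rewrite C2, Cmult_assoc, C3 in HN2.
  (* Parallelogram law; the constant 2 is the contribution of z itself to the two tests. *)
  assert (W : weight 1 (1 + y1) y3 y5 y7
              + weight 1 (Ci * (1 - y1)) (- (Ci * y3)) (- (Ci * y5)) (- (Ci * y7))
              = 2 + 2 * weight 1 y1 y3 y5 y7).
  { unfold weight. rewrite !Cmod_opp, !Cmod_mult, Cmod_Ci, !Rmult_1_l.
    assert (P : Cmod (1 + y1)%C ^ 2 + Cmod (1 - y1)%C ^ 2 = 2 + 2 * Cmod y1 ^ 2)
      by (rewrite !Cmod2_alt; unfold Re, Im; simpl; ring).
    rewrite !pow1. lra. }
  set (A := form n e e) in *. set (B := form n e f) in *. set (E := form n f f) in *.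
  replace (Re (A + 2 * 1 * B + 1 * 1 * E)%C) with (Re A + 2 * Re B + Re E) in HN1
    by (unfold Re; simpl; ring).
  replace (Re (-1 * (A + 2 * -1 * B + -1 * -1 * E))%C) with (- Re A + 2 * Re B - Re E) in HN2
    by (unfold Re; simpl; ring).
  change (2 * Re B <= 1 + weight 1 y1 y3 y5 y7 + eps). lra.
Qed.

(** The inner mean against conj z extracts the first Taylor coefficient of L in z, namely [L1 w 0];
    the outer mean then pairs its coefficients with the polynomial. *)
Lemma form_limit (y1 y3 y5 y7 c1 c3 c5 c7 : C) :
  csmall (fun n => cmean n (fun w => Cconj w ^ 1 * L1 w 0) - c1)%C ->
  csmall (fun n => cmean n (fun w => Cconj w ^ 3 * L1 w 0) - c3)%C ->
  csmall (fun n => cmean n (fun w => Cconj w ^ 5 * L1 w 0) - c5)%C ->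
  csmall (fun n => cmean n (fun w => Cconj w ^ 7 * L1 w 0) - c7)%C ->
  csmall (fun n => form n (fun z => z) (odd_poly y1 y3 y5 y7)
     - (Cconj y1 * c1 + Cconj y3 * c3 + Cconj y5 * c5 + Cconj y7 * c7))%C.
Proof.
  intros S1 S3 S5 S7. destruct HL as (M & HM & HM').
  pose proof cdisk_0 as Hd0.
  assert (HU : small circle (fun n w => cmean n (fun z => Cconj z * L z w) - L1 w 0)%C).
  (* Subtracting the first order Taylor polynomial at 0 leaves a kernel of order |z|^2, as
     [mean_vanish] with exponent 1 requires. *)
  { assert (H : UH cdisk 0 (fun w z => L z w - (L 0 w + L1 w 0 * z))%C
                  (fun w z => L1 w z - (0 + (0 * z + L1 w 0 * 1)))%C).
    { apply UH_minus; [exact HL|]. apply UH_plus.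
      - apply (UH_const (fun w => L 0%C w) M). intros w Hw; apply HM'; auto.
      - apply UH_mult; [|apply UH_id].
        apply (UH_const (fun w => L1 w 0%C) M). intros w Hw; apply HM'; auto. }
    intros eps He. destruct (mean_vanish _ _ _ 1 M H) with (eps := eps) as [N HN]; auto.
    - intros w z Hw Hz. destruct (HM' w 0%C Hw Hd0) as (_ & _ & H3).
      specialize (H3 z). rewrite !Cplus_0_l in H3. specialize (H3 Hz).
      replace (L z w - (L 0 w + L1 w 0 * z))%C with (L z w - L 0 w - z * L1 w 0)%C by ring.
      exact H3.
    - exists (N + 2)%nat; intros n Hn' w Hw. specialize (HN n ltac:(lia) w (circle_cdisk w Hw)).
      rewrite (cmean_ext n _ (fun z => Cconj z ^ 1 * L z w
         - (L 0 w * (Cconj z ^ 1 * z ^ 0) + L1 w 0 * (Cconj z ^ 1 * z ^ 1)))%C) in HN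
        by (intros; simpl; ring).
      rewrite cmean_minus, cmean_plus, !cmean_scal, cmean_orth_eq, cmean_orth_lt in HN by lia.
      rewrite (cmean_ext n _ (fun z => Cconj z ^ 1 * L z w)%C) by (intros; simpl; ring).
      set (A := cmean n _) in HN |- *.
      replace (A - L1 w 0)%C with (A - (L 0 w * 0 + L1 w 0 * 1))%C by ring. exact HN. }
  set (f := odd_poly y1 y3 y5 y7).
  pose proof (small_cmean (fun w => Cconj (f w)) (Cmod y1 + Cmod y3 + Cmod y5 + Cmod y7) _
    (fun w Hw => Rle_trans _ _ _ (Req_le _ _ (Cmod_conj _)) (odd_poly_bound1 y1 y3 y5 y7 w Hw)) HU) as H1.
  eapply (small_ext 0); [|exact (small_plus _ _ H1 (small_plus _ _ (small_plus _ _ (small_plus _ _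
     (small_scal (Cconj y1) _ S1) (small_scal (Cconj y3) _ S3)) (small_scal (Cconj y5) _ S5))
     (small_scal (Cconj y7) _ S7)))].
  intros n [] _ _. cbv beta.
  rewrite (cmean_ext n (fun w => Cconj (f w) * (cmean n (fun z => Cconj z * L z w) - L1 w 0))%C
    (fun w => Cconj (f w) * cmean n (fun z => Cconj z * L z w) - Cconj (f w) * L1 w 0)%C)
    by (intros; ring).
  rewrite cmean_minus. unfold f at 2. rewrite cmean_odd_poly_conj. unfold form. fold f. ring.
Qed.
End Form.

(** Testing with y_k = k c_k makes the limit of the form and the weight both equal to the left side
    S, and [form_cross] becomes 2 S <= 1 + S. *)
Theorem area_theorem (phi : C -> C) (D D1 : C -> C -> C) (c1 c3 c5 c7 : C) :
  dclass phi D -> UH cdisk 0 (fun w z => D z w) D1 ->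
  (forall z w, cdisk z -> cdisk w -> D z w <> 0%C) ->
  csmall (fun n => cmean n (fun w => Cconj w ^ 1 * (D1 w 0 / D 0 w)) - c1)%C ->
  csmall (fun n => cmean n (fun w => Cconj w ^ 3 * (D1 w 0 / D 0 w)) - c3)%C ->
  csmall (fun n => cmean n (fun w => Cconj w ^ 5 * (D1 w 0 / D 0 w)) - c5)%C ->
  csmall (fun n => cmean n (fun w => Cconj w ^ 7 * (D1 w 0 / D 0 w)) - c7)%C ->
  Cmod c1 ^ 2 + 3 * Cmod c3 ^ 2 + 5 * Cmod c5 ^ 2 + 7 * Cmod c7 ^ 2 <= 1.
Proof.
  intros Hphi HD Hn S1 S3 S5 S7.
  destruct (log_exists phi D D1 Hphi HD Hn) as (L & L1 & HL & HLp).
  pose proof cdisk_0 as Hd0.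
  assert (HE : forall k c, csmall (fun n => cmean n (fun w => Cconj w ^ k * (D1 w 0 / D 0 w)) - c)%C ->
                 csmall (fun n => cmean n (fun w => Cconj w ^ k * L1 w 0) - c)%C).
  { intros k c. apply (small_ext 0). intros n [] _ _. f_equal. apply cmean_ext; intros w Hw.
    pose proof (circle_cdisk w Hw) as Dw. destruct (HLp 0%C w Hd0 Dw) as (_ & _ & E).
    rewrite <- E. field. auto. }
  set (y3 := (3 * c3)%C). set (y5 := (5 * c5)%C). set (y7 := (7 * c7)%C).
  pose proof (form_limit L L1 HL c1 y3 y5 y7 c1 c3 c5 c7 (HE _ _ S1) (HE _ _ S3) (HE _ _ S5)
    (HE _ _ S7)) as HF.
  set (S := Cmod c1 ^ 2 + 3 * Cmod c3 ^ 2 + 5 * Cmod c5 ^ 2 + 7 * Cmod c7 ^ 2).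
  assert (HW : weight 1 c1 y3 y5 y7 = S).
  { unfold weight, y3, y5, y7, S. rewrite !Cmod_mult, !Cmod_R, !Rabs_pos_eq by lra. field. }
  assert (HS : (Cconj c1 * c1 + Cconj y3 * c3 + Cconj y5 * c5 + Cconj y7 * c7)%C = RtoC S).
  { unfold S, y3, y5, y7. rewrite !RtoC_plus, !RtoC_mult, !Cmod2_conj, !Cmult_conj.
    assert (Cr : forall r : R, Cconj r = RtoC r)
      by (intros r; unfold Cconj, RtoC; simpl; now rewrite Ropp_0).
    rewrite !Cr. ring. }
  rewrite HS in HF.
  (* The two approximations give 2 (S - eps) <= 1 + S + eps, that is S - 1 <= 3 eps, which this eps
     contradicts. *)
  apply Rnot_lt_le; intros Hlt. set (eps := (S - 1) / 4).
  assert (He : 0 < eps) by (unfold eps; lra).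
  destruct (form_cross phi D D1 Hphi HD Hn L L1 HL (fun z w Hz Hw => proj1 (HLp z w Hz Hw))
    (fun z w Hz Hw => proj1 (proj2 (HLp z w Hz Hw))) c1 y3 y5 y7 eps He) as [N1 HN1].
  destruct (HF eps He) as [N2 HN2].
  specialize (HN1 (N1 + N2)%nat ltac:(lia)). specialize (HN2 (N1 + N2)%nat ltac:(lia) tt Logic.I).
  rewrite HW in HN1. cbv beta in HN2. set (F := form _ _ _ _) in *.
  pose proof (re_le_Cmod (F - RtoC S)%C) as HR.
  replace (Re (F - RtoC S)%C) with (Re F - S) in HR by (unfold Re; simpl; ring).
  assert (HR' : Rabs (Re F - S) <= eps) by lra.
  apply Rabs_le_between in HR'. unfold eps in *. lra.
Qed.

(** * Coefficients of univalent functions *)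

(** Balls of the uniform structure on C are products of intervals, so both projections are
    continuous. *)
Lemma is_series_C (u : nat -> C) (l : C) :
  @is_series C_AbsRing C_NormedModule u l ->
  is_series (fun n => Re (u n)) (Re l) /\ is_series (fun n => Im (u n)) (Im l).
Proof.
  intros H.
  assert (E : forall N, Re (@sum_n C_AbelianMonoid u N) = sum_n (fun n => Re (u n)) N /\
              Im (@sum_n C_AbelianMonoid u N) = sum_n (fun n => Im (u n)) N).
  { induction N as [|N [I1 I2]].
    - rewrite !sum_O; auto.
    - rewrite !sum_Sn, <- I1, <- I2. split; reflexivity. }
  split.
  - apply (filterlim_ext (fun N => Re (@sum_n C_AbelianMonoid u N))); [intros; apply E|].
    eapply filterlim_comp; [exact H|].
    intros P [e He]; exists e; intros y Hy; apply He, Hy.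
  - apply (filterlim_ext (fun N => Im (@sum_n C_AbelianMonoid u N))); [intros; apply E|].
    eapply filterlim_comp; [exact H|].
    intros P [e He]; exists e; intros y Hy; apply He, Hy.
Qed.

(** Besides the value, convergence at one point bounds the terms there; this plays the part of
    Cauchy's estimates for smaller radii. *)
Lemma is_pseries_C (a : nat -> C) (z l : C) :
  @is_pseries C_AbsRing C_NormedModule a z l ->
  csum (fun n => a n * z ^ n)%C = l /\ exists M, forall n, Cmod (a n * z ^ n)%C <= M.
Proof.
  intros H. unfold is_pseries in H.
  assert (E : forall n, scal (pow_n (K := C_AbsRing) z n) (a n) = (a n * z ^ n)%C).
  { intros n. change (pow_n (K := C_AbsRing) z n * a n = a n * z ^ n)%C.
    replace (pow_n (K := C_AbsRing) z n) with (z ^ n)%C; [ring|].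
    induction n as [|n IH]; [reflexivity|]. simpl Cpow. rewrite IH. reflexivity. }
  apply (is_series_ext _ _ _ E) in H. apply is_series_C in H. destruct H as [HR HI]. split.
  - unfold csum. rewrite (is_series_unique _ _ HR), (is_series_unique _ _ HI). now destruct l.
  - assert (B : forall v : nat -> R, ex_series v -> exists M, forall n, Rabs (v n) <= M).
    { intros v Hv. pose proof (ex_series_lim_0 v Hv) as Hl.
      destruct (filterlim_bounded v) as [M HM]; [exists 0; exact Hl|]. exists M; exact HM. }
    destruct (B _ (ex_intro _ _ HR)) as [M1 H1]. destruct (B _ (ex_intro _ _ HI)) as [M2 H2].
    exists (M1 + M2); intros n. eapply Rle_trans; [apply Cmod_le_Re_Im|].
    apply Rplus_le_compat; [apply H1|apply H2].
Qed.

(** Two expansions of the same function differ by O(t^2) at real points t > 0. It serves to compute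
    derivatives known only to exist. *)
Lemma UH_deriv_unique {I : Type} (P : I -> Prop) (K K1 K2 : I -> C -> C) (i : I) :
  UH P 0 K K1 -> UH P 0 K K2 -> P i -> K1 i 0%C = K2 i 0%C.
Proof.
  intros (M & HM & H1) (N & HN & H2) Hi.
  pose proof cdisk_0 as Hd0.
  destruct (H1 i 0%C Hi Hd0) as (_ & _ & A). destruct (H2 i 0%C Hi Hd0) as (_ & _ & B).
  set (x := Cmod (K1 i 0 - K2 i 0)%C).
  assert (Hx : forall t, 0 < t <= 1 -> x <= (M + N) * t).
  { intros t Ht.
    assert (Ht' : cdisk (0 + RtoC t)%C)
      by (apply cdisk_intro; rewrite Cplus_0_l, Cmod_R, Rabs_pos_eq; lra).
    specialize (A t Ht'). specialize (B t Ht'). rewrite Cmod_R, Rabs_pos_eq in A, B by lra.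
    apply (Rmult_le_reg_l t); [lra|]. unfold x.
    rewrite <- (Rabs_pos_eq t) at 1 by lra. rewrite <- Cmod_R, <- Cmod_mult.
    replace (t * (K1 i 0 - K2 i 0))%C
      with ((K i (0 + t) - K i 0 - t * K2 i 0) - (K i (0 + t) - K i 0 - t * K1 i 0))%C by ring.
    eapply Rle_trans; [apply Cmod_sub_le; eassumption|]. apply Req_le; ring. }
  assert (Hx0 : x <= 0).
  { apply Rnot_lt_le; intros Hlt.
    set (t := Rmin 1 (x / 2 / (M + N + 1))).
    assert (Ht : 0 < t) by (apply Rmin_pos; [lra|apply Rdiv_lt_0_compat; lra]).
    specialize (Hx t (conj Ht (Rmin_l _ _))).
    assert (t <= x / 2 / (M + N + 1)) by apply Rmin_r.
    assert ((M + N + 1) * t <= x / 2).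
    { apply Rle_trans with ((M + N + 1) * (x / 2 / (M + N + 1)));
        [apply Rmult_le_compat_l; lra|apply Req_le; field; lra]. }
    lra. }
  assert (E : (K1 i 0 - K2 i 0)%C = 0%C)
    by (apply Cmod_eq_0; fold x; pose proof (Cmod_ge_0 (K1 i 0 - K2 i 0)%C); fold x in H; lra).
  replace (K1 i 0%C) with ((K1 i 0 - K2 i 0) + K2 i 0)%C by ring. rewrite E; ring.
Qed.

(** Passage to t = 1 through Bernoulli's inequality t^n >= 1 - n (1 - t); it removes the
    dilations. *)
Lemma pow_limit (A c : R) (n : nat) : (forall t, 0 < t < 1 -> t ^ n * A <= c) -> A <= c.
Proof.
  intros H. apply Rnot_lt_le; intros Hlt.
  assert (Bern : forall k t, 0 <= t <= 1 -> 1 - INR k * (1 - t) <= t ^ k).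
  { induction k as [|k IH]; intros t Ht; [simpl; lra|]. rewrite S_INR. simpl.
    specialize (IH t Ht). pose proof (pos_INR k).
    assert (t * (1 - INR k * (1 - t)) <= t * t ^ k) by (apply Rmult_le_compat_l; lra).
    assert (0 <= INR k * ((1 - t) * (1 - t))) by (apply Rmult_le_pos; [auto|nra]). nra. }
  destruct (Rle_or_lt A 0) as [HA|HA].
  - specialize (H (1 / 2) ltac:(lra)).
    assert (Hp : (1 / 2) ^ n <= 1 ^ n) by (apply pow_incr; lra). rewrite pow1 in Hp.
    assert (0 <= (1 / 2) ^ n) by (apply pow_le; lra). nra.
  - pose proof (pos_INR n).
    set (d := Rmin (1 / 2) ((A - c) / 2 / (INR n * A + 1))).
    assert (Hd0 : 0 < INR n * A + 1) by nra.
    assert (Hd : 0 < d) by (apply Rmin_pos; [lra|apply Rdiv_lt_0_compat; lra]).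
    assert (Hd1 : d <= 1 / 2) by apply Rmin_l.
    assert (Hd2 : d * (INR n * A + 1) <= (A - c) / 2).
    { apply Rle_trans with ((A - c) / 2 / (INR n * A + 1) * (INR n * A + 1));
        [apply Rmult_le_compat_r; [lra|apply Rmin_r]|apply Req_le; field; lra]. }
    specialize (H (1 - d) ltac:(lra)). specialize (Bern n (1 - d) ltac:(lra)). nra.
Qed.

(** Put s = x^2 + 3 y^2 and q = 1 / sqrt 7. Then u <= q sqrt (1 - s) <= q (1 - s / 2), while y^2 / 2
    + x^4 / 12 <= s / 6 because x <= 1; the loss q s / 2 covers this gain since q >= 1 / 3. Equality
    holds at x = y = 0, u = q. *)
Lemma moduli_inequality (x y u : R) : 0 <= x -> 0 <= y -> 0 <= u ->
  x ^ 2 + 3 * y ^ 2 + 7 * u ^ 2 <= 1 -> u + y ^ 2 / 2 + x ^ 4 / 12 <= 1 / sqrt 7.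
Proof.
  intros Hx Hy Hu H.
  assert (H7 : sqrt 7 * sqrt 7 = 7) by (apply sqrt_sqrt; lra).
  assert (H70 : 0 < sqrt 7) by (apply sqrt_lt_R0; lra).
  set (q := 1 / sqrt 7).
  assert (Hq : q * q = 1 / 7).
  { unfold q. replace (1 / sqrt 7 * (1 / sqrt 7)) with (1 / (sqrt 7 * sqrt 7)) by (field; lra).
    now rewrite H7. }
  assert (Hq0 : 0 < q) by (apply Rdiv_lt_0_compat; lra).
  assert (Hq3 : 1 / 3 <= q) by nra.
  set (s := x ^ 2 + 3 * y ^ 2) in *.
  assert (Hs : 0 <= s <= 1) by (unfold s in *; simpl in *; split; nra).
  assert (Hx4 : x ^ 4 <= x ^ 2).
  { replace (x ^ 4) with (x ^ 2 * x ^ 2) by ring.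
    assert (0 <= x ^ 2 <= 1) by (unfold s in *; pose proof (pow2_ge_0 y); pose proof (pow2_ge_0 x); lra).
    nra. }
  assert (Hu2 : u <= q * (1 - s / 2)).
  { apply Rnot_lt_le; intros Hlt.
    assert (0 <= q * (1 - s / 2)) by (apply Rmult_le_pos; lra).
    assert ((q * (1 - s / 2)) * (q * (1 - s / 2)) < u * u) by (apply Rmult_le_0_lt_compat; auto).
    replace (q * (1 - s / 2) * (q * (1 - s / 2))) with (q * q * ((1 - s / 2) * (1 - s / 2))) in H1 by ring.
    rewrite Hq in H1. pose proof (pow2_ge_0 s). replace (u * u) with (u ^ 2) in H1 by ring. nra. }
  assert (y ^ 2 / 2 + x ^ 4 / 12 <= s / 6) by (unfold s; pose proof (pow2_ge_0 x); lra).
  assert (1 / 3 * (s / 2) <= q * (s / 2)) by (apply Rmult_le_compat_r; lra).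
  lra.
Qed.

(** * Taylor coefficients of the inverse square root *)

Definition inv_sqrt_poly_coef (w1 w3 w5 w7 : C) (n : nat) : C :=
  match n with
  | 0%nat => 1%C | 1%nat => (- w1)%C | 2%nat => (- w3)%C | 3%nat => (- w5)%C | _ => (- w7)%C
  end.

(* The relations expressing b_0 + b_1 v + ... = (1 - w1 v - w3 v^2 - w5 v^3 - w7 v^4)^-2 up to
   order 4. *)
Definition inv_sqrt_coefs (b : nat -> C) (w1 w3 w5 w7 : C) : Prop :=
  b 0%nat = 1%C /\ b 1%nat = (2 * w1)%C /\ b 2%nat = (2 * w3 + 3 * (w1 * w1))%C /\
  b 3%nat = (2 * w5 + 6 * (w1 * w3) + 4 * (w1 * w1 * w1))%C /\
  b 4%nat = (2 * w7 + 6 * (w1 * w5) + 3 * (w3 * w3) + 12 * (w1 * w1 * w3)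
             + 5 * (w1 * w1 * w1 * w1))%C.

Lemma poly_bounded (m : nat) (b : nat -> C) : exists M, 0 <= M /\
  (forall z, cdisk z -> Cmod (psum b m z) <= M) /\
  forall z, cdisk z -> Cmod (psum b m z - psum b m 0)%C <= M * Cmod z.
Proof.
  destruct (UH_psum (fun _ : unit => True) 0 _ _ m b UH_id) as [K HK].
  destruct (UH_bounds _ _ _ _ HK) as (M & HM & HB & HL).
  pose proof cdisk_0 as Hd0.
  exists M; repeat split; auto.
  - intros z Hz; apply (HB tt z); auto.
  - intros z Hz. replace (Cmod z) with (Cmod (z - 0)%C) by (f_equal; ring).
    apply (HL tt 0%C z); auto.
Qed.

Lemma inv_sqrt_poly (b : nat -> C) (w1 w3 w5 w7 : C) : inv_sqrt_coefs b w1 w3 w5 w7 ->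
  exists g, forall v, (psum (inv_sqrt_poly_coef w1 w3 w5 w7) 5 v * psum (inv_sqrt_poly_coef w1 w3 w5 w7) 5 v * psum b 5 v - 1)%C
    = (v ^ 5 * psum g 8 v)%C.
Proof.
  intros (H0 & H1 & H2 & H3 & H4).
  (* The product has degree 12 and equals 1 up to order 4, so the quotient by v^5 has the eight
     coefficients of orders 5 to 12, written out here. *)
  exists (fun n => let b1 := b 1%nat in let b2 := b 2%nat in let b3 := b 3%nat in
    let b4 := b 4%nat in match n with
  | 0%nat => - 2 * w1 * b4 - 2 * w3 * b3 - 2 * w5 * b2 - 2 * w7 * b1 + w1 * w1 * b3
      + 2 * w1 * w3 * b2 + 2 * w1 * w5 * b1 + 2 * w1 * w7 + w3 * w3 * b1 + 2 * w3 * w5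
  | 1%nat => - 2 * w3 * b4 - 2 * w5 * b3 - 2 * w7 * b2 + w1 * w1 * b4 + 2 * w1 * w3 * b3
      + 2 * w1 * w5 * b2 + 2 * w1 * w7 * b1 + w3 * w3 * b2 + 2 * w3 * w5 * b1 + 2 * w3 * w7
      + w5 * w5
  | 2%nat => - 2 * w5 * b4 - 2 * w7 * b3 + 2 * w1 * w3 * b4 + 2 * w1 * w5 * b3 + 2 * w1 * w7 * b2
      + w3 * w3 * b3 + 2 * w3 * w5 * b2 + 2 * w3 * w7 * b1 + w5 * w5 * b1 + 2 * w5 * w7
  | 3%nat => - 2 * w7 * b4 + 2 * w1 * w5 * b4 + 2 * w1 * w7 * b3 + w3 * w3 * b4 + 2 * w3 * w5 * b3
      + 2 * w3 * w7 * b2 + w5 * w5 * b2 + 2 * w5 * w7 * b1 + w7 * w7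
  | 4%nat => 2 * w1 * w7 * b4 + 2 * w3 * w5 * b4 + 2 * w3 * w7 * b3 + w5 * w5 * b3
      + 2 * w5 * w7 * b2 + w7 * w7 * b1
  | 5%nat => 2 * w3 * w7 * b4 + w5 * w5 * b4 + 2 * w5 * w7 * b3 + w7 * w7 * b2
  | 6%nat => 2 * w5 * w7 * b4 + w7 * w7 * b3
  | _ => w7 * w7 * b4 end%C).
  intros v. unfold inv_sqrt_poly_coef; cbn [psum]. rewrite H0.
  revert H1 H2 H3 H4. generalize (b 1%nat), (b 2%nat), (b 3%nat), (b 4%nat).
  intros b1 b2 b3 b4 -> -> -> ->. cbv zeta. cbn [Cpow]. ring.
Qed.

(** Both 1 / h and the polynomial are square roots of 1 / F up to O(v^5). Their difference times
    their sum is thus O(v^5), and near 0 the sum is close to 2, as both take the value 1 there. *)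
Lemma inv_sqrt_taylor (b : nat -> C) (w1 w3 w5 w7 : C) (F h : C -> C) (E : C -> C -> C) (BF : R) :
  inv_sqrt_coefs b w1 w3 w5 w7 ->
  (forall v, cdisk v -> Cmod (F v - psum b 5 v)%C <= BF * Cmod v ^ 5) ->
  dclass h E -> h 0%C = 1%C -> (forall v, cdisk v -> (h v * h v)%C = F v) ->
  (forall v, cdisk v -> h v <> 0%C) ->
  exists B, forall v, cdisk v -> Cmod (/ h v - psum (inv_sqrt_poly_coef w1 w3 w5 w7) 5 v)%C <= B * Cmod v ^ 5.
Proof.
  intros Hb HF Hh Hh0 Hsq Hne.
  destruct (inv_sqrt_poly b w1 w3 w5 w7 Hb) as [g Hg].
  destruct (poly_bounded 5 (inv_sqrt_poly_coef w1 w3 w5 w7)) as (Mb & HMb & Hb1 & Hb2).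
  destruct (poly_bounded 8 g) as (Mg & HMg & Hg1 & _).
  set (be := psum (inv_sqrt_poly_coef w1 w3 w5 w7) 5) in *.
  destruct (dclass_bounded _ _ (dclass_inv _ _ Hh Hne)) as (Mk & HMk & Hk1 & Hk2).
  pose proof cdisk_0 as Hd0.
  set (A := Mg + Mb * Mb * Rabs BF).
  assert (HA : 0 <= A) by (unfold A; pose proof (Rabs_pos BF); nra).
  assert (Hmain : forall v, cdisk v ->
     Cmod ((/ h v - be v) * (/ h v + be v))%C <= Mk * Mk * A * Cmod v ^ 5).
  { intros v Hv. specialize (Hne v Hv).
    replace ((/ h v - be v) * (/ h v + be v))%C
      with (/ h v * / h v * (- (be v * be v * psum b 5 v - 1) - be v * be v * (h v * h v - psum b 5 v)))%C
      by (field; auto).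
    rewrite Hg, (Hsq v Hv), Rmult_assoc.
    apply Cmod_mul_le; [apply Cmod_mul_le; auto|].
    unfold A. rewrite Rmult_plus_distr_r. apply Cmod_sub_le.
    - rewrite Cmod_opp, Rmult_comm, <- Cmod_pow. apply Cmod_mul_le; [lra|auto].
    - rewrite Rmult_assoc. apply Cmod_mul_le; [apply Cmod_mul_le; auto|].
      eapply Rle_trans; [apply HF; auto|]. apply Rmult_le_compat_r; [|apply Rle_abs].
      apply pow_le, Cmod_ge_0. }
  (* Up to modulus [v0] the sum of the two roots stays at least 1; beyond it the trivial bound
     [Mk + Mb] is absorbed by dividing by [v0 ^ 5]. *)
  set (v0 := / (Mk + Mb + 1)).
  assert (Hv0 : 0 < v0) by (apply Rinv_0_lt_compat; lra).
  assert (HE : (Mk + Mb + 1) * v0 = 1) by (unfold v0; field; lra).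
  exists (Mk * Mk * A + (Mk + Mb) * / v0 ^ 5). intros v Hv.
  pose proof (Cmod_ge_0 v) as Hvp.
  assert (Hv5 : 0 <= Cmod v ^ 5) by (apply pow_le; auto).
  assert (H5 : 0 < v0 ^ 5) by (apply pow_lt; auto).
  rewrite Rmult_plus_distr_r.
  destruct (Rle_or_lt (Cmod v) v0) as [Hs|Hl].
  - assert (Hsum : 1 <= Cmod (/ h v + be v)%C).
    { specialize (Hk2 0%C v Hd0 Hv). specialize (Hb2 v Hv). cbv beta in Hk2. rewrite Hh0 in Hk2.
      replace (v - 0)%C with v in Hk2 by ring.
      assert (Hbe0 : be 0%C = 1%C) by (unfold be, inv_sqrt_poly_coef; cbn [psum]; ring).
      rewrite Hbe0 in Hb2.
      pose proof (Cmod_sub_ge 2 (2 - (/ h v + be v))%C) as Hge.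
      replace (2 - (2 - (/ h v + be v)))%C with (/ h v + be v)%C in Hge by ring.
      rewrite Cmod_R, Rabs_pos_eq in Hge by lra.
      assert (Cmod (2 - (/ h v + be v))%C <= Mk * Cmod v + Mb * Cmod v).
      { replace (2 - (/ h v + be v))%C with (- (/ h v - / 1) + - (be v - 1))%C by (field; auto).
        apply Cmod_add_le; rewrite Cmod_opp; auto. }
      assert ((Mk + Mb) * Cmod v <= (Mk + Mb) * v0) by (apply Rmult_le_compat_l; lra).
      lra. }
    specialize (Hmain v Hv). rewrite Cmod_mult in Hmain.
    pose proof (Cmod_ge_0 (/ h v - be v)%C).
    assert (Cmod (/ h v - be v)%C <= Mk * Mk * A * Cmod v ^ 5) by nra.
    assert (0 <= (Mk + Mb) * / v0 ^ 5 * Cmod v ^ 5).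
    { apply Rmult_le_pos; auto. apply Rmult_le_pos; [lra|left; apply Rinv_0_lt_compat; auto]. }
    lra.
  - assert (0 <= Mk * Mk * A * Cmod v ^ 5)
      by (apply Rmult_le_pos; [apply Rmult_le_pos; [apply Rmult_le_pos|]|]; auto).
    assert (Cmod (/ h v - be v)%C <= Mk + Mb) by (apply Cmod_sub_le; auto).
    assert (v0 ^ 5 <= Cmod v ^ 5) by (apply pow_incr; lra).
    assert (1 <= / v0 ^ 5 * Cmod v ^ 5).
    { rewrite <- (Rinv_l (v0 ^ 5)) by lra.
      apply Rmult_le_compat_l; [left; apply Rinv_0_lt_compat; auto|auto]. }
    assert ((Mk + Mb) * 1 <= (Mk + Mb) * (/ v0 ^ 5 * Cmod v ^ 5)) by (apply Rmult_le_compat_l; lra).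
    lra.
Qed.

(** * The odd square root transform *)

Section OddRoot.
Variables (h : C -> C) (E : C -> C -> C) (w1 w3 w5 w7 : C) (B : R).
Hypothesis Hh : dclass h E.
Hypothesis Hh0 : h 0%C = 1%C.
Hypothesis Hne : forall v, cdisk v -> h v <> 0%C.
Hypothesis Hinj : forall z w, cdisk z -> cdisk w ->
  (z * h (z * z))%C = (w * h (w * w))%C -> z = w.
Hypothesis HT : forall v, cdisk v ->
  Cmod (/ h v - psum (inv_sqrt_poly_coef w1 w3 w5 w7) 5 v)%C <= B * Cmod v ^ 5.

(** The area inequality is applied to phi(s z) with phi z = z h(z^2): the dilation moves the closed
    disk into the open one, where the divided difference has no zeros. *)
Lemma odd_root_area (s : R) : 0 < s < 1 ->
  Cmod (s ^ 2 * w1)%C ^ 2 + 3 * Cmod (s ^ 4 * w3)%C ^ 2 + 5 * Cmod (s ^ 6 * w5)%C ^ 2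
  + 7 * Cmod (s ^ 8 * w7)%C ^ 2 <= 1.
Proof.
  intros Hs. assert (Hs' : 0 <= s <= 1) by lra.
  pose proof cdisk_0 as Hd0.
  pose proof (dclass_mult _ _ _ _ dclass_id (dclass_comp _ _ _ _ Hh
    (dclass_mult _ _ _ _ dclass_id dclass_id) (fun z Hz => cdisk_mult z z Hz Hz))) as Hphi.
  cbv beta in Hphi.
  set (phi := fun z => (z * h (z * z))%C) in Hphi.
  set (D := fun z w : C => (1 * h (z * z) + w * (E (z * z) (w * w) * (1 * z + w * 1)))%C).
  change (dclass phi D) in Hphi.
  assert (HDne : forall z w, Cmod z < 1 -> Cmod w < 1 -> D z w <> 0%C)
    by (apply (injective_nonvanishing phi D Hphi Hinj)).
  pose proof (dclass_comp _ _ _ _ Hphi (dclass_scal_arg s Hs') (fun z => cdisk_scal s z Hs')) as Hps.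
  cbv beta in Hps.
  set (phis := fun z : C => phi (s * z)%C) in Hps.
  set (Ds := fun z w : C => (D (s * z) (s * w) * s)%C).
  change (dclass phis Ds) in Hps.
  assert (Hs0 : RtoC s <> 0%C) by (intros E0; apply RtoC_inj in E0; lra).
  assert (Hin : forall z, cdisk z -> Cmod (s * z)%C < 1).
  { intros z [H1 H2]. rewrite Cmod_mult, Cmod_R, Rabs_pos_eq by lra. nra. }
  assert (HDs : forall z w, cdisk z -> cdisk w -> Ds z w <> 0%C).
  { intros z w Hz Hw. apply Cmult_neq_0; auto. }
  destruct (proj2 Hps) as [D1 HD1].
  (* Differentiating (z - w) D(z, w) = phi z - phi w at z = 0, with phi and D dilated, gives D(0, w)
     - w D1 = s, and D(0, w) = s h(s^2 w^2). As [D1] is only known to exist, uniqueness of the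
     expansion at 0 supplies this. *)
  assert (Hk : forall w, Cmod w = 1 ->
    (D1 w 0 / Ds 0 w)%C = (Cconj w * (1 - / h (RtoC (s ^ 2) * (w * w))))%C).
  { intros w Hw. pose proof (circle_cdisk w Hw) as Dw.
    assert (Hw0 : w <> 0%C) by (apply Cmod_gt_0; lra).
    pose proof (UH_mult _ _ _ _ HD1 (UH_minus _ _ _ _ UH_id
      (UH_const (fun w => w) 1 (fun w (H : cdisk w) => proj2 H)))) as U1.
    pose proof (UH_minus _ _ _ _ (dclass_UH cdisk _ _ Hps) (dclass_UH_second _ _ Hps)) as U2.
    cbv beta in U1, U2.
    assert (U3 := UH_ext _ _ (fun w z => phis z - phis w)%C _
      (fun i z Hi Hz => eq_trans (Cmult_comm _ _) (eq_sym (proj1 Hps z i Hz Hi)))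
      (fun i z Hi Hz => eq_refl) U1).
    pose proof (UH_deriv_unique _ _ _ _ w U3 U2 Dw) as U. cbv beta in U.
    assert (V0 : Ds 0%C 0%C = RtoC s).
    { unfold Ds, D. rewrite !Cmult_0_r, !Cmult_0_l, Hh0. ring. }
    rewrite V0 in U.
    assert (V1 : Ds 0%C w = (s * h (RtoC (s ^ 2) * (w * w)))%C).
    { pose proof (proj1 Hps w 0%C Dw Hd0) as G.
      rewrite (dclass_sym phis Ds 0 w) by auto.
      replace (Ds w 0%C) with (/ w * ((w - 0) * Ds w 0))%C by (field; auto).
      rewrite <- G. unfold phis, phi. rewrite RtoC_pow. simpl Cpow.
      replace (s * (s * 1) * (w * w))%C with (s * w * (s * w))%C by ring. field; auto. }
    set (hw := h (RtoC (s ^ 2) * (w * w))%C) in *.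
    assert (Hhw : hw <> 0%C).
    { apply Hne. apply cdisk_scal; [split; [apply pow_le; lra|rewrite <- (pow1 2); apply pow_incr; lra]|].
      apply cdisk_mult; auto. }
    assert (Hd1 : D1 w 0%C = ((s * hw - s) / w)%C).
    { rewrite <- V1. replace (RtoC s) with (RtoC s - 0)%C at 1 by ring. rewrite <- U. field; auto. }
    assert (Hcw : Cconj w = (/ w)%C).
    { replace (Cconj w) with (Cconj w * w * / w)%C by (field; auto). rewrite conj_unit by auto. ring. }
    rewrite Hd1, V1, Hcw. field. auto. }
  assert (Hs2 : 0 <= s ^ 2 <= 1)
    by (split; [apply pow_le; lra|rewrite <- (pow1 2); apply pow_incr; lra]).
  set (c1 := (s ^ 2 * w1)%C). set (c3 := (s ^ 4 * w3)%C).
  set (c5 := (s ^ 6 * w5)%C). set (c7 := (s ^ 8 * w7)%C).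
  (* What is left after the terms carrying w1, w3, w5, w7 is O(|z|^10), small enough for every
     frequency tested. *)
  set (rem := fun z : C => (1 - / h (RtoC (s ^ 2) * (z * z))
                 - (c1 * z ^ 2 + c3 * z ^ 4 + c5 * z ^ 6 + c7 * z ^ 8))%C).
  assert (Hv : forall z, cdisk z -> cdisk (RtoC (s ^ 2) * (z * z))%C)
    by (intros; apply cdisk_scal; auto; apply cdisk_mult; auto).
  assert (Hrem : forall z, cdisk z -> Cmod (rem z) <= Rabs B * Cmod z ^ 10).
  { intros z Hz. specialize (HT _ (Hv z Hz)).
    replace (rem z) with (- (/ h (RtoC (s ^ 2) * (z * z))
       - psum (inv_sqrt_poly_coef w1 w3 w5 w7) 5 (RtoC (s ^ 2) * (z * z))))%C.
    - rewrite Cmod_opp. eapply Rle_trans; [exact HT|].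
      apply Rle_trans with (Rabs B * Cmod (RtoC (s ^ 2) * (z * z))%C ^ 5);
        [apply Rmult_le_compat_r; [apply pow_le, Cmod_ge_0|apply Rle_abs]|].
      apply Rmult_le_compat_l; [apply Rabs_pos|].
      replace (Cmod z ^ 10) with ((1 * (Cmod z * Cmod z)) ^ 5) by ring.
      apply pow_incr; split; [apply Cmod_ge_0|].
      apply Cmod_mul_le; [rewrite Cmod_R, Rabs_pos_eq; lra|rewrite Cmod_mult; lra].
    - unfold rem, c1, c3, c5, c7, inv_sqrt_poly_coef; cbn [psum]. rewrite RtoC_pow. ring. }
  assert (Hremd : exists K, UH (fun _ : unit => True) 0 (fun _ z => rem z) K).
  { pose proof (dclass_inv _ _ (dclass_comp _ _ _ _ Hh (dclass_mult _ _ _ _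
      (dclass_const (RtoC (s ^ 2))) (dclass_mult _ _ _ _ dclass_id dclass_id)) Hv)
      (fun z Hz => Hne _ (Hv z Hz))) as K1.
    pose proof (dclass_UH (fun _ : unit => True) _ _ K1) as U1. cbv beta in U1.
    assert (U2 : forall k (c : C), exists K, UH (fun _ : unit => True) 0 (fun _ z => c * z ^ k)%C K).
    { intros k c. destruct (@UH_pow unit (fun _ => True) 0 _ _ k UH_id) as [K HK].
      eexists. exact (UH_scal c _ _ HK). }
    destruct (U2 2%nat c1) as [A2 V2]. destruct (U2 4%nat c3) as [A4 V4].
    destruct (U2 6%nat c5) as [A6 V6]. destruct (U2 8%nat c7) as [A8 V8].
    eexists. refine (UH_minus _ _ _ _ (UH_minus _ _ _ _ (UH_const (fun _ => RtoC 1) 1 _) U1)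
      (UH_plus _ _ _ _ (UH_plus _ _ _ _ (UH_plus _ _ _ _ V2 V4) V6) V8)).
    intros; rewrite Cmod_1; lra. }
  destruct Hremd as [K HK].
  (* The factor conj w in [Hk] shifts the index: frequency m of the logarithmic derivative is
     frequency m + 1 of 1 - 1 / h. *)
  assert (Hsm : forall m c, (m <= 7)%nat ->
    (forall n, (16 <= n)%nat -> cmean n (fun w => Cconj w ^ S m *
       (c1 * w ^ 2 + c3 * w ^ 4 + c5 * w ^ 6 + c7 * w ^ 8))%C = c) ->
    csmall (fun n => cmean n (fun w => Cconj w ^ m * (D1 w 0 / Ds 0 w)) - c)%C).
  { intros m c Hm Hc. apply (small_ext 16 (fun n _ => cmean n (fun w => Cconj w ^ S m * rem w)%C)).
    - intros n [] Hn _. rewrite <- (Hc n Hn), <- cmean_minus.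
      apply cmean_ext; intros w Hw. rewrite Hk by auto. unfold rem. rewrite !Cpow_S. ring.
    - intros eps He. destruct (mean_vanish _ _ _ (S m) (Rabs B) HK) with (eps := eps) as [N HN]; auto.
      + intros _ z _ Hz. eapply Rle_trans; [apply Hrem; auto|].
        apply Rmult_le_compat_l; [apply Rabs_pos|].
        replace 10%nat with (S (S m) + (8 - m))%nat by lia. rewrite pow_add.
        destruct Hz as [Z0 Z1].
        rewrite <- (Rmult_1_r (Cmod z ^ S (S m))) at 2.
        apply Rmult_le_compat_l; [apply pow_le; auto|].
        rewrite <- (pow1 (8 - m)). apply pow_incr; auto.
      + exists N; intros n Hn [] _. apply (HN n Hn tt Logic.I). }
  assert (O : forall n k j, (k <= 8)%nat -> (j <= 8)%nat -> (16 <= n)%nat -> forall c : C,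
    cmean n (fun w => Cconj w ^ k * (c * w ^ j))%C = if Nat.eqb k j then c else 0%C).
  { intros n k j Hk' Hj Hn c.
    rewrite (cmean_ext n _ (fun w => c * (Cconj w ^ k * w ^ j))%C) by (intros; ring).
    rewrite cmean_scal.
    destruct (Nat.eqb_spec k j) as [->|Hne'].
    - rewrite cmean_orth_eq; ring.
    - destruct (Nat.lt_ge_cases k j); [rewrite cmean_orth_gt by lia|rewrite cmean_orth_lt by lia]; ring. }
  assert (O4 : forall n k, (k <= 8)%nat -> (16 <= n)%nat ->
    cmean n (fun w => Cconj w ^ k * (c1 * w ^ 2 + c3 * w ^ 4 + c5 * w ^ 6 + c7 * w ^ 8))%C
    = ((if Nat.eqb k 2 then c1 else 0) + (if Nat.eqb k 4 then c3 else 0)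
       + (if Nat.eqb k 6 then c5 else 0) + (if Nat.eqb k 8 then c7 else 0))%C).
  { intros n k Hk' Hn. rewrite (cmean_ext n _ (fun w => Cconj w ^ k * (c1 * w ^ 2)
      + Cconj w ^ k * (c3 * w ^ 4) + Cconj w ^ k * (c5 * w ^ 6) + Cconj w ^ k * (c7 * w ^ 8))%C)
      by (intros; ring). rewrite !cmean_plus, !O by lia. reflexivity. }
  apply (area_theorem phis Ds D1 c1 c3 c5 c7 Hps HD1 HDs);
    apply Hsm; try lia; intros n Hn; rewrite O4 by lia; simpl Nat.eqb; cbv iota; ring.
Qed.
End OddRoot.

(** * Dilated univalent functions *)

Section Univalent.
Variables (f : C -> C) (a : nat -> C) (R0 : R).
Hypothesis Hf : in_class_S f a.
Hypothesis HR : 0 < R0 < 1.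

(** Coefficients of f(R0 v) / (R0 v), called [F] below. *)
Let b (n : nat) : C := (a (S n) * R0 ^ n)%C.

Lemma scaled_summable :
  ex_series (fun n => INR n ^ 3 * Cmod (b n)) /\ ex_series (fun n => Cmod (b n)).
Proof.
  (* The terms are bounded at the intermediate radius r, which gives geometric decay with ratio R0 /
     r at radius R0. *)
  destruct Hf as (HT & _). set (r := (1 + R0) / 2). assert (Hr : R0 < r < 1) by (unfold r; lra).
  assert (Hd : unit_disk (RtoC r)) by (unfold unit_disk; rewrite Cmod_R, Rabs_pos_eq; lra).
  destruct (is_pseries_C _ _ _ (HT _ Hd)) as [_ [M HM]].
  set (q := R0 / r). assert (Hq : 0 <= q < 1).
  { unfold q; split; [apply Rle_div_r; lra|]. apply (Rmult_lt_reg_r r); [lra|].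
    replace (R0 / r * r) with R0 by (field; lra). lra. }
  assert (Hb : forall n, Cmod (b n) <= M / r * q ^ n).
  { intros n. specialize (HM (S n)).
    rewrite Cmod_mult, Cmod_pow, Cmod_R, Rabs_pos_eq in HM by lra.
    unfold b. rewrite Cmod_mult, Cmod_pow, Cmod_R, Rabs_pos_eq by lra.
    assert (Hrn : 0 < r ^ n) by (apply pow_lt; lra).
    replace (M / r * q ^ n) with (M * (R0 ^ n / (r * r ^ n))).
    2:{ unfold q, Rdiv. rewrite Rpow_mult_distr, pow_inv. field. split; lra. }
    replace (Cmod (a (S n)) * R0 ^ n) with (Cmod (a (S n)) * r ^ S n * (R0 ^ n / (r * r ^ n)))
      by (simpl; field; split; lra).
    apply Rmult_le_compat_r; auto.
    apply Rle_div_r; [apply Rmult_lt_0_compat; lra|]. rewrite Rmult_0_l. apply pow_le; lra. }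
  assert (HM0 : 0 <= M / r).
  { pose proof (Rle_trans _ _ _ (Cmod_ge_0 _) (Hb 0%nat)) as H0. rewrite pow_O in H0. lra. }
  split.
  - apply (ex_series_le (fun n => INR n ^ 3 * Cmod (b n)) (fun n => M / r * (INR n ^ 3 * q ^ n))).
    + intros n. change (Rabs (INR n ^ 3 * Cmod (b n)) <= M / r * (INR n ^ 3 * q ^ n)).
      assert (0 <= INR n ^ 3) by (apply pow_le, pos_INR).
      rewrite Rabs_pos_eq by (apply Rmult_le_pos; [auto|apply Cmod_ge_0]).
      replace (M / r * (INR n ^ 3 * q ^ n)) with (INR n ^ 3 * (M / r * q ^ n)) by ring.
      apply Rmult_le_compat_l; auto.
    + apply (ex_series_scal_l (M / r) (fun n => INR n ^ 3 * q ^ n)), ex_series_cube_geom; auto.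
  - apply (ex_series_le (fun n => Cmod (b n)) (fun n => M / r * q ^ n)).
    + intros n. change (Rabs (Cmod (b n)) <= M / r * q ^ n).
      rewrite Rabs_pos_eq by apply Cmod_ge_0. auto.
    + apply (ex_series_scal_l (M / r) (fun n => q ^ n)), ex_series_geom.
      rewrite Rabs_pos_eq; lra.
Qed.

Let F (v : C) : C := csum (fun n => b n * v ^ n)%C.

Lemma scaled_disk (v : C) : cdisk v -> unit_disk (R0 * v)%C.
Proof.
  intros [H0 H1]. unfold unit_disk. rewrite Cmod_mult, Cmod_R, Rabs_pos_eq by lra. nra.
Qed.

Lemma scaled_f (v : C) : cdisk v -> f (R0 * v)%C = (R0 * v * F v)%C.
Proof.
  intros Hv. destruct Hf as (HT & _ & Ha0 & _).
  destruct (is_pseries_C _ _ _ (HT _ (scaled_disk v Hv))) as [E _]. rewrite <- E.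
  destruct scaled_summable as [_ Hs].
  assert (Hd : forall n, Cmod (b n * v ^ n)%C <= Cmod (b n)).
  { intros n. rewrite <- (Rmult_1_r (Cmod (b n))).
    apply Cmod_mul_le; [lra|apply Cmod_pow_le1, Hv]. }
  unfold F. rewrite <- (csum_scal _ _ _ Hd Hs).
  set (u := fun n => (a n * (R0 * v) ^ n)%C).
  assert (Hu : forall n, u (S n) = (R0 * v * (b n * v ^ n))%C).
  { intros n. unfold u, b. rewrite Cpow_S, Cpow_mult_l. ring. }
  set (d := fun n => match n with 0%nat => Cmod (u 0%nat) | S m => Cmod (R0 * v)%C * Cmod (b m) end).
  rewrite (csum_incr_1 u d).
  - unfold u at 1. rewrite Ha0. rewrite (csum_ext _ _ Hu). ring.
  - intros [|n]; [simpl; lra|]. rewrite Hu. simpl. apply Cmod_mul_le; [lra|auto].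
  - apply (ex_series_incr_1 d). apply (ex_series_scal_l (Cmod (R0 * v)%C) (fun n => Cmod (b n)) Hs).
Qed.

(** F has no zeros, so it has a square root h with h(0) = 1; z h(z^2) is injective and its
    reciprocal expands as 1 / z - w1 z - w3 z^3 - ..., whose exponents explain the odd indices. *)
Lemma scaled_area (w1 w3 w5 w7 : C) : inv_sqrt_coefs b w1 w3 w5 w7 ->
  Cmod w1 ^ 2 + 3 * Cmod w3 ^ 2 + 5 * Cmod w5 ^ 2 + 7 * Cmod w7 ^ 2 <= 1.
Proof.
  intros Hw. destruct scaled_summable as [Hs3 Hs].
  pose proof cdisk_0 as Hd0.
  assert (HRc : RtoC R0 <> 0%C) by (intros E0; apply RtoC_inj in E0; lra).
  pose proof (dclass_pseries b Hs3 Hs) as HF. change (dclass F (fun z w => csum (fun n => b n * dd n z w)%C)) in HF.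
  destruct (pseries_tail 5 b Hs) as (BF & _ & HBF).
  assert (HF0 : F 0%C = 1%C).
  { destruct (pseries_tail 1 b Hs) as (B1 & _ & HB1). specialize (HB1 0%C Hd0).
    rewrite Cmod_0, pow_1, Rmult_0_r in HB1. cbn [psum] in HB1.
    rewrite (proj1 Hw) in HB1. fold (F 0%C) in HB1.
    assert (E : (F 0 - (1 + 0 * 0))%C = 0%C)
      by (apply Cmod_eq_0; pose proof (Cmod_ge_0 (F 0 - (1 + 0 * 0))%C); lra).
    replace (F 0%C) with ((F 0 - (1 + 0 * 0)) + 1)%C by ring. rewrite E; ring. }
  destruct Hf as (_ & Hinj & _).
  assert (Hinj' : forall v v', cdisk v -> cdisk v' -> (v * F v)%C = (v' * F v')%C -> v = v').
  { intros v v' Hv Hv' E.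
    assert (E1 : (R0 * v)%C = (R0 * v')%C).
    { apply Hinj; try (apply scaled_disk; auto). rewrite !scaled_f by auto.
      rewrite <- !Cmult_assoc, E. reflexivity. }
    replace v with (/ R0 * (R0 * v))%C by (field; auto). rewrite E1. field; auto. }
  (* At a zero v of F the function v F(v) takes its value at 0, so v = 0 by injectivity; but F(0) =
     1. *)
  assert (HFn : forall v, cdisk v -> F v <> 0%C).
  { intros v Hv E0. assert (v = 0%C).
    { apply Hinj'; auto. rewrite E0. ring. }
    subst v. rewrite HF0 in E0. apply RtoC_inj in E0. lra. }
  destruct (dclass_has_sqrt _ _ HF HF0 HFn) as (h & E & Hh & Hh0 & Hsq).
  assert (Hhn : forall v, cdisk v -> h v <> 0%C).
  { intros v Hv E0. apply (HFn v Hv). rewrite <- Hsq, E0 by auto. ring. }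
  destruct (inv_sqrt_taylor b w1 w3 w5 w7 F h E BF Hw HBF Hh Hh0 Hsq Hhn) as [B HB].
  (* Squaring z h(z^2) gives z^2 F(z^2), so z^2 = w^2 by injectivity of f; the common nonzero factor
     h(w^2) then excludes z = -w unless both vanish. *)
  assert (Hodd : forall z w, cdisk z -> cdisk w -> (z * h (z * z))%C = (w * h (w * w))%C -> z = w).
  { intros z w Hz Hw' Ezw.
    assert (E2 : (z * z)%C = (w * w)%C).
    { apply Hinj'; try (apply cdisk_mult; auto).
      rewrite <- !Hsq by (apply cdisk_mult; auto).
      transitivity ((z * h (z * z)) * (z * h (z * z)))%C; [ring|]. rewrite Ezw; ring. }
    assert (E3 : ((z - w) * h (w * w))%C = 0%C).
    { rewrite E2 in Ezw. replace ((z - w) * h (w * w))%C with (z * h (w * w) - w * h (w * w))%C by ring.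
      rewrite Ezw; ring. }
    assert (Hn : h (w * w)%C <> 0%C) by (apply Hhn, cdisk_mult; auto).
    replace z with ((z - w) * h (w * w) * / h (w * w) + w)%C by (field; auto).
    rewrite E3; ring. }
  (* The exponent 16 belongs to |s^8 w7|^2; the other terms carry lower powers of s, which are
     larger. *)
  apply (pow_limit _ _ 16). intros s Hs'.
  eapply Rle_trans; [|apply (odd_root_area h E w1 w3 w5 w7 B Hh Hh0 Hhn Hodd HB s Hs')].
  assert (Hk : forall k y, (2 * k <= 16)%nat -> s ^ 16 * Cmod y ^ 2 <= Cmod (RtoC s ^ k * y)%C ^ 2).
  { intros k y Hk. rewrite Cmod_mult, Cmod_pow, Cmod_R, Rabs_pos_eq by lra.
    rewrite Rpow_mult_distr. apply Rmult_le_compat_r; [apply pow2_ge_0|].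
    rewrite <- pow_mult. replace 16%nat with (k * 2 + (16 - k * 2))%nat by lia. rewrite pow_add.
    rewrite <- (Rmult_1_r (s ^ (k * 2))) at 2. apply Rmult_le_compat_l; [apply pow_le; lra|].
    rewrite <- (pow1 (16 - k * 2)). apply pow_incr; lra. }
  pose proof (Hk 2%nat w1 ltac:(lia)). pose proof (Hk 4%nat w3 ltac:(lia)).
  pose proof (Hk 6%nat w5 ltac:(lia)). pose proof (Hk 8%nat w7 ltac:(lia)). lra.
Qed.

(** Logarithmic coefficients are homogeneous: R0^n gamma_n belongs to the dilated function. The w's
    come from solving the triangular system [inv_sqrt_coefs] one after another. *)
Lemma scaled_bound :
  R0 ^ 4 * Cmod (gamma4 a) <= R0 ^ 3 * Cmod (gamma3 a) + 1 / sqrt 7.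
Proof.
  set (w1 := (b 1%nat / 2)%C).
  set (w3 := ((b 2%nat - 3 * (w1 * w1)) / 2)%C).
  set (w5 := ((b 3%nat - 6 * (w1 * w3) - 4 * (w1 * w1 * w1)) / 2)%C).
  set (w7 := ((b 4%nat - 6 * (w1 * w5) - 3 * (w3 * w3) - 12 * (w1 * w1 * w3)
               - 5 * (w1 * w1 * w1 * w1)) / 2)%C).
  assert (Hw : inv_sqrt_coefs b w1 w3 w5 w7).
  { repeat split.
    - unfold b. rewrite (proj2 (proj2 (proj2 Hf))). simpl. ring.
    - unfold w1. field.
    - unfold w3. field.
    - unfold w5. field.
    - unfold w7. field. }
  pose proof (scaled_area w1 w3 w5 w7 Hw) as HA. destruct Hw as (_ & H1 & H2 & H3 & H4).
  clearbody w1 w3 w5 w7.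
  (* This is the third coefficient of -log (1 - w1 v - w3 v^2 - ...), because log (f v / v) is -2
     times the logarithm of sqrt (v / f v). *)
  assert (E3 : (R0 ^ 3 * gamma3 a)%C = (w5 + w1 * w3 + / 3 * (w1 * w1 * w1))%C).
  { transitivity (/ 2 * (b 3%nat - b 1%nat * b 2%nat + / 3 * (b 1%nat * b 1%nat * b 1%nat)))%C.
    - unfold b, gamma3. field.
    - rewrite H1, H2, H3. field. }
  assert (E4 : (R0 ^ 4 * gamma4 a)%C
     = (w1 * (R0 ^ 3 * gamma3 a) + w7 + / 2 * (w3 * w3) - / 12 * (w1 * w1 * w1 * w1))%C).
  { rewrite E3.
    transitivity (/ 2 * (b 4%nat - b 1%nat * b 3%nat - / 2 * (b 2%nat * b 2%nat)
      + b 1%nat * b 1%nat * b 2%nat - / 4 * (b 1%nat * b 1%nat * b 1%nat * b 1%nat)))%C.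
    - unfold b, gamma4. field.
    - rewrite H1, H2, H3, H4. field. }
  pose proof (Cmod_ge_0 w1). pose proof (Cmod_ge_0 w3). pose proof (Cmod_ge_0 w7).
  pose proof (pow2_ge_0 (Cmod w3)). pose proof (pow2_ge_0 (Cmod w5)). pose proof (pow2_ge_0 (Cmod w7)).
  assert (Hw1 : Cmod w1 <= 1) by (apply Rnot_lt_le; intros Hlt; nra).
  assert (Hfin := moduli_inequality (Cmod w1) (Cmod w3) (Cmod w7) ltac:(auto) ltac:(auto) ltac:(auto)
    ltac:(lra)).
  assert (M : forall k x, Cmod (RtoC R0 ^ k * x)%C = R0 ^ k * Cmod x)
    by (intros; rewrite Cmod_mult, Cmod_pow, Cmod_R, Rabs_pos_eq by lra; reflexivity).
  rewrite <- !M. apply (f_equal Cmod) in E4. rewrite E4.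
  assert (Hi : forall r : R, 0 < r -> Cmod (/ RtoC r)%C = / r).
  { intros r Hr. rewrite <- RtoC_inv, Cmod_R, Rabs_pos_eq; [auto|left; apply Rinv_0_lt_compat; auto|lra]. }
  apply Rle_trans with (1 * Cmod (RtoC R0 ^ 3 * gamma3 a)%C + Cmod w7
     + / 2 * (Cmod w3 * Cmod w3) + / 12 * (Cmod w1 * Cmod w1 * Cmod w1 * Cmod w1)).
  - apply Cmod_sub_le; [apply Cmod_add_le; [apply Cmod_add_le; [apply Cmod_mul_le; lra|lra]|]|].
    + rewrite !Cmod_mult, Hi by lra. lra.
    + rewrite !Cmod_mult, Hi by lra. lra.
  - simpl pow in Hfin. lra.
Qed.
End Univalent.

Theorem theorem1 (f : C -> C) (a : nat -> C) :
  in_class_S f a ->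
  Cmod (gamma4 a) - Cmod (gamma3 a) <= 1 / sqrt 7.
Proof.
  intros Hf.
  enough (Cmod (gamma4 a) <= Cmod (gamma3 a) + 1 / sqrt 7) by lra.
  (* The factor t^3 on |gamma_3| is at most 1 and is discarded first, so only t^4 on |gamma_4| has
     to be removed in the limit. *)
  apply (pow_limit _ _ 4). intros t Ht. pose proof (scaled_bound f a t Hf Ht) as H.
  pose proof (Cmod_ge_0 (gamma3 a)).
  assert (t ^ 3 <= 1) by (rewrite <- (pow1 3); apply pow_incr; lra). nra.
Qed.
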